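(* For every $\tilde f \in T(\mathcal S)$ and every $t \in \mathbb R$ with $|t| \leq R/3$, $$\lim_{n \to \infty} \left\lVert \mathfrak m\left( F(p_1 \otimes \mathrm{Id})\, e^{\overline{\mathcal D} t}\, F(E_n) \tilde{f} \right) - U_t\, \mathfrak m\tilde{f} \right\rVert_{\mathcal H} = 0.$$
   Context: Setting. $X$ is a $C^\infty$ manifold and $\Phi^t \colon X \to X$, $t \in \mathbb R$, is a flow generated by a $C^\infty$ vector field $\vec V$, with derivation $Vf = \vec V \cdot \nabla f$ on $C^\infty(X)$. $\mathcal H \subset C^\infty(X)$ is a complex reproducing kernel Hilbert space (RKHS) with strictly positive-definite kernel $k$ and kernel sections $k_x = k(x,\cdot)$, so $f(x) = \langle k_x, f\rangle_{\mathcal H}$ (inner products conjugate-linear in the first argument). As an unbounded operator on $\mathcal H$, $V$ has domain $\{f \in \mathcal H : Vf \in \mathcal H\}$; $V^*$ is its adjoint. $U_t f = f \circ \Phi^t$ with domain $\{f \in \mathcal H : f\circ\Phi^t \in \mathcal H\}$. Standing assumption 1. (a) $V \colon \mathcal H \to C(X)$ is continuous for the compact-open topology on $C(X)$. (b) $\mathcal H_\infty \subseteq \mathrm{dom}(V) \cap \mathrm{dom}(V^* )$ is a dense subspace of $\mathcal H$ invariant under $V$ and $V^*$. (c) With $V_1 = V$, $V_2 = V^*$, for every $f \in \mathcal H_\infty$ the series $\sum_{n=0}^\infty \frac{z^n}{n!} \sum_{\epsilon \colon [n] \to [2]} \lVert V_{\epsilon(1)} \cdots V_{\epsilon(n)}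 f \rVert_{\mathcal H}$ has a strictly positive radius of convergence $R_f$, where $[n]=\{1,\dots,n\}$ (joint analyticity). Standing assumption 2. $\mathcal H$ is a reproducing kernel Hilbert algebra (RKHA): $k_x \mapsto k_x \otimes k_x$ extends to a bounded linear map $\Delta \colon \mathcal H \to \mathcal H \otimes \mathcal H$ (so $\Delta^*$ is pointwise multiplication). $\mathcal S \subset \mathcal H_\infty$ is a finite-dimensional subspace such that the subalgebra $\mathrm{Alg}(\mathcal S)$ generated by $\mathcal S$ is dense in $\mathcal H$. $\mathcal H$ is unital (contains the constant function $1_{\mathcal H} = 1$). $R$ is the maximal radius of joint analyticity for $\mathcal S$, i.e. the largest $R \in (0,\infty]$ such that the series in 1(c) converges for $|z|<R$ for all $f \in \mathcal S$. First amplification. On $\mathcal H_\infty$, $A = (V-V^* )/2$, $S = (V+V^* )/2$. $\mathfrak H = \ell^2(\mathbb N) \otimes \mathcal H$, $\mathfrak H_0 = C_c(\mathbb N) \otimes_{\mathrm{alg}} \mathcal H_\infty$, $e_i$ is the canonical basis of $\ell^2(\mathbb N)$, $e_{i,j}$ the matrix units ($e_{i,j}e_j = e_i$), and $L = \sum_{i\ge 1} (e_{i,i+1} \otimes S + e_{i,i} \otimes A - e_{i+1,i} \otimes S)$ on $\mathfrak H_0$, which is essentially skew-adjoint. $E_n f = \sum_{i=1}^n F_i\, e_i \otimes f$ with $F_i$ the Fibonacci numbers ($F_1=F_2=1$), $E_n\colon \mathcal H \to \mathfrak H$. $p_1 \colon \ell^2(\mathbb N) \to \mathbb C$ is the first-component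 projection. Fock space. For a Hilbert space $\mathbb H$, $\mathbb H^{\vee n}$ is the closed subspace of symmetric tensors in $\mathbb H^{\otimes n}$ ($\mathbb H^{\vee 0} = \mathbb C$), $u_1 \vee \cdots \vee u_n = \frac1{n!}\sum_{\sigma \in S_n} u_{\sigma(1)} \otimes \cdots \otimes u_{\sigma(n)}$, and $T(\mathbb H) = \bigcup_N \bigoplus_{n=0}^N \mathbb H^{\vee n}$. $F_w(\mathbb H)$ is the Hilbert space completion of $\bigoplus_n (\mathbb H^{\vee n}, w(n)^2 \langle\cdot,\cdot\rangle_{\mathbb H^{\vee n}})$, with weights $w(n) = e^{\tau n^p}$, $\tau>0$, $p \in (0,1)$. $\mathfrak F = F_w(\mathfrak H)$. $T(\mathcal S) \subset T(\mathcal H)$ is the symmetric tensor algebra of $\mathcal S$. For a bounded linear map $B \colon \mathbb H \to \mathbb K$, $F(B) = \bigoplus_k B^{\vee k}$, mapping $T(\mathbb H) \to T(\mathbb K)$ (and bounded on $F_w$ if $\|B\|\le 1$). $\mathcal D$ is the operator on $\mathfrak F$ with domain the linear span of $1 \in \mathbb C$ and all $v_1 \vee\cdots\vee v_n$, $v_i \in \mathfrak H_0$, given by $\mathcal D 1 = 0$ and $\mathcal D(v_1 \vee \cdots \vee v_n) = \sum_i v_1 \vee \cdots \vee Lv_i \vee \cdots \vee v_n$; it is essentially skew-adjoint with closure $\overline{\mathcal D}$, and $e^{t\overline{\mathcal D}} = F(e^{t \overline L})$. Finally $\mathfrak m \colon T(\mathcal H) \to \mathcal H$ is $\mathfrak m(z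 \oplus \bigoplus_{n=1}^N f_n) = z 1_{\mathcal H} + \sum_{n=1}^N \Delta_n^* f_n$, where $\Delta_n^* \colon \mathcal H^{\otimes n} \to \mathcal H$ is the bounded $n$-fold pointwise multiplication map, $\Delta_n^*(g_1 \otimes\cdots\otimes g_n) = g_1\cdots g_n$. *)

(* Defs.v *)
(* Complex scalars are [R[i]]; their topology is carried by the alias [R[i]^o]. *)
From HB Require Import structures.
From mathcomp Require Import all_boot all_order all_fingroup all_algebra.
From mathcomp Require Import all_classical all_reals all_analysis.
From mathcomp Require Import complex.

Set Implicit Arguments.
Unset Strict Implicit.
Unset Printing Implicit Defensive.

Import Order.TTheory GRing.Theory Num.Theory ComplexField.
Import numFieldNormedType.Exports.

Local Open Scope classical_set_scope.
Local Open Scope ring_scope.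
Local Open Scope complex_scope.

(* [Ck k Om g], for [Om] open: the partial derivatives of [g] of order at most *)
(* [k] exist and are continuous at every point of [Om].                        *)
Fixpoint Ck (R : realType) (d k : nat) (Om : set 'rV[R]_d)
    (g : 'rV[R]_d -> R) : Prop :=
  (forall y, Om y -> {for y, continuous g}) /\
  if k is k'.+1 then
    forall i : 'I_d,
      (forall y, Om y -> derivable g y (delta_mx 0 i)) /\
      Ck k' Om (fun y => 'D_(delta_mx 0 i) g y)
  else True.

Definition smooth_on (R : realType) (d : nat) (Om : set 'rV[R]_d)
  (g : 'rV[R]_d -> R) : Prop := forall k, Ck k Om g.

Record chart (R : realType) (X : topologicalType) (d : nat) := Chart {
  cdom : set X;
  cto : X -> 'rV[R]_d;
  cof : 'rV[R]_d -> X;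
  cdom_open : open cdom;
  cimage_open : open (cto @` cdom);
  cto_cont : forall x, cdom x -> {for x, continuous cto};
  cof_cont : forall y, (cto @` cdom) y -> {for y, continuous cof};
  ctoK : forall x, cdom x -> cof (cto x) = x }.

Definition smooth_manifold (R : realType) (X : topologicalType) (d : nat)
    (atlas : set (chart R X d)) : Prop :=
  [/\ hausdorff_space X,
      @second_countable X,
      (forall x : X, exists2 c, atlas c & cdom c x) &
      (forall c1 c2, atlas c1 -> atlas c2 -> forall j : 'I_d,
        smooth_on (cto c1 @` (cdom c1 `&` cdom c2))
                  (fun y => cto c2 (cof c1 y) 0 j))].

Definition smooth (R : realType) (X : topologicalType) (d : nat)
    (atlas : set (chart R X d)) (f : X -> R) : Prop :=
  forall c, atlas c -> smooth_on (cto c @` cdom c) (f \o cof c).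

Definition smoothC (R : realType) (X : topologicalType) (d : nat)
    (atlas : set (chart R X d)) (f : X -> R[i]) : Prop :=
  smooth atlas (fun x => complex.Re (f x)) /\
  smooth atlas (fun x => complex.Im (f x)).

(* A smooth vector field, tangent vectors being derivations at a point: [V f x] *)
(* is the value at [f] of the tangent vector at [x]. Only smooth [f] matter.   *)
Definition smooth_vector_field (R : realType) (X : topologicalType) (d : nat)
    (atlas : set (chart R X d)) (V : (X -> R) -> X -> R) : Prop :=
  [/\ (forall f g (a : R) x, smooth atlas f -> smooth atlas g ->
         V (fun y => a * f y + g y) x = a * V f x + V g x),
      (forall f g x, smooth atlas f -> smooth atlas g ->
         V (fun y => f y * g y) x = f x * V g x + V f x * g x) &
      (forall f, smooth atlas f -> smooth atlas (V f))].

Definition flow_generated_by (R : realType) (X : topologicalType) (d : nat)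
    (atlas : set (chart R X d)) (V : (X -> R) -> X -> R) (Phi : R -> X -> X) :
    Prop :=
  [/\ (forall x, Phi 0 x = x),
      (forall s t x, Phi (s + t) x = Phi s (Phi t x)) &
      (forall f, smooth atlas f -> forall (t : R) x,
         is_derive t 1 (fun s : R => f (Phi s x)) (V f (Phi t x)))].

Definition vfC (R : realType) (X : Type) (V : (X -> R) -> X -> R)
    (f : X -> R[i]) : X -> R[i] :=
  fun x => (V (fun y => complex.Re (f y)) x) +i* (V (fun y => complex.Im (f y)) x).

HB.mixin Record isHilbert (R : realType) V of CompleteNormedModule R[i] V := {
  dot : V -> V -> R[i];
  dot_linear : forall (x y z : V) (a : R[i]),
    dot x (a *: y + z) = a * dot x y + dot x z;
  dot_conj : forall x y : V, dot y x = (dot x y)^*;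
  dot_norm : forall x : V, dot x x = `|x| ^+ 2
}.

#[short(type="hilbertType")]
HB.structure Definition Hilbert (R : realType) :=
  {V of isHilbert R V & CompleteNormedModule R[i] V}.

Definition linear_subspace (R : realType) (E : lmodType R[i]) (A : set E) : Prop :=
  A 0 /\ forall (a : R[i]) x y, A x -> A y -> A (a *: x + y).

Definition lspan (R : realType) (E : lmodType R[i]) (A : set E) : set E :=
  smallest (@linear_subspace R E) A.

Definition bounded_linear (R : realType) (E F : hilbertType R) (B : E -> F) :
  Prop := linear B /\ continuous B.

Definition op_dom (E F : Type) (G : set (E * F)) : set E :=
  [set x | exists y, G (x, y)].

(* The value at [x] of the operator with graph [G]; meaningful for [x] in      *)
(* [op_dom G] and [G] single-valued.                                           *)
Definition op_app (E : Type) (F : pointedType) (G : set (E * F)) (x : E) : F :=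
  get [set y | G (x, y)].

Definition op_adjoint (R : realType) (E : hilbertType R) (G : set (E * E)) :
    set (E * E) :=
  [set p | forall q, G q -> dot p.2 q.1 = dot p.1 q.2].

Definition unitary_group (R : realType) (E : hilbertType R) (W : R -> E -> E) :
    Prop :=
  [/\ (forall t, linear (W t)),
      (forall t u v, dot (W t u) (W t v) = dot u v),
      W 0 = id,
      (forall s t u, W (s + t) u = W s (W t u)) &
      (forall u, continuous (fun t : R => W t u))].

Definition group_generator (R : realType) (E : hilbertType R) (W : R -> E -> E) :
    set (E * E) :=
  [set p | (h^-1)%:C *: (W h p.1 - p.1) @[h --> (0 : R)^'] --> p.2].

(* [exp_group T t] is e^{tT} for a skew-op_adjoint operator with graph [T]: the *)
(* strongly continuous unitary group whose generator is exactly [T].           *)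
Definition exp_group (R : realType) (E : hilbertType R) (T : set (E * E)) :
    R -> E -> E :=
  get [set W : R -> E -> E | unitary_group W /\ group_generator W = T].

(* Linearity of [ev] follows from [reproducing]; with [ev_inj] the space is a  *)
(* space of functions on [X], with pointwise operations.                       *)
Record rkhs (R : realType) (X : Type) := RKHS {
  rkhs_space :> hilbertType R;
  ev : rkhs_space -> X -> R[i];
  ksec : X -> rkhs_space;
  reproducing : forall x f, ev f x = dot (ksec x) f;
  ev_inj : injective ev }.

Definition kernel_of (R : realType) (X : Type) (H : rkhs R X) (x y : X) : R[i] :=
  ev (ksec H x) y.

Definition strictly_positive_definite (R : realType) (X : Type)
    (k : X -> X -> R[i]) : Prop :=
  forall (n : nat) (x : 'I_n -> X) (c : 'I_n -> R[i]),
    injective x -> (exists i, c i != 0) ->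
    0 < \sum_i \sum_j (c i)^* * c j * k (x i) (x j).

Definition subalgebra (R : realType) (X : Type) (H : rkhs R X) (A : set H) :
    Prop :=
  linear_subspace A /\
  forall f g h : H, A f -> A g -> ev h = (fun x => ev f x * ev g x) -> A h.

Definition Alg (R : realType) (X : Type) (H : rkhs R X) (A : set H) : set H :=
  smallest (@subalgebra R X H) A.

Definition finite_dimensional (R : realType) (E : hilbertType R) (A : set E) :
  Prop := exists s : seq E, A = lspan [set` s].

Definition Vop (R : realType) (X : Type) (V : (X -> R) -> X -> R)
    (H : rkhs R X) : set (H * H) :=
  [set p | ev p.2 = vfC V (ev p.1)].
Arguments Vop {R X} V H.

Definition koopman (R : realType) (X : Type) (Phi : R -> X -> X)
    (H : rkhs R X) (t : R) : set (H * H) :=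
  [set p | ev p.2 = ev p.1 \o Phi t].
Arguments koopman {R X} Phi H t.

Definition word (R : realType) (E : hilbertType R) (G : set (E * E))
    (eps : seq bool) (f : E) : E :=
  foldr (fun b g => op_app (if b then op_adjoint G else G) g) f eps.

(* The series sum_n z^n/n! sum_eps |V_eps(1) ... V_eps(n) f| converges for all *)
(* complex |z| < r; [false] and [true] in [eps] stand for V and V^*.           *)
Definition jointly_analytic_on (R : realType) (E : hilbertType R)
    (G : set (E * E)) (f : E) (r : \bar R) : Prop :=
  forall z : R[i], ((complex.Re `|z|)%:E < r)%E ->
    cvgn (series (fun n => z ^+ n / n`!%:R *
            \sum_(eps : n.-tuple bool) `|word G eps f|) : nat -> R[i]^o).

(* The supremum is attained.                                                   *)
Definition joint_radius (R : realType) (E : hilbertType R) (G : set (E * E))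
    (A : set E) : \bar R :=
  ereal_sup [set r | forall f, A f -> jointly_analytic_on G f r].

(* A Hilbert tensor product of [E] and [F], determined up to a unique unitary   *)
(* compatible with [tens]; the formula for the inner product forces             *)
(* bilinearity. [tensor_powers], [ell2] and [fock_space] likewise describe a    *)
(* Hilbert space by its defining properties, up to a unique unitary.            *)
Record hilbert_tensor (R : realType) (E F : hilbertType R) := HilbertTensor {
  tens_space :> hilbertType R;
  tens : E -> F -> tens_space;
  tens_dot : forall a b a' b',
    dot (tens a b) (tens a' b') = dot a a' * dot b b';
  tens_dense : dense (lspan [set u | exists a b, u = tens a b]) }.

Record tensor_powers (R : realType) (E : hilbertType R) := TensorPowers {
  tpow :> nat -> hilbertType R;
  tp : forall n, ('I_n -> E) -> tpow n;
  tp_dot : forall n (u v : 'I_n -> E),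
    dot (tp u) (tp v) = \prod_i dot (u i) (v i);
  tp_dense : forall n, dense (lspan (range (@tp n))) }.

(* ell^2(N) with its canonical basis; [l2e i] is e_{i+1}.                      *)
Record ell2 (R : realType) := Ell2 {
  l2 :> hilbertType R;
  l2e : nat -> l2;
  l2e_orthonormal : forall i j, dot (l2e i) (l2e j) = (i == j)%:R;
  l2e_dense : dense (lspan (range l2e)) }.

(* Invariance of [u] under the unitaries permuting the tensor factors, tested  *)
(* against the total family of elementary tensors.                             *)
Definition symmetric_tensor (R : realType) (E : hilbertType R)
    (T : tensor_powers E) (n : nat) (u : T n) : Prop :=
  forall (s : 'S_n) (v : 'I_n -> E),
    dot (tp T (fun i => v (s i))) u = dot (tp T v) u.

Definition vee (R : realType) (E : hilbertType R) (T : tensor_powers E)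
    (n : nat) (u : 'I_n -> E) : T n :=
  (n`!%:R)^-1 *: \sum_(s : 'S_n) tp T (fun i => u (s i)).

Definition tensor_map (R : realType) (E F : hilbertType R)
    (TE : tensor_powers E) (TF : tensor_powers F) (B : E -> F) (n : nat) :
    TE n -> TF n :=
  get [set P : TE n -> TF n |
        bounded_linear P /\ forall u, P (tp TE u) = tp TF (B \o u)].

Definition weight (R : realType) (tau p : R) (n : nat) : R :=
  expR (tau * (n%:R `^ p)).

(* The completion of the direct sum of the spaces of symmetric tensors with    *)
(* inner products w(n)^2 <.,.>. Only the values of [fock_inj n] at symmetric tensors *)
(* are relevant. Degree 0 is identified with the scalars by z |-> z *: tp _,   *)
(* where [tp] is the empty tensor, a unit vector.                              *)
Record fock_space (R : realType) (E : hilbertType R) (T : tensor_powers E)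
    (w : nat -> R) := FockSpace {
  fock :> hilbertType R;
  fock_inj : forall n, T n -> fock;
  fock_dot : forall n (u v : T n), symmetric_tensor u -> symmetric_tensor v ->
    dot (fock_inj u) (fock_inj v) = (w n ^+ 2)%:C * dot u v;
  fock_orth : forall m n (u : T m) (v : T n), m != n ->
    symmetric_tensor u -> symmetric_tensor v -> dot (fock_inj u) (fock_inj v) = 0;
  fock_dense : dense (lspan [set x | exists n (u : T n),
                       symmetric_tensor u /\ x = fock_inj u]) }.

Definition Tfin (R : realType) (E : hilbertType R) (T : tensor_powers E)
    (w : nat -> R) (F : fock_space T w) : set F :=
  [set x | exists (N : nat) (a : forall n, T n),
     (forall n, symmetric_tensor (a n)) /\ x = \sum_(n < N.+1) fock_inj F (a n)].

(* T(A) for a finite-dimensional subspace [A]: the symmetric tensor power of   *)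
(* degree [n] of [A] is the span of the products [vee u], [u] in [A]^n.        *)
Definition Tsub (R : realType) (E : hilbertType R) (T : tensor_powers E)
    (w : nat -> R) (F : fock_space T w) (A : set E) : set F :=
  lspan [set x | exists n (u : 'I_n -> E),
          (forall i, A (u i)) /\ x = fock_inj F (vee T u)].

(* The component of degree [n] (orthogonal projection). *)
Definition component (R : realType) (E : hilbertType R) (T : tensor_powers E)
    (w : nat -> R) (F : fock_space T w) (n : nat) (x : F) : T n :=
  get [set a : T n | symmetric_tensor a /\
        forall v : T n, symmetric_tensor v ->
          dot (fock_inj F v) x = (w n ^+ 2)%:C * dot v a].

(* F(B); the limit is a finite sum on T(E). *)
Definition fock_map (R : realType) (E E' : hilbertType R)
    (T : tensor_powers E) (T' : tensor_powers E') (w : nat -> R)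
    (F : fock_space T w) (F' : fock_space T' w) (B : E -> E') (x : F) : F' :=
  limn (fun N => \sum_(n < N) fock_inj F' (tensor_map T' B (component n x))).

(* Graph of the derivation extending the operator with graph [L]; the case     *)
(* [n = 0] is D 1 = 0.                                                         *)
Definition fock_derivation (R : realType) (E : hilbertType R)
    (T : tensor_powers E) (w : nat -> R) (F : fock_space T w)
    (L : set (E * E)) : set (F * F) :=
  lspan [set p | exists n (v Lv : 'I_n -> E),
    (forall i, L (v i, Lv i)) /\
    p = (fock_inj F (vee T v),
         \sum_(i < n) fock_inj F (vee T (fun j => if j == i then Lv j else v j)))].

Section Amplification.
Context (R : realType) (X : Type) (H : rkhs R X).

Definition is_rkha (T : tensor_powers H) : Prop :=
  exists Delta : H -> T 2, bounded_linear Delta /\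
    forall x, Delta (ksec H x) = tp T (fun _ : 'I_2 => ksec H x).

Definition mult_map (T : tensor_powers H) (n : nat) : T n -> H :=
  get [set M : T n -> H | bounded_linear M /\
        forall (g : 'I_n -> H) x, ev (M (tp T g)) x = \prod_i ev (g i) x].

(* On T(H) the sum has finitely many nonzero terms; [mult_map] of degree 0 maps *)
(* the empty tensor to the unit function.                                      *)
Definition mm (T : tensor_powers H) (w : nat -> R) (F : fock_space T w)
    (x : F) : H :=
  \sum_(n \in [set: nat]) mult_map (component n x).

Definition anti_part (G : set (H * H)) (f : H) : H :=
  2^-1 *: (op_app G f - op_app (op_adjoint G) f).

Definition sym_part (G : set (H * H)) (f : H) : H :=
  2^-1 *: (op_app G f + op_app (op_adjoint G) f).

Context (ell : ell2 R) (K : hilbert_tensor ell H).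

Definition matrix_unit (i j : nat) (x : ell) : ell :=
  dot (l2e ell j) x *: l2e ell i.

(* Graph of L = sum_i (e_{i,i+1} (x) S + e_{i,i} (x) A - e_{i+1,i} (x) S) on   *)
(* the algebraic tensor product of C_c(N) and [D]; at e_j (x) f the terms with *)
(* i > j vanish.                                                               *)
Definition Lop (G : set (H * H)) (D : set H) : set (K * K) :=
  lspan [set p | exists (j : nat) (f : H), D f /\
    p = (tens K (l2e ell j) f,
         \sum_(i < j.+1)
           (tens K (matrix_unit i i.+1 (l2e ell j)) (sym_part G f)
            + tens K (matrix_unit i i (l2e ell j)) (anti_part G f)
            - tens K (matrix_unit i.+1 i (l2e ell j)) (sym_part G f)))].

Fixpoint fib (n : nat) : nat :=
  match n with
  | 0 => 0
  | 1 => 1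
  | (m.+1 as n').+1 => fib n' + fib m
  end.

Definition En (n : nat) (f : H) : K :=
  \sum_(i < n) (fib i.+1)%:R *: tens K (l2e ell i) f.

Definition p1Id : K -> H :=
  get [set P : K -> H | bounded_linear P /\
        forall x f, P (tens K x f) = dot (l2e ell 0) x *: f].

End Amplification.

Arguments Tfin {R E T w} F x.
Arguments Tsub {R E T w} F A x.
Arguments fock_derivation {R E T w} F L p.
Arguments Lop {R X H ell} K G D p.
Arguments En {R X H ell} K n f.
Arguments p1Id {R X H ell} K.

(* Main.v *)
(* A curve [c] is a trajectory of the skew operator [G] when [c' = G c] along   *)
(* it, for the closure of [G]. Trajectories conserve the norm, and as soon as   *)
(* the starting points of the global ones are dense, trajectories are the       *)
(* orbits of a unitary group generated by the closure of [G]. For the           *)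
(* derivation on Fock space the products [c_1 v ... v c_n] of trajectories of   *)
(* [L] are trajectories, so [e^{tD}] acts factor by factor.                     *)
(*                                                                              *)
(* Trajectories of [L] starting at finite columns [sum_j e_j (x) g_j] are power *)
(* series: the first components of [L^m E_n f] are bounded by [2^m] times       *)
(* the sum [W_m] of the norms of all words of length [m] in [V] and [V^*], and  *)
(* radius [2|t| < R] is enough. The relation [F_(i+2) - F_i = F_(i+1)] makes    *)
(* the full Fibonacci column intertwine [V = S + A] with [L]; truncated at [n], *)
(* it still gives [V^m f] as first component of [L^m E_n f] for [m < n]. Hence  *)
(* [p_1 e^{tL} E_n f] tends to [sum_m t^m/m! V^m f], which is [f o Phi^t] by    *)
(* Taylor's formula along the flow, because point evaluations are uniformly     *)
(* bounded on a reproducing kernel Hilbert algebra. Multiplication is           *)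
(* continuous on tensor powers by the Schur product theorem, and [f o Phi^t]    *)
(* is multiplicative in [f].                                                    *)
Require Import Defs.
From HB Require Import structures.
From mathcomp Require Import all_boot all_order all_fingroup all_algebra.
From mathcomp Require Import all_classical all_reals all_analysis.
From mathcomp Require Import complex.
From mathcomp Require Import ring lra zify.
Import Order.TTheory GRing.Theory Num.Theory ComplexField.
Import numFieldNormedType.Exports.
Local Open Scope classical_set_scope.
Local Open Scope ring_scope.
Local Open Scope complex_scope.

Set Implicit Arguments.
Unset Strict Implicit.
Unset Printing Implicit Defensive.

(** * Limits in complex normed spaces *)

(** [L] is skew, yet on the Fibonacci column [sum_j F_j e_j (x) f] it acts like [V = S + A]: row [i]
    of [L] gives [(F_(i+1) - F_(i-1)) S f + F_i A f = F_i V f]. So a unitary evolution can reproduce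
    the generally non-unitary Koopman evolution, once the error of truncating the column is
    controlled on the first component.

    Exponentials are only known through their specification, so they are computed by solving
    differential equations. [stone_trajectories] produces a unitary group from a dense set of global
    trajectories, and [group_local_trajectory] identifies every group with that generator along
    every trajectory, even one defined only for short times. Global trajectories come from vectors
    whose iterates have exponential series of positive radius ([analytic_trajectory], in the spirit
    of Nelson's analytic vector theorem). The product rule carries trajectories of [L] to the
    derivation ([fock_trajectory]), so its exponential acts on each factor of a symmetric product
    separately ([exp_group_fvee]).

    For one factor, [jacobi_bound] dominates the iterates of [L] by word norms uniformly in the
    truncation, [jacobi_fib] shows that the first [n] Taylor coefficients are exact, and
    [compression_cvg] concludes by dominated convergence. [flow_series] recognises the limit as [f]
    composed with the flow. Products of factors pass to the limit because multiplication is bounded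
    on every tensor power ([mult_mapP]), which follows from the positivity of [C^2 k - k^2]
    ([rkha_kernel]) and the Schur product theorem ([psd_gram]). Linearity extends the result from
    symmetric products to their span. *)

Section RealNorm.
Context {R : realType}.
Implicit Types E F : normedModType R[i].

(** The norm of a module over [R[i]] takes values in [R[i]]; this is the same number read in [R], so
    that real order, real limits and [lra] apply. *)
Definition nrm E (x : E) : R := complex.Re `|x|.

Lemma nrmE E (x : E) : `|x| = (nrm x)%:C.
Proof. by rewrite RRe_real// ger0_real. Qed.

Lemma nrm_ge0 E (x : E) : 0 <= nrm x.
Proof. by rewrite -ler0c -nrmE. Qed.

Lemma nrm0 E : nrm (0 : E) = 0.
Proof. by rewrite /nrm normr0. Qed.

Lemma nrm_eq0 E (x : E) : nrm x = 0 -> x = 0.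
Proof. by move=> x0; apply/normr0_eq0; rewrite nrmE x0. Qed.

Lemma nrmN E (x : E) : nrm (- x) = nrm x.
Proof. by rewrite /nrm normrN. Qed.

Lemma nrmBC E (x y : E) : nrm (x - y) = nrm (y - x).
Proof. by rewrite /nrm distrC. Qed.

Lemma nrmD E (x y : E) : nrm (x + y) <= nrm x + nrm y.
Proof. by rewrite -lecR rmorphD /= -!nrmE ler_normD. Qed.

Lemma nrmB E (x y : E) : nrm (x - y) <= nrm x + nrm y.
Proof. by rewrite -(nrmN y) nrmD. Qed.

Lemma nrm_dist E (z x y : E) : nrm (x - y) <= nrm (x - z) + nrm (z - y).
Proof. by rewrite -lecR rmorphD /= -!nrmE ler_distD. Qed.

Lemma nrmZ E (a : R[i]) (x : E) : nrm (a *: x) = nrm (a : R[i]^o) * nrm x.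
Proof. by apply: complexI; rewrite rmorphM /= -!nrmE normrZ. Qed.

Lemma nrmC (a : R) : nrm (a%:C : R[i]^o) = `|a|.
Proof. by rewrite /nrm normc_def /= expr0n addr0 sqrtr_sqr. Qed.

Lemma nrmZr E (a : R) (x : E) : nrm (a%:C *: x) = `|a| * nrm x.
Proof. by rewrite nrmZ nrmC. Qed.

Lemma nrm_sum E (I : Type) (s : seq I) (P : pred I) (f : I -> E) :
  nrm (\sum_(i <- s | P i) f i) <= \sum_(i <- s | P i) nrm (f i).
Proof.
elim/big_ind2: _ => [|x a y b xa yb|//]; first by rewrite nrm0.
by apply: le_trans (nrmD _ _) (lerD xa yb).
Qed.

Lemma cvg_nrmP E T (F : set_system T) {FF : Filter F} (f : T -> E) l :
  f @ F --> l <-> forall e : R, 0 < e -> \forall x \near F, nrm (l - f x) < e.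
Proof.
rewrite cvgrPdist_lt; split => H e e0.
  have := H e%:C; rewrite ltcR => /(_ e0).
  by apply: filterS => x; rewrite nrmE ltcR.
(* A positive element of [R[i]] is real, so complex radii can be replaced by real ones. *)
have ee : e = (complex.Re e)%:C by rewrite RRe_real// gtr0_real.
move: e0; rewrite ee ltcR => e0.
by have := H _ e0; apply: filterS => x; rewrite nrmE ltcR.
Qed.

Lemma cvg_nrm0 E T (F : set_system T) {FF : Filter F} (f : T -> E) l :
  f @ F --> l <-> nrm (l - f x) @[x --> F] --> (0 : R).
Proof.
rewrite cvg_nrmP cvgrPdist_lt; split => H e e0; have := H e e0;
  by apply: filterS => x; rewrite sub0r normrN ger0_norm ?nrm_ge0.
Qed.

Lemma cvg_nrm_le E T (F : set_system T) {FF : Filter F} (f : T -> E) l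
    (g : T -> R) :
  (\forall x \near F, nrm (l - f x) <= g x) -> g @ F --> (0 : R) -> f @ F --> l.
Proof.
move=> fg g0; apply/cvg_nrm0; apply: (squeeze_cvgr _ (cvg_cst 0) g0).
by apply: filterS fg => x ->; rewrite nrm_ge0.
Qed.

Lemma cvgZc E T (F : set_system T) {FF : Filter F} (f : T -> E) (a : R[i]) l :
  f @ F --> l -> a *: f i @[i --> F] --> a *: l.
Proof.
move=> /cvg_nrm0 fl.
apply: (@cvg_nrm_le _ _ _ _ _ _ (fun i => nrm (a : R[i]^o) * nrm (l - f i))).
  by apply: nearW => i; rewrite -scalerBr nrmZ.
by rewrite -[X in _ --> X](mulr0 (nrm (a : R[i]^o))); exact: cvgMl_tmp.
Qed.

Lemma cvgDc E T (F : set_system T) {FF : Filter F} (f g : T -> E) l m :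
  f @ F --> l -> g @ F --> m -> f i + g i @[i --> F] --> l + m.
Proof. exact: cvgD. Qed.

Lemma cvgBc E T (F : set_system T) {FF : Filter F} (f g : T -> E) l m :
  f @ F --> l -> g @ F --> m -> f i - g i @[i --> F] --> l - m.
Proof. exact: cvgB. Qed.

Lemma cvg_sumc E T (F : set_system T) {FF : Filter F} I (s : seq I) (P : pred I)
    (f : I -> T -> E) (l : I -> E) : (forall i, P i -> f i @ F --> l i) ->
  \sum_(i <- s | P i) f i t @[t --> F] --> \sum_(i <- s | P i) l i.
Proof.
move=> fl; elim: s => [|i s IH].
  by under eq_fun do rewrite big_nil; rewrite big_nil; exact: cvg_cst.
under eq_fun do rewrite big_cons; rewrite big_cons.
by case: ifP => // Pi; apply: cvgDc => //; exact: fl.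
Qed.

Lemma cvg_nrm E T (F : set_system T) {FF : Filter F} (f : T -> E) l :
  f @ F --> l -> nrm (f x) @[x --> F] --> nrm l.
Proof.
move=> /cvg_nrmP fl; apply/cvgrPdist_lt => e e0.
apply: filterS (fl e e0) => x; apply: le_lt_trans.
rewrite ler_norml; apply/andP; split.
  have := nrmD (f x - l) l; rewrite subrK nrmBC; lra.
have := nrmD (l - f x) (f x); rewrite subrK; lra.
Qed.

Lemma cvg_Re T (F : set_system T) {FF : Filter F} (f : T -> R[i]^o) (l : R[i]^o) :
  f @ F --> l -> complex.Re (f x) @[x --> F] --> complex.Re l.
Proof.
move=> /cvg_nrmP fl; apply/cvgrPdist_lt => e e0.
apply: filterS (fl e e0) => x; apply: le_lt_trans.
by rewrite -lecR -nrmE -raddfB normc_ge_Re.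
Qed.

Lemma cvgR_uniq T (F : set_system T) {FF : ProperFilter F} (f : T -> R) (a b : R) :
  f @ F --> a -> f @ F --> b -> a = b.
Proof.
by move=> fa fb; rewrite -(cvg_lim (@Rhausdorff R) fa) (cvg_lim (@Rhausdorff R) fb).
Qed.

Lemma cvg_uniq E T (F : set_system T) {FF : ProperFilter F} (f : T -> E) (a b : E) :
  f @ F --> a -> f @ F --> b -> a = b.
Proof.
move=> fa fb; apply/eqP; rewrite -subr_eq0; apply/eqP/nrm_eq0.
have ab : (f - f) x @[x --> F] --> a - b by exact: cvgB.
apply: (cvgR_uniq (cvg_nrm ab)); rewrite (_ : (fun i => _) = cst 0).
  exact: cvg_cst.
by apply/funext => i; rewrite /= subrr nrm0.
Qed.

Lemma closureP E (A : set E) x :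
  closure A x <-> forall e : R, 0 < e -> exists2 a, A a & nrm (x - a) < e.
Proof.
split => [Ax e e0|Ax B].
  have [|a [Aa]] := Ax [set y | nrm (x - y) < e]; last by exists a.
  by have /cvg_nrmP/(_ e e0) := @cvg_id _ (nbhs x).
rewrite -(@nbhs_ballE R[i]) => -[e /= e0 eB].
have ee : e = (complex.Re e)%:C by rewrite RRe_real// gtr0_real.
move: e0; rewrite ee ltcR => /Ax[a Aa ax]; exists a; split => //.
by apply: eB; rewrite -ball_normE /= nrmE ee ltcR.
Qed.

(** Unbounded operators are handled as graphs, and their closure is taken in the product topology;
    this gives a metric form of that closure. *)
Lemma closure2P E F (A : set (E * F)) x y :
  closure A (x, y) <-> forall e : R, 0 < e ->
    exists a b, [/\ A (a, b), nrm (x - a) < e & nrm (y - b) < e].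
Proof.
split => [Axy e e0|Axy B [[P Q] /= [Px Qy] PQB]].
  have [|[a b] [Aab [/= xa yb]]] :=
    Axy [set z | nrm (x - z.1) < e /\ nrm (y - z.2) < e].
    exists ([set z | nrm (x - z) < e], [set z | nrm (y - z) < e]) => //=.
    split.
      by have /cvg_nrmP/(_ e e0) := @cvg_id _ (nbhs x).
    by have /cvg_nrmP/(_ e e0) := @cvg_id _ (nbhs y).
  by exists a, b.
have cr (G : normedModType R[i]) (z : G) U : nbhs z U ->
    exists2 e : R, 0 < e & forall t, nrm (z - t) < e -> U t.
  rewrite -(@nbhs_ballE R[i]) => -[e /= e0 eB].
  have ee : e = (complex.Re e)%:C by rewrite RRe_real// gtr0_real.
  move: e0; rewrite ee ltcR => e0; exists (complex.Re e) => // t zt.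
  by apply: eB; rewrite -ball_normE /= nrmE ee ltcR.
have [e1 e10 P1] := cr _ _ _ Px; have [e2 e20 Q2] := cr _ _ _ Qy.
have [|a [b [Aab xa yb]]] := Axy (Num.min e1 e2); first by rewrite lt_min e10.
exists (a, b); split => //; apply: PQB; split => /=.
  by apply: P1; apply: lt_le_trans xa _; rewrite ge_min lexx.
by apply: Q2; apply: lt_le_trans yb _; rewrite ge_min lexx orbT.
Qed.

Lemma denseP E (A : set E) :
  dense A <-> forall x (e : R), 0 < e -> exists2 a, A a & nrm (x - a) < e.
Proof.
split => [dA x e e0|dA O [x Ox] oO].
  have [||a [xa Aa]] := dA (ball x (e%:C : R[i])).
  - by exists x; apply: ballxx; rewrite ltcR.
  - by apply: ball_open; rewrite ltcR.
  by exists a => //; move: xa; rewrite -ball_normE /= nrmE ltcR.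
have /closureP cA := dA x.
by have [a [Aa Oa]] := cA O (open_nbhs_nbhs (conj oO Ox)); exists a.
Qed.

Lemma cvgn_le E (u : nat -> E) l (g : nat -> R) :
  (forall n, nrm (l - u n) <= g n) -> g @ \oo --> (0 : R) -> u @ \oo --> l.
Proof. by move=> ug; apply: cvg_nrm_le; apply: nearW. Qed.

Lemma cvgn_harmonic E (u : nat -> E) l :
  (forall n, nrm (l - u n) <= n.+1%:R^-1) -> u @ \oo --> l.
Proof. by move=> /cvgn_le; apply; exact: cvg_harmonic. Qed.

Lemma nrm_lim_le E T (F : set_system T) {FF : ProperFilter F} (f : T -> E) l C :
  f @ F --> l -> (\forall x \near F, nrm (f x) <= C) -> nrm l <= C.
Proof.
move=> /cvg_nrm fl fC; rewrite -(cvg_lim (@Rhausdorff R) fl).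
by apply: limr_le => //; apply: cvgP fl.
Qed.

Lemma closure_lim E (A : set E) T (F : set_system T) {FF : ProperFilter F} (f : T -> E) l :
  f @ F --> l -> (\forall x \near F, A (f x)) -> closure A l.
Proof.
move=> /cvg_nrmP fl fA; apply/closureP => e e0.
have [x [? ?]] := @filter_ex _ _ FF _ (filterI fA (fl e e0)).
by exists (f x).
Qed.

Lemma closure2_lim E F' (A : set (E * F')) T (F : set_system T) {FF : ProperFilter F}
    (f : T -> E) (g : T -> F') l m :
  f @ F --> l -> g @ F --> m -> (\forall x \near F, A (f x, g x)) ->
  closure A (l, m).
Proof.
move=> /cvg_nrmP fl /cvg_nrmP gm fA; apply/closure2P => e e0.
have [x [[? ?] ?]] :=
  @filter_ex _ _ FF _ (filterI (filterI (fl e e0) (gm e e0)) fA).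
by exists (f x), (g x).
Qed.

Lemma closure2_seq E F (A : set (E * F)) x y : closure A (x, y) ->
  exists u v, [/\ forall n : nat, A (u n, v n), u @ \oo --> x & v @ \oo --> y].
Proof.
move=> /closure2P cA.
have {cA}/choice[f Hf] n : exists p : E * F, [/\ A p, nrm (x - p.1) <= n.+1%:R^-1
    & nrm (y - p.2) <= n.+1%:R^-1].
  have [|a [b [Aab xa yb]]] := cA (n.+1%:R^-1); first by rewrite invr_gt0.
  by exists (a, b); split => //; exact: ltW.
exists (fun n => (f n).1), (fun n => (f n).2); split.
- by move=> n; rewrite -surjective_pairing; have [] := Hf n.
- by apply: cvgn_harmonic => n; have [] := Hf n.
- by apply: cvgn_harmonic => n; have [] := Hf n.
Qed.

Lemma closure_seq E (A : set E) x : closure A x ->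
  exists2 u : nat -> E, forall n, A (u n) & u @ \oo --> x.
Proof.
move=> /closureP cA.
have {cA}/choice[f Hf] n : exists p : E, A p /\ nrm (x - p) <= n.+1%:R^-1.
  have [|a Aa xa] := cA (n.+1%:R^-1); first by rewrite invr_gt0.
  by exists a; split => //; exact: ltW.
exists f; first by move=> n; have [] := Hf n.
by apply: cvgn_harmonic => n; have [] := Hf n.
Qed.

Lemma dense_closure E (A : set E) : dense A <-> forall x, closure A x.
Proof.
by rewrite denseP; split => H x; [apply/closureP; exact: H|exact/closureP].
Qed.

End RealNorm.

Section Completeness.
Context {R : realType}.
Implicit Type E : completeNormedModType R[i].

Lemma cauchy_nrm E (u : nat -> E) :
  (forall e : R, 0 < e -> exists N, forall m n, (N <= m)%N -> (N <= n)%N ->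
     nrm (u m - u n) < e) -> exists l : E, u @ \oo --> l.
Proof.
move=> cu; suff: cvgn u by move=> /cvg_ex.
apply: cauchy_cvg; apply/cauchy_ballP => e e0.
have ee : e = (complex.Re e)%:C by rewrite RRe_real// gtr0_real.
move: e0; rewrite ee ltcR => /cu[N HN].
exists ([set x | exists2 n, (N <= n)%N & x = u n],
        [set x | exists2 n, (N <= n)%N & x = u n]).
  by split; exists N => // n /= Nn; exists n.
move=> [_ _] /= [[m Nm ->] [n Nn ->]].
by rewrite -ball_normE /= nrmE ee ltcR HN.
Qed.

End Completeness.

(** * Hilbert spaces *)

Section InnerProduct.
Context {R : realType}.
Implicit Types E F : hilbertType R.

Lemma dotDr E (x y z : E) : dot x (y + z) = dot x y + dot x z.
Proof. by have := dot_linear x y z 1; rewrite scale1r mul1r. Qed.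

Lemma dot0r E (x : E) : dot x 0 = 0.
Proof. by apply: (@addrI _ (dot x 0)); rewrite -dotDr !addr0. Qed.

Lemma dotZr E (x y : E) (a : R[i]) : dot x (a *: y) = a * dot x y.
Proof. by have := dot_linear x y 0 a; rewrite addr0 dot0r addr0. Qed.

Lemma dotNr E (x y : E) : dot x (- y) = - dot x y.
Proof. by rewrite -scaleN1r dotZr mulN1r. Qed.

Lemma dotBr E (x y z : E) : dot x (y - z) = dot x y - dot x z.
Proof. by rewrite dotDr dotNr. Qed.

Lemma dotDl E (x y z : E) : dot (x + y) z = dot x z + dot y z.
Proof. by rewrite dot_conj dotDr rmorphD /= -!dot_conj. Qed.

Lemma dot0l E (x : E) : dot 0 x = 0.
Proof. by rewrite dot_conj dot0r conjc0. Qed.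

Lemma dotZl E (x y : E) (a : R[i]) : dot (a *: x) y = conjc a * dot x y.
Proof. by rewrite dot_conj dotZr rmorphM /= -!dot_conj. Qed.

Lemma dotNl E (x y : E) : dot (- x) y = - dot x y.
Proof. by rewrite dot_conj dotNr rmorphN /= -!dot_conj. Qed.

Lemma dotBl E (x y z : E) : dot (x - y) z = dot x z - dot y z.
Proof. by rewrite dotDl dotNl. Qed.

Lemma dot_sumr E I (s : seq I) (P : pred I) (f : I -> E) x :
  dot x (\sum_(i <- s | P i) f i) = \sum_(i <- s | P i) dot x (f i).
Proof. by apply: big_morph => [y z|]; [exact: dotDr|exact: dot0r]. Qed.

Lemma dot_suml E I (s : seq I) (P : pred I) (f : I -> E) x :
  dot (\sum_(i <- s | P i) f i) x = \sum_(i <- s | P i) dot (f i) x.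
Proof.
by apply: (big_morph (fun y => dot y x)) => [y z|]; [exact: dotDl|exact: dot0l].
Qed.

Lemma dotxx E (x : E) : dot x x = (nrm x ^+ 2)%:C.
Proof. by rewrite dot_norm nrmE rmorphXn. Qed.

Definition rdot E (x y : E) : R := complex.Re (dot x y).

Lemma rdotC E (x y : E) : rdot x y = rdot y x.
Proof. by rewrite /rdot dot_conj; case: (dot y x). Qed.

Lemma rdotDr E (x y z : E) : rdot x (y + z) = rdot x y + rdot x z.
Proof. by rewrite /rdot dotDr raddfD. Qed.

Lemma rdotNr E (x y : E) : rdot x (- y) = - rdot x y.
Proof. by rewrite /rdot dotNr raddfN. Qed.

Lemma rdotBr E (x y z : E) : rdot x (y - z) = rdot x y - rdot x z.
Proof. by rewrite rdotDr rdotNr. Qed.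

Lemma rdotDl E (x y z : E) : rdot (y + z) x = rdot y x + rdot z x.
Proof. by rewrite rdotC rdotDr !(rdotC x). Qed.

Lemma rdotNl E (x y : E) : rdot (- y) x = - rdot y x.
Proof. by rewrite rdotC rdotNr (rdotC x). Qed.

Lemma rdotBl E (x y z : E) : rdot (y - z) x = rdot y x - rdot z x.
Proof. by rewrite rdotDl rdotNl. Qed.

Lemma rdotZr E (x y : E) (a : R) : rdot x (a%:C *: y) = a * rdot x y.
Proof. by rewrite /rdot dotZr; case: (dot x y) => b c /=; rewrite mul0r subr0. Qed.

Lemma rdotZl E (x y : E) (a : R) : rdot (a%:C *: x) y = a * rdot x y.
Proof. by rewrite rdotC rdotZr rdotC. Qed.

Lemma rdot0r E (x : E) : rdot x 0 = 0.
Proof. by rewrite /rdot dot0r. Qed.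

Lemma rdotxx E (x : E) : rdot x x = nrm x ^+ 2.
Proof. by rewrite /rdot dotxx. Qed.

Lemma nrmD2 E (x y : E) :
  nrm (x + y) ^+ 2 = nrm x ^+ 2 + 2 * rdot x y + nrm y ^+ 2.
Proof. by rewrite -!rdotxx rdotDr !rdotDl (rdotC y x); ring. Qed.

Lemma nrmB2 E (x y : E) :
  nrm (x - y) ^+ 2 = nrm x ^+ 2 - 2 * rdot x y + nrm y ^+ 2.
Proof. by rewrite nrmD2 rdotNr nrmN; ring. Qed.

(** Expand the squared norm of [|y| x - |x| y], which is nonnegative. *)
Lemma rdot_le E (x y : E) : rdot x y <= nrm x * nrm y.
Proof.
have [x0|x0] := eqVneq (nrm x) 0.
  by rewrite x0 (nrm_eq0 x0) rdotC rdot0r mul0r.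
have [y0|y0] := eqVneq (nrm y) 0.
  by rewrite y0 (nrm_eq0 y0) rdot0r mulr0.
have ab : 0 < nrm x * nrm y by rewrite mulr_gt0// lt_def ?x0 ?y0 nrm_ge0.
have := sqr_ge0 (nrm ((nrm y)%:C *: x - (nrm x)%:C *: y)).
rewrite nrmB2 !nrmZr rdotZr rdotZl !ger0_norm ?nrm_ge0// => H.
rewrite -(ler_pM2l ab); lra.
Qed.

Lemma rdot_norm E (x y : E) : `|rdot x y| <= nrm x * nrm y.
Proof.
rewrite ler_norml rdot_le andbT; have := rdot_le (- x) y.
rewrite nrmN rdotNl; lra.
Qed.

(** Multiplying [y] by the conjugate of [dot x y] makes the pairing real and equal to its squared
    modulus, which reduces the claim to [rdot_le]. *)
Lemma dot_le E (x y : E) : nrm (dot x y : R[i]^o) <= nrm x * nrm y.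
Proof.
set z : R[i]^o := dot x y.
have [z0|z0] := eqVneq (nrm z) 0; first by rewrite z0 mulr_ge0 ?nrm_ge0.
have zp : 0 < nrm z by rewrite lt_def z0 nrm_ge0.
have nz : nrm (conjc z : R[i]^o) = nrm z by rewrite /nrm normcJ.
have := rdot_le x (conjc z *: y); rewrite /rdot dotZr -/z nrmZ nz.
have -> : conjc z * z = (nrm z ^+ 2)%:C.
  by rewrite mulrC -sqr_normc rmorphXn; congr (_ ^+ 2); exact: (nrmE z).
by rewrite /= expr2 (mulrCA (nrm x)) ler_pM2l.
Qed.

Lemma ImdotE E (x y : E) : complex.Im (dot x y) = rdot x (- 'i *: y).
Proof.
rewrite /rdot dotZr; case: (dot x y) => a b /=.
by rewrite oppr0 mul0r mulN1r add0r opprK.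
Qed.

(** The imaginary part of an inner product is the real part after rotating one argument by [- 'i].
    Arguments about real derivatives and real norms thereby give complex identities. *)
Lemma dot_rdotP E F (x y : E) (a b : F) :
  rdot x y = rdot a b -> rdot x (- 'i *: y) = rdot a (- 'i *: b) ->
  dot x y = dot a b.
Proof.
move=> re im; rewrite (complexE (dot x y)) (complexE (dot a b)).
by rewrite !ImdotE im -/(rdot x y) re.
Qed.

Lemma cvg_dot E T (F : set_system T) {FF : Filter F} (f g : T -> E) x y :
  f @ F --> x -> g @ F --> y -> dot (f i) (g i) @[i --> F] --> (dot x y : R[i]^o).
Proof.
move=> fx gy.
apply: (@cvg_nrm_le R (R[i]^o : normedModType R[i]) T F FF _ _
  (fun i => nrm x * nrm (y - g i) + nrm (x - f i) * nrm (g i))).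
  apply: nearW => i.
  have -> : dot x y - dot (f i) (g i) = dot x (y - g i) + dot (x - f i) (g i).
    by rewrite dotBr dotBl; ring.
  by apply: (le_trans (nrmD (_ : R[i]^o) _)); rewrite lerD ?dot_le.
rewrite [X in _ --> X](_ : 0 = nrm x * 0 + 0 * nrm y); last by ring.
apply: cvgD; first by apply: cvgMl_tmp; exact/cvg_nrm0.
by apply: cvgM; [exact/cvg_nrm0|exact: cvg_nrm].
Qed.

Lemma cvg_rdot E T (F : set_system T) {FF : Filter F} (f g : T -> E) x y :
  f @ F --> x -> g @ F --> y -> rdot (f i) (g i) @[i --> F] --> rdot x y.
Proof. by move=> fx gy; apply: cvg_Re; exact: cvg_dot. Qed.

(** Expand [|x - f i|^2]. This is how continuity of tensors is obtained, since only their inner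
    products are given. *)
Lemma cvg_dotP E T (F : set_system T) {FF : Filter F} (f : T -> E) x :
  dot (f i) (f i) @[i --> F] --> (dot x x : R[i]^o) ->
  dot (f i) x @[i --> F] --> (dot x x : R[i]^o) -> f @ F --> x.
Proof.
move=> /cvg_Re ff /cvg_Re fx; apply/cvg_nrmP => e e0.
have : nrm (x - f i) ^+ 2 @[i --> F] --> (0 : R).
  rewrite (_ : (fun i => _) =
    (fun i => rdot x x - 2 * rdot (f i) x + rdot (f i) (f i))); last first.
    by apply/funext => i; rewrite nrmB2 !rdotxx (rdotC x).
  rewrite [X in _ --> X](_ : 0 = rdot x x - 2 * rdot x x + rdot x x); last by ring.
  apply: cvgD => //; apply: cvgB; first exact: cvg_cst.
  exact: cvgMl_tmp.
move=> /cvgrPdist_lt/(_ (e ^+ 2)); rewrite exprn_gt0// => /(_ isT).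
apply: filterS => i; rewrite sub0r normrN ger0_norm ?sqr_ge0//.
by rewrite ltr_pXn2r ?nnegrE ?nrm_ge0 // ltW.
Qed.

Lemma dot_ext E (x y : E) : (forall z, dot z x = dot z y) -> x = y.
Proof.
move=> xy; apply/eqP; rewrite -subr_eq0; apply/eqP/nrm_eq0/eqP.
by rewrite -sqrf_eq0 -rdotxx /rdot dotBr xy subrr.
Qed.

Lemma dense_orth E (A : set E) x : dense A -> (forall a, A a -> dot a x = 0) -> x = 0.
Proof.
move=> /dense_closure/(_ x)/closure_seq[u Au ux] Ax.
apply: nrm_eq0; apply/eqP; rewrite -sqrf_eq0 -rdotxx.
have ux' : rdot (u n) x @[n --> \oo] --> rdot x x.
  by apply: cvg_rdot => //; exact: cvg_cst.
apply/eqP; apply: (cvgR_uniq ux').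
by under eq_fun do rewrite /rdot Ax //; exact: cvg_cst.
Qed.

End InnerProduct.

(** * Linear subspaces, spans, density and bounded operators *)

Section Subspaces.
Context {R : realType}.

Section Lmod.
Implicit Types V : lmodType R[i].

Lemma subspace0 V (A : set V) : linear_subspace A -> A 0.
Proof. by case. Qed.

Lemma subspaceZ V (A : set V) a x : linear_subspace A -> A x -> A (a *: x).
Proof. by move=> [A0 AA] Ax; have := AA a x 0 Ax A0; rewrite addr0. Qed.

Lemma subspaceD V (A : set V) x y : linear_subspace A -> A x -> A y -> A (x + y).
Proof. by move=> [A0 AA] Ax Ay; have := AA 1 x y Ax Ay; rewrite scale1r. Qed.

Lemma subspaceN V (A : set V) x : linear_subspace A -> A x -> A (- x).
Proof. by move=> sA Ax; rewrite -scaleN1r; exact: subspaceZ. Qed.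

Lemma subspaceB V (A : set V) x y : linear_subspace A -> A x -> A y -> A (x - y).
Proof. by move=> sA Ax Ay; apply: subspaceD => //; exact: subspaceN. Qed.

Lemma sub_lspan V (A : set V) : A `<=` lspan A.
Proof. by move=> x Ax B [_]; exact. Qed.

Lemma lspan_subspace V (A : set V) : linear_subspace (lspan A).
Proof.
split=> [B [[]]//|a x y Ax Ay B [sB AB]].
by apply: sB.2; [apply: Ax|apply: Ay].
Qed.

Lemma lspan_min V (A B : set V) : linear_subspace B -> A `<=` B -> lspan A `<=` B.
Proof. by move=> sB AB x; exact. Qed.

Lemma lspan_rangeP V I (f : I -> V) x : lspan (range f) x ->
  exists s : seq (R[i] * I), x = \sum_(k <- s) k.1 *: f k.2.
Proof.
apply: (@lspan_min V _ [set x | exists s : seq (R[i] * I),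
  x = \sum_(k <- s) k.1 *: f k.2]) => [|_ [i _ <-]]; last first.
  by exists [:: (1, i)]; rewrite big_seq1 scale1r.
split=> [|a _ _ [s ->] [t ->]]; first by exists [::]; rewrite big_nil.
exists ([seq (a * k.1, k.2) | k <- s] ++ t).
rewrite big_cat big_map scaler_sumr /=; congr (_ + _).
by apply: eq_bigr => k _; rewrite scalerA.
Qed.

Lemma lfun0 V V' (B : V -> V') : linear B -> B 0 = 0.
Proof.
move=> lB; have := lB (-1) 0 0; rewrite !scaleN1r oppr0 addr0 => ->.
by rewrite addNr.
Qed.

Lemma lfunB V V' (B : V -> V') x y : linear B -> B (x - y) = B x - B y.
Proof.
by move=> lB; have := lB (-1) y x; rewrite !scaleN1r [- y + x]addrC [- B y + _]addrC.
Qed.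

Lemma lfunZ V V' (B : V -> V') a x : linear B -> B (a *: x) = a *: B x.
Proof. by move=> lB; have := lB a x 0; rewrite (lfun0 lB) !addr0. Qed.

Lemma lfunD V V' (B : V -> V') x y : linear B -> B (x + y) = B x + B y.
Proof. by move=> lB; have := lB 1 x y; rewrite !scale1r. Qed.

Lemma lfun_sum V V' (B : V -> V') I (s : seq I) (P : pred I) (f : I -> V) :
  linear B -> B (\sum_(i <- s | P i) f i) = \sum_(i <- s | P i) B (f i).
Proof.
move=> lB; apply: (big_morph B) => [x y|]; [exact: lfunD|exact: lfun0].
Qed.

Lemma subACA V (x y z t : V) : x - y - (z - t) = x - z - (y - t).
Proof. by rewrite !opprD !opprK addrACA. Qed.

Lemma subr_swap V (x y x' y' : V) : x - y = x' - y' -> y - y' = x - x'.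
Proof.
move=> xy; apply/eqP; rewrite -subr_eq0 subACA -(opprB x y) -(opprB x' y') xy.
by rewrite subrr.
Qed.

End Lmod.

Section Normed.
Implicit Types E F : normedModType R[i].

Lemma closure_subspace E (A : set E) :
  linear_subspace A -> linear_subspace (closure A).
Proof.
move=> sA; split=> [|a x y /closure_seq[u Au ux] /closure_seq[v Av vy]].
  by apply: subset_closure; exact: subspace0.
apply: (@closure_lim _ _ _ _ \oo _ (fun n => a *: u n + v n)).
  by apply: cvgDc => //; exact: cvgZc.
by apply: nearW => n; exact: sA.2.
Qed.

Lemma closure2_subspace E F (A : set (E * F)) :
  linear_subspace A -> linear_subspace (closure A).
Proof.
move=> sA; split=> [|a [x x'] [y y'] /closure2_seq[u [u' [Au ux ux']]]
    /closure2_seq[v [v' [Av vy vy']]]].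
  by apply: subset_closure; exact: subspace0.
apply: (@closure2_lim _ _ _ _ _ \oo _ (fun n => a *: u n + v n)
  (fun n => a *: u' n + v' n)).
- by apply: cvgDc => //; exact: cvgZc.
- by apply: cvgDc => //; exact: cvgZc.
- by apply: nearW => n; exact: (sA.2 a (_, _) (_, _)).
Qed.

Lemma dense_lspan E (A B : set E) : dense (lspan A) -> A `<=` closure (lspan B) ->
  dense (lspan B).
Proof.
move=> /dense_closure dA AB; apply/dense_closure => x.
have cc : closure (lspan B) = closure (closure (lspan B)).
  by apply: (closure_id _).1; exact: closed_closure.
rewrite cc; move: (dA x); apply: closure_subset; apply: lspan_min => //.
by apply: closure_subspace; exact: lspan_subspace.
Qed.

Lemma eq_dense E F (A : set E) (f g : E -> F) : dense A -> continuous f ->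
  continuous g -> (forall a, A a -> f a = g a) -> forall x, f x = g x.
Proof.
move=> /dense_closure dA cf cg fg x; have /closure_seq[u Au ux] := dA x.
apply: (cvg_uniq (cvg_comp _ _ ux (cf x))).
by rewrite (_ : f \o u = g \o u); [exact: (cvg_comp _ _ ux (cg x))|apply/funext => n /=; exact: fg].
Qed.

End Normed.

Section Bounded.
Implicit Types E F : hilbertType R.

Lemma bounded_linear_bound E F (B : E -> F) : bounded_linear B ->
  exists2 C : R, 0 <= C & forall x, nrm (B x) <= C * nrm x.
Proof.
move=> [lB cB]; have B0 : B 0 = 0.
  by have := lB (-1) 0 0; rewrite scaler0 add0r scaleN1r addNr.
have := cB 0; rewrite /continuous_at B0 => /cvg_nrmP/(_ 1 ltr01).
rewrite -(@nbhs_ballE R[i]) => -[e /= e0 eB].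
have ee : e = (complex.Re e)%:C by rewrite RRe_real// gtr0_real.
move: e0 eB; rewrite ee; move: (complex.Re e) => {ee}e; rewrite ltcR => e0 eB.
exists (2 / e); first by rewrite divr_ge0// ltW.
move=> x; have [x0|x0] := eqVneq (nrm x) 0.
  by rewrite x0 mulr0 (nrm_eq0 x0) B0 nrm0.
have xp : 0 < nrm x by rewrite lt_def x0 nrm_ge0.
pose a := e / 2 / nrm x; have a0 : 0 < a by rewrite !divr_gt0.
have : nrm (0 - B (a%:C *: x)) < 1.
  apply: eB; rewrite -ball_normE /= nrmE sub0r nrmN nrmZr gtr0_norm// ltcR.
  by rewrite /a divfK// ltr_pdivrMr// ltr_pMr// ltr1n.
have -> : B (a%:C *: x) = a%:C *: B x by have := lB a%:C x 0; rewrite !addr0 B0 addr0.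
rewrite sub0r nrmN nrmZr gtr0_norm// mulrC -ltr_pdivlMr// => /ltW/le_trans; apply.
by rewrite /a div1r !invf_div mulrC.
Qed.

Lemma bound_bounded_linear E F (B : E -> F) (C : R) : linear B ->
  (forall x, nrm (B x) <= C * nrm x) -> bounded_linear B.
Proof.
move=> lB BC; split=> // x; apply: (@cvg_nrm_le _ _ _ _ _ _ _
  (fun y => C * nrm (x - y))).
  apply: nearW => y.
  have -> : B x - B y = B (x - y); last exact: BC.
  by have := lB (-1) y x; rewrite !scaleN1r [- y + x]addrC [- B y + B x]addrC.
rewrite -[X in _ --> X](mulr0 C); apply: cvgMl_tmp; apply/cvg_nrm0.
exact: cvg_id.
Qed.

Lemma rdot_subspace E (A : set E) w : linear_subspace A ->
  (forall a, A a -> rdot a w = 0) -> forall a, A a -> dot a w = 0.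
Proof.
move=> sA Aw a Aa; rewrite -(dot0l (0 : E)).
apply: dot_rdotP; first by rewrite Aw// rdot0r.
rewrite scaler0 rdot0r -(Aw ('i *: a)); last exact: subspaceZ.
by rewrite /rdot dotZl dotZr; congr (complex.Re (_ * _)); simpc.
Qed.

End Bounded.
End Subspaces.

(** * Orthogonal projection, Riesz representation and adjoints *)

Section Projection.
Context {R : realType}.
Implicit Types E F : hilbertType R.

(** A minimising sequence for the distance from [x] to [A] is Cauchy by the parallelogram identity,
    and its limit satisfies the variational equation. [A] need not be closed, so the foot lies in
    its closure. *)
Lemma projection E (A : set E) x : linear_subspace A ->
  exists2 y, closure A y & forall a, A a -> dot a (x - y) = 0.
Proof.
move=> sA; pose D := [set nrm (x - a) | a in A]; pose d := inf D.
have D0 : has_inf D.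
  split; first by exists (nrm (x - 0)), 0 => //; exact: subspace0.
  by exists 0 => _ [a _ <-]; exact: nrm_ge0.
have dA a : A a -> d <= nrm (x - a) by move=> Aa; apply: ge_inf D0.2 _ _; exists a.
have d0 : 0 <= d by apply: lb_le_inf D0.1 _ => _ [a _ <-]; exact: nrm_ge0.
have /choice[u Hu] (n : nat) : exists a, A a /\ nrm (x - a) < d + n.+1%:R^-1.
  have [|_ [a Aa <-] ?] := @inf_adherent _ D n.+1%:R^-1 _ D0.
    by rewrite invr_gt0.
  by exists a.
(* The midpoint of [u n] and [u m] lies in [A], at distance at least [d] from [x]; hence
   [|u m - u n|^2 <= 4 (d + e)^2 - 4 d^2]. *)
have u_le n m e : 0 <= e -> nrm (x - u n) <= d + e -> nrm (x - u m) <= d + e ->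
    nrm (u m - u n) ^+ 2 <= 8 * d * e + 4 * e ^+ 2.
  move=> e0 un um.
  have : 2 * d <= nrm ((x - u n) + (x - u m)).
    have -> : (x - u n) + (x - u m) = 2%:C *: (x - (2^-1)%:C *: (u n + u m)).
      rewrite scalerBr scalerA -rmorphM /= mulfV ?pnatr_eq0// scale1r.
      by rewrite rmorph_nat scaler_nat mulr2n opprD addrACA.
    rewrite nrmZr ger0_norm// ler_pM2l// dA//.
    by apply: subspaceZ => //; apply: subspaceD => //; apply: (Hu _).1.
  have -> : u m - u n = (x - u n) - (x - u m) by rewrite opprB [RHS]addrC addrA subrK.
  move: (nrm_ge0 (x - u n)) (nrm_ge0 (x - u m)) un um.
  move=> + + + + H; have : (2 * d) ^+ 2 <= nrm (x - u n + (x - u m)) ^+ 2.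
    by rewrite ler_pXn2r// nnegrE ?nrm_ge0// mulr_ge0.
  rewrite nrmD2 (nrmB2 (x - u n)).
  move: (nrm (x - u n)) (nrm (x - u m)) (rdot _ _) => a b r H2 a0 b0 ad bd.
  have a2 : a ^+ 2 <= (d + e) ^+ 2 by rewrite ler_pXn2r// nnegrE; lra.
  have b2 : b ^+ 2 <= (d + e) ^+ 2 by rewrite ler_pXn2r// nnegrE; lra.
  nra.
have [y uy] : exists y : E, u @ \oo --> y.
  apply: cauchy_nrm => e e0.
  (* Since [f <= 1], [8 d f + 4 f^2 <= (8 d + 4) f], strictly below [(8 d + 5) f <= e^2]. *)
  pose f := Num.min 1 (e ^+ 2 / (8 * d + 5)).
  have f0 : 0 < f by rewrite lt_min ltr01/= divr_gt0 ?exprn_gt0//; lra.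
  have f1 : f <= 1 by rewrite ge_min lexx.
  have fe : f * (8 * d + 5) <= e ^+ 2.
    by rewrite -ler_pdivlMr ?ge_min ?lexx ?orbT//; lra.
  have [N _ HN] : \forall n \near \oo, n.+1%:R^-1 < f.
    have := @cvg_harmonic R; move=> /cvgrPdist_lt/(_ f f0).
    by apply: filterS => n; rewrite sub0r normrN ger0_norm// invr_ge0.
  exists N => m n Nm Nn.
  have H k : (N <= k)%N -> nrm (x - u k) <= d + f.
    move=> Nk; apply: ltW; apply: lt_le_trans (Hu k).2 _.
    by rewrite lerD2l ltW//; exact: HN.
  have := u_le n m f (ltW f0) (H _ Nn) (H _ Nm) => um.
  rewrite -(@ltr_pXn2r _ 2)// ?nnegrE ?nrm_ge0 ?ltW//.
  by apply: le_lt_trans um _; apply: lt_le_trans fe; nra.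
have cy : closure A y.
  by apply: closure_lim uy _; apply: nearW => n; exact: (Hu n).1.
have xyd : nrm (x - y) <= d.
  have xu : nrm (x - u n) @[n --> \oo] --> nrm (x - y).
    by apply: cvg_nrm; apply: cvgBc => //; exact: cvg_cst.
  have du : d + n.+1%:R^-1 @[n --> \oo] --> d + (0 : R).
    by apply: cvgD; [exact: cvg_cst|exact: cvg_harmonic].
  rewrite -(addr0 d); apply: (ler_cvg_to xu du).
  by apply: nearW => n; exact/ltW/(Hu n).2.
have cd z : closure A z -> d <= nrm (x - z).
  move=> /closure_seq[v Av vz].
  have xv : nrm (x - v n) @[n --> \oo] --> nrm (x - z).
    by apply: cvg_nrm; apply: cvgBc => //; exact: cvg_cst.
  by apply: (ler_cvg_to (cvg_cst d) xv); apply: nearW => n; exact: dA.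
have r0 a : A a -> rdot a (x - y) = 0.
  move=> Aa; set r := rdot a (x - y); set N := nrm a ^+ 2.
  have N0 : 0 <= N by rewrite sqr_ge0.
  have H s : 0 <= s ^+ 2 * N - 2 * s * r.
    have : nrm (x - y) ^+ 2 <= nrm ((x - y) - s%:C *: a) ^+ 2.
      rewrite ler_pXn2r// ?nnegrE ?nrm_ge0//; apply: le_trans xyd _.
      rewrite -addrA -opprD; apply: cd.
      apply: (subspaceD (closure_subspace sA)) => //.
      by apply: subset_closure; exact: subspaceZ.
    rewrite (nrmB2 (x - y)) rdotZr nrmZr exprMn -normrX ger0_norm ?sqr_ge0//.
    by rewrite (rdotC (x - y)) -/r -/N; lra.
  (* This nearly minimises the quadratic; the added 1 covers [N = 0]. Its value there is
     [- r^2 (N + 2) / (N + 1)^2], which forces [r = 0]. *)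
  have := H (r / (N + 1)); rewrite expr_div_n => {}H.
  have N1 : 0 < (N + 1) ^+ 2 by rewrite exprn_gt0//; lra.
  have : 0 <= (r ^+ 2 / (N + 1) ^+ 2 * N - 2 * (r / (N + 1)) * r) * (N + 1) ^+ 2.
    by rewrite mulr_ge0// ltW.
  have -> : (r ^+ 2 / (N + 1) ^+ 2 * N - 2 * (r / (N + 1)) * r) * (N + 1) ^+ 2 =
     - (r ^+ 2 * (N + 2)) by field; lra.
  move=> {}H; apply/eqP; rewrite -sqrf_eq0 eq_le sqr_ge0 andbT.
  rewrite -(@pmulr_lle0 _ (N + 2)); first by lra.
  by lra.
by exists y => // a; apply: rdot_subspace sA r0 a.
Qed.

Lemma dense_of_orth E (A : set E) : linear_subspace A ->
  (forall x, (forall a, A a -> dot a x = 0) -> x = 0) -> dense A.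
Proof.
move=> sA A0; apply/dense_closure => x.
have [y cy /A0/eqP] := projection x sA.
by rewrite subr_eq0 => /eqP ->.
Qed.

Lemma riesz E (phi : E -> R[i]) (C : R) :
  (forall a x y, phi (a *: x + y) = a * phi x + phi y) ->
  (forall x, nrm (phi x : R[i]^o) <= C * nrm x) ->
  exists y, forall x, phi x = dot y x.
Proof.
move=> lphi bphi; have [z0|] := pselect (forall x, phi x = 0).
  by exists 0 => x; rewrite dot0l.
move=> /existsNP[x0 /eqP px0].
have phi0 : phi 0 = 0.
  by have := lphi (-1) 0 0; rewrite scaler0 addr0 mulN1r addNr.
have phiB x y : phi (x - y) = phi x - phi y.
  by rewrite addrC -scaleN1r lphi mulN1r addrC.
have sA : linear_subspace [set x | phi x = 0].
  by split => // a x y /= x1 y1; rewrite lphi x1 y1 mulr0 addr0.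
have [y0 /closure_seq[u u0 uy]] := projection x0 sA.
have py0 : phi y0 = 0.
  have : phi (u n) @[n --> \oo] --> (phi y0 : R[i]^o).
    apply: (@cvg_nrm_le R (R[i]^o : normedModType R[i]) _ \oo _ _ _
      (fun n => C * nrm (y0 - u n))).
      by apply: nearW => n; rewrite -phiB bphi.
    by rewrite -[X in _ --> X](mulr0 C); apply: cvgMl_tmp; exact/cvg_nrm0.
  under eq_fun do rewrite u0.
  move=> H; exact: (@cvg_uniq R (R[i]^o) nat \oo _ _ _ _ H (cvg_cst _)).
set z := x0 - y0 => zA.
have pz : phi z = phi x0 by rewrite phiB py0 subr0.
have z0 : nrm z != 0.
  by apply: contra_neq px0 => /nrm_eq0 zz; rewrite -pz zz phi0.
exists (conjc (phi z / (nrm z ^+ 2)%:C) *: z) => x.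
have := zA (phi z *: x - phi x *: z).
rewrite /= phiB.
have phiZ a w : phi (a *: w) = a * phi w by have := lphi a w 0; rewrite phi0 !addr0.
rewrite !phiZ [phi x * _]mulrC subrr => /(_ erefl).
rewrite dot_conj => /(congr1 conjc); rewrite conjcK conjc0 dotBr !dotZr dotxx.
move=> /eqP; rewrite subr_eq0 => /eqP H.
rewrite dotZl conjcK mulrAC H mulfK//.
by rewrite fmorph_eq0 expf_eq0.
Qed.

Lemma adjoint_exists E F (B : E -> F) : bounded_linear B ->
  exists2 B' : F -> E, bounded_linear B' & forall x y, dot (B x) y = dot x (B' y).
Proof.
move=> bB; have [C C0 HC] := bounded_linear_bound bB; have lB := bB.1.
have /choice[B' HB'] (y : F) : exists w, forall x, dot y (B x) = dot w x.
  apply: (riesz (C := nrm y * C)) => [a x z|x]; first by rewrite lB dotDr dotZr.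
  by apply: le_trans (dot_le _ _) _; rewrite -mulrA ler_wpM2l ?nrm_ge0.
exists B' => [|x y]; last by rewrite dot_conj HB' -dot_conj.
apply: (bound_bounded_linear (C := C)) => [a x y|y].
  apply/eqP; rewrite -subr_eq0; apply/eqP.
  set w := _ - _; apply: nrm_eq0; apply/eqP; rewrite -sqrf_eq0 -rdotxx /rdot.
  by rewrite {1}/w dotBl dotDl dotZl -!HB' dotDl dotZl subrr.
have [y0|y0] := eqVneq (nrm (B' y)) 0; first by rewrite y0 mulr_ge0 ?nrm_ge0.
have : nrm (B' y) ^+ 2 <= C * nrm y * nrm (B' y).
  rewrite -rdotxx /rdot -HB' -/(rdot _ _); apply: le_trans (rdot_le _ _) _.
  by rewrite [C * _]mulrC -mulrA ler_wpM2l ?nrm_ge0.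
by rewrite expr2 ler_pM2r// lt_def y0 nrm_ge0.
Qed.

End Projection.

(** * Extension of bounded maps by density *)

Section Extension.
Context {R : realType}.
Implicit Types E F : hilbertType R.

(** The bound, stable under closure, makes the closed graph single-valued, and completeness makes it
    total. A graph is used because the partial map is often known only through witnesses, such as
    the trajectory joining two points. *)
Lemma extend_graph E F (A : set (E * F)) (C : R) : 0 <= C ->
  linear_subspace A -> (forall x y, A (x, y) -> nrm y <= C * nrm x) ->
  dense [set x | exists y, A (x, y)] ->
  exists B : E -> F, [/\ bounded_linear B, forall x y, A (x, y) -> B x = y &
    forall x, nrm (B x) <= C * nrm x].
Proof.
move=> C0 sA AC dA.
have cAC x y : closure A (x, y) -> nrm y <= C * nrm x.
  move=> /closure2_seq[u [v [Auv ux vy]]].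
  apply: (ler_cvg_to (cvg_nrm vy) (cvgMl_tmp (a := C) (cvg_nrm ux))).
  by apply: nearW => n; exact: AC.
have scA := closure2_subspace sA.
have /choice[B HB] (x : E) : exists y, closure A (x, y).
  have /closure_seq[u + ux] := (dense_closure _).1 dA x.
  move=> /choice[v Auv].
  have [y vy] : exists y : F, v @ \oo --> y.
    apply: cauchy_nrm => e e0.
    have f0 : 0 < e / (2 * (C + 1)) by rewrite divr_gt0//; lra.
    have [N _ HN] := (cvg_nrmP _ _).1 ux _ f0.
    exists N => m n Nm Nn.
    have Ap : A (u m - u n, v m - v n) by exact: (subspaceB (x := (_, _)) (y := (_, _))).
    apply: le_lt_trans (AC _ _ Ap) _.
    have H : nrm (u m - u n) <= 2 * (e / (2 * (C + 1))).
      apply: le_trans (nrm_dist x _ _) _; rewrite nrmBC mulr_natl mulr2n.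
      by apply: lerD; apply: ltW; apply: HN.
    apply: (@le_lt_trans _ _ (C * (2 * (e / (2 * (C + 1)))))).
      by rewrite ler_wpM2l.
    have -> : C * (2 * (e / (2 * (C + 1)))) = e * (C / (C + 1)) by field; lra.
    by rewrite gtr_pMr// ltr_pdivrMr; lra.
  by exists y; apply: closure2_lim ux vy _; exact: nearW.
have uB x y : closure A (x, y) -> B x = y.
  move=> cxy; apply/eqP; rewrite -subr_eq0; apply/eqP/nrm_eq0/eqP.
  rewrite eq_le nrm_ge0 andbT -(mulr0 C) -(@nrm0 _ E); apply: cAC.
  by rewrite -(subrr x); exact: (subspaceB scA (HB x) cxy).
exists B; split=> [|x y Axy|x].
- apply: (bound_bounded_linear (C := C)) => [a x y|x]; last exact: cAC.
  by apply: uB; exact: (scA.2 a (_, _) (_, _)).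
- by apply: uB; exact: subset_closure.
- exact: cAC.
Qed.

(** The bound on all finite combinations also settles well-definedness when the vectors [phi i] are
    linearly dependent. *)
Lemma extend_family E F (I : Type) (phi : I -> E) (psi : I -> F) (C : R) :
  0 <= C -> dense (lspan (range phi)) ->
  (forall s : seq (R[i] * I), nrm (\sum_(k <- s) k.1 *: psi k.2) <=
     C * nrm (\sum_(k <- s) k.1 *: phi k.2)) ->
  exists B : E -> F, [/\ bounded_linear B, forall i, B (phi i) = psi i &
    forall x, nrm (B x) <= C * nrm x].
Proof.
move=> C0 dphi bC.
pose A := [set p | exists s : seq (R[i] * I), p = (\sum_(k <- s) k.1 *: phi k.2,
  \sum_(k <- s) k.1 *: psi k.2)].
have [||x _ [s [-> ->]]//||B [bB AB BC]] := @extend_graph E F A C.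
- exact: C0.
- split; first by exists [::]; rewrite !big_nil.
  move=> a _ _ [s ->] [t ->]; exists ([seq (a * k.1, k.2) | k <- s] ++ t).
  rewrite !big_cat !big_map; congr (_, _) => /=; rewrite scaler_sumr;
    by congr (_ + _); apply: eq_bigr => k _; rewrite scalerA.
- apply/denseP => x e e0; have [a /lspan_rangeP[s as_] ax] := (denseP _).1 dphi x e e0.
  by exists a => //; exists (\sum_(k <- s) k.1 *: psi k.2), s; rewrite as_.
exists B; split => // i; apply: AB; exists [:: (1, i)].
by rewrite !big_seq1 !scale1r.
Qed.

End Extension.

(** * Trajectories and unitary groups *)

Section RealCalculus.
Context {R : realType}.

Lemma is_derive_limit (f : R -> R) (t d : R) :
  h^-1 * (f (t + h) - f t) @[h --> (0 : R)^'] --> d -> is_derive t 1 f d.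
Proof.
move=> fd; have fd' : h^-1 *: ((f \o shift t) (h *: (1 : R)) - f t)
    @[h --> (0 : R)^'] --> d.
  rewrite (_ : (fun h => _) = (fun h => h^-1 * (f (t + h) - f t)))//.
  by apply/funext => h; rewrite /= [_%:A]mulr1 [h + t]addrC.
by apply: DeriveDef; [exact: cvgP fd'|exact: cvg_lim fd'].
Qed.

(** A mean value theorem for increments of either sign. The second bound on the intermediate point
    serves Cauchy's form of the Taylor remainder. *)
Lemma MVT0 (f df : R -> R) (h : R) :
  (forall s : R, `|s| <= `|h| -> is_derive s 1 f (df s)) ->
  exists2 x, (`|x| <= `|h|) && (`|h - x| <= `|h|) & f h - f 0 = df x * h.
Proof.
move=> fd; have [h0|h0] := leP 0 h.
  have [|//||x] := @MVT_segment R f df 0 h.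
  - exact: h0.
  - by move=> x; rewrite in_itv/= => /andP[x0 xh]; apply: fd; rewrite !ger0_norm// ltW.
  - apply: derivable_within_continuous => x; rewrite in_itv/= => /andP[x0 xh].
    by have [] := fd x; rewrite ?ger0_norm.
  rewrite in_itv/= => /andP[x0 xh]; rewrite subr0 => E.
  by exists x => //; rewrite !ger0_norm ?subr_ge0// xh gerBl.
have [|x|x|x] := @MVT_segment R f df h 0.
- exact: ltW.
- rewrite in_itv/= => /andP[x0 xh]; apply: fd; rewrite !ltr0_norm//.
  by rewrite lerN2 ltW.
- apply: derivable_within_continuous => {}x; rewrite in_itv/= => /andP[x0 xh].
  by have [] := fd x; rewrite ?(ltr0_norm h0) ?ler0_norm ?lerN2.
rewrite in_itv/= => /andP[x0 xh] E.
exists x; first by rewrite (ltr0_norm h0) (ler0_norm xh) lerN2 x0 ler0_norm ?subr_le0//; lra.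
by apply: oppr_inj; rewrite opprB E sub0r mulrN.
Qed.

Lemma derive0_const (f : R -> R) (r t : R) :
  (forall s : R, `|s| < r -> is_derive s 1 f 0) -> `|t| < r -> f t = f 0.
Proof.
move=> fd tr; have [|x _] := @MVT0 f (fun=> 0) t.
  by move=> s st; apply: fd; exact: le_lt_trans tr.
by rewrite /= mul0r => /eqP; rewrite subr_eq0 => /eqP.
Qed.

End RealCalculus.

Section VectorDerivative.
Context {R : realType}.
Implicit Type E : hilbertType R.

Definition deriv_at E (c : R -> E) (t : R) (v : E) : Prop :=
  (h^-1)%:C *: (c (t + h) - c t) @[h --> (0 : R)^'] --> v.

Lemma cvg_dnbhs0 : h @[h --> (0 : R)^'] --> (0 : R).
Proof. exact: nbhs_dnbhs. Qed.

Lemma deriv_at_cont0 E (c : R -> E) t v : deriv_at c t v ->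
  c (t + h) @[h --> (0 : R)^'] --> c t.
Proof.
move=> cv; have nv : nrm ((h^-1)%:C *: (c (t + h) - c t)) @[h --> (0 : R)^'] --> nrm v.
  exact: cvg_nrm.
apply: (@cvg_nrm_le _ _ _ _ _ _ _ (fun h => `|h| *
  nrm ((h^-1)%:C *: (c (t + h) - c t)))).
  near=> h; have h0 : h != 0 by near: h; exact: nbhs_dnbhs_neq.
  by rewrite nrmZr mulrA normfV mulfV ?mul1r ?normr_eq0// nrmBC.
rewrite -[X in _ --> X](mul0r (nrm v)); apply: cvgM => //.
by rewrite -[X in _ --> X](@normr0 _ R); apply: cvg_norm; exact: cvg_dnbhs0.
Unshelve. all: by end_near. Qed.

Lemma deriv_at_continuous E (c : R -> E) t v : deriv_at c t v ->
  c s @[s --> t] --> c t.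
Proof.
move=> /deriv_at_cont0 /cvg_nrmP ct; apply/cvg_nrmP => e e0.
have := ct e e0 => -[d /= d0 H]; exists d => //= s st.
have [->|st0] := eqVneq s t; first by rewrite subrr nrm0.
have := H (s - t); rewrite /ball_/= sub0r normrN distrC [t + _]addrC subrK.
by apply => //; rewrite subr_eq0.
Qed.

Lemma deriv_at_cst E (x : E) t : deriv_at (fun=> x) t 0.
Proof.
rewrite /deriv_at; under eq_fun do rewrite subrr scaler0.
exact: cvg_cst.
Qed.

Lemma deriv_atD E (a : R[i]) (c d : R -> E) t v w : deriv_at c t v ->
  deriv_at d t w -> deriv_at (fun s => a *: c s + d s) t (a *: v + w).
Proof.
move=> cv dw; rewrite /deriv_at.
rewrite (_ : (fun h => _) = (fun h => a *: ((h^-1)%:C *: (c (t + h) - c t)) +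
  (h^-1)%:C *: (d (t + h) - d t))).
  by apply: cvgDc => //; exact: cvgZc.
apply/funext => h; rewrite scalerA mulrC -scalerA -scalerDr.
by rewrite opprD addrACA scalerBr.
Qed.

Lemma deriv_at_shift E (c : R -> E) s t v :
  deriv_at c (t + s) v -> deriv_at (fun x => c (x + s)) t v.
Proof. by rewrite /deriv_at; under eq_fun do rewrite addrAC. Qed.

Lemma deriv_at_eq E (c d : R -> E) t (e : R) v : 0 < e ->
  (forall h, `|h| < e -> c (t + h) = d (t + h)) -> deriv_at c t v -> deriv_at d t v.
Proof.
move=> e0 cd; apply: cvg_trans; apply: near_eq_cvg.
near=> h; rewrite -(addr0 t) -addrA add0r !cd ?addr0 ?normr0//.
  by near: h; exact: dnbhs0_lt.
Unshelve. all: by end_near. Qed.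

Lemma deriv_at_id E (v : E) t : deriv_at (fun s => s%:C *: v) t v.
Proof.
rewrite /deriv_at; apply: (@cvg_trans _ (v @[_ --> (0 : R)^'])); last exact: cvg_cst.
apply: near_eq_cvg.
near=> h; have h0 : h != 0 by near: h; exact: nbhs_dnbhs_neq.
by rewrite -scalerBl -rmorphB /= addrC addKr scalerA -rmorphM /= mulVf// scale1r.
Unshelve. all: by end_near. Qed.

Lemma is_derive_rdot E (c d : R -> E) t v w : deriv_at c t v -> deriv_at d t w ->
  is_derive t 1 (fun s => rdot (c s) (d s)) (rdot v (d t) + rdot (c t) w).
Proof.
move=> cv dw; apply: is_derive_limit.
rewrite (_ : (fun h => _) = (fun h => rdot ((h^-1)%:C *: (c (t + h) - c t)) (d (t + h)) +
  rdot (c t) ((h^-1)%:C *: (d (t + h) - d t)))).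
  apply: cvgD; first by apply: cvg_rdot => //; exact: deriv_at_cont0 dw.
  by apply: cvg_rdot => //; exact: cvg_cst.
by apply/funext => h; rewrite rdotZl rdotZr rdotBl rdotBr; ring.
Qed.

(** Apply the real mean value theorem to the pairing with the fixed vector [c h - c 0 - h v] itself,
    then divide by the norm of that vector. *)
Lemma deriv_at_mvt E (c c' : R -> E) (h M : R) (v : E) :
  (forall s, `|s| <= `|h| -> deriv_at c s (c' s) /\ nrm (c' s - v) <= M) ->
  nrm (c h - c 0 - h%:C *: v) <= `|h| * M.
Proof.
move=> H; set psi := c h - c 0 - h%:C *: v.
have [|x /andP[xh _]] := @MVT0 R (fun s => rdot psi (-1 *: (s%:C *: v) + c s))
  (fun s => rdot psi (c' s - v)) h.
  move=> s sh; have := is_derive_rdot (@deriv_at_cst E psi s)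
    (deriv_atD (a := -1) (@deriv_at_id E v s) (H s sh).1).
  by rewrite [rdot 0 _]rdotC rdot0r add0r scaleN1r [- v + _]addrC.
rewrite /= scale0r scaler0 add0r scaleN1r -rdotBr.
rewrite [- _ + _]addrC addrAC -/psi rdotxx => E1.
have [p0|p0] := eqVneq (nrm psi) 0.
  rewrite p0 mulr_ge0//; have := H x xh => -[_]; apply: le_trans.
  exact: nrm_ge0.
have pp : 0 < nrm psi by rewrite lt_def p0 nrm_ge0.
rewrite -(ler_pM2l pp) -expr2 E1; apply: le_trans (ler_norm _) _.
rewrite normrM mulrCA mulrC ler_wpM2l//; apply: le_trans (rdot_norm _ _) _.
by rewrite ler_pM2l//; have [] := H x xh.
Qed.

End VectorDerivative.

(** * Trajectories of a skew operator: norm conservation and uniqueness *)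

Section Trajectories.
Context {R : realType} {E : hilbertType R} (G : set (E * E)).
Hypotheses (sG : linear_subspace G) (skG : forall x y, G (x, y) -> rdot x y = 0).

Definition trajectory (I : set R) (c c' : R -> E) : Prop :=
  forall t, I t -> closure G (c t, c' t) /\ deriv_at c t (c' t).

Lemma closure_skew x y : closure G (x, y) -> rdot x y = 0.
Proof.
move=> /closure2_seq[u [v [Guv ux vy]]].
apply: (cvgR_uniq (cvg_rdot ux vy)).
by under eq_fun do rewrite skG//; exact: cvg_cst.
Qed.

Lemma trajectoryD I a c c' d d' : trajectory I c c' -> trajectory I d d' ->
  trajectory I (fun s => a *: c s + d s) (fun s => a *: c' s + d' s).
Proof.
move=> cc dd t It; have [Gc dc] := cc t It; have [Gd de] := dd t It; split.
  exact: ((closure2_subspace sG).2 a (_, _) (_, _)).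
exact: deriv_atD.
Qed.

Lemma trajectory0 I : trajectory I (fun=> 0) (fun=> 0).
Proof.
move=> t _; split; last exact: deriv_at_cst.
by apply: subset_closure; exact: (subspace0 sG).
Qed.

Lemma trajectory_shift c c' s : trajectory setT c c' ->
  trajectory setT (fun t => c (t + s)) (fun t => c' (t + s)).
Proof.
move=> cc t _; have [Gc dc] := cc (t + s) I.
by split => //; exact: deriv_at_shift.
Qed.

Lemma trajectory_nrm (r : R) c c' t : trajectory [set t | `|t| < r] c c' ->
  `|t| < r -> nrm (c t) = nrm (c 0).
Proof.
move=> cc tr; apply/eqP; rewrite -(@eqrXn2 _ 2)//; try exact: nrm_ge0.
rewrite -!rdotxx; apply/eqP.
apply: (@derive0_const R (fun s => rdot (c s) (c s)) r) => // s sr.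
have [Gc dc] := cc s sr; have := is_derive_rdot dc dc.
by rewrite [rdot (c' s) _]rdotC (closure_skew Gc) addr0.
Qed.

(** The difference is a trajectory starting at 0, and trajectories conserve the norm. *)
Lemma trajectory_uniq (r : R) c c' d d' t : trajectory [set t | `|t| < r] c c' ->
  trajectory [set t | `|t| < r] d d' -> c 0 = d 0 -> `|t| < r -> c t = d t.
Proof.
move=> cc dd cd0 tr; have := trajectory_nrm (trajectoryD (-1) dd cc) tr.
rewrite cd0 !scaleN1r addNr nrm0 => /nrm_eq0/eqP.
by rewrite addrC subr_eq0 => /eqP.
Qed.

Lemma trajectoryT (r : R) c c' : trajectory setT c c' ->
  trajectory [set t | `|t| < r] c c'.
Proof. by move=> cc t _; exact: cc. Qed.

Lemma trajectoryT_nrm c c' t : trajectory setT c c' -> nrm (c t) = nrm (c 0).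
Proof.
by move=> cc; have /trajectory_nrm := @trajectoryT (`|t| + 1) _ _ cc; apply; rewrite ltrDl.
Qed.

Definition trajectory_start : set E :=
  [set x | exists c c', trajectory setT c c' /\ c 0 = x].

Lemma trajectory_start_subspace : linear_subspace trajectory_start.
Proof.
split; first by exists (fun=> 0), (fun=> 0); split => //; exact: trajectory0.
move=> a _ _ [c [c' [cc <-]]] [d [d' [dd <-]]].
exists (fun s => a *: c s + d s), (fun s => a *: c' s + d' s); split => //.
exact: trajectoryD.
Qed.

End Trajectories.

(** * Unitary groups generated by trajectories *)

Section StoneGroup.
Context {R : realType} {E : hilbertType R} (G : set (E * E)).
Hypotheses (sG : linear_subspace G) (skG : forall x y, G (x, y) -> rdot x y = 0).
Hypothesis dG : dense (trajectory_start G).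

Lemma dot_nrm_preserve (F : hilbertType R) (B : E -> F) : linear B ->
  (forall x, nrm (B x) = nrm x) -> forall x y, dot (B x) (B y) = dot x y.
Proof.
move=> lB nB; have BD x y : B (x + y) = B x + B y by exact: lfunD.
have BZ a x : B (a *: x) = a *: B x by exact: lfunZ.
have rB x y : rdot (B x) (B y) = rdot x y.
  have := nB (x + y); rewrite BD => /(congr1 (fun z => z ^+ 2)).
  by rewrite !nrmD2 !nB; lra.
by move=> x y; apply: dot_rdotP; rewrite ?rB// -BZ rB.
Qed.

(** At each time the relation between start and position is linear and isometric with dense domain,
    so it extends to the whole space. *)
Lemma trajectory_group : exists W : R -> E -> E, [/\ forall t, linear (W t),
  forall t x, nrm (W t x) = nrm x, forall t, continuous (W t) &
  forall c c', trajectory G setT c c' -> forall t, W t (c 0) = c t].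
Proof.
have /choice[W HW] (t : R) : exists B : E -> E, [/\ bounded_linear B,
    forall x y, (exists c c', [/\ trajectory G setT c c', c 0 = x & c t = y]) ->
      B x = y & forall x, nrm (B x) <= 1 * nrm x].
  apply: (@extend_graph R E E [set p | exists c c',
    [/\ trajectory G setT c c', c 0 = p.1 & c t = p.2]]) => //.
  - split.
      by exists (fun=> 0), (fun=> 0); split => //; exact: trajectory0.
    move=> a [x x'] [y y'] [c [c' [cc /= <- <-]]] [d [d' [dd /= <- <-]]].
    exists (fun s => a *: c s + d s), (fun s => a *: c' s + d' s); split => //.
    exact: trajectoryD.
  - move=> _ _ [c [c' [cc /= <- <-]]].
    by rewrite mul1r (trajectoryT_nrm skG _ cc).
  - apply/denseP => x e e0.
    have [a [c [c' [cc ca]]] xa] := (denseP _).1 dG x e e0.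
    by exists a => //; exists (c t), c, c'.
exists W; split => [t|t x|t|c c' cc t].
- by have [[]] := HW t.
- have [[lW cW] Wt _] := HW t.
  have /closure_seq[u + ux] := (dense_closure _).1 dG x.
  move=> /choice[c] /choice[c' Hc].
  have H : nrm (W t (u n)) @[n --> \oo] --> nrm (W t x).
    by apply: cvg_nrm; apply: (cvg_comp _ _ ux); exact: cW.
  apply: (cvgR_uniq H); rewrite (_ : (fun n => _) = (fun n => nrm (u n))).
    exact: cvg_nrm.
  apply/funext => n; have [cc cu] := Hc n.
  by rewrite (Wt _ (c n t)) ?(trajectoryT_nrm skG _ cc) ?cu//; exists (c n), (c' n).
- by have [[]] := HW t.
- by have [_ Wt _] := HW t; apply: Wt; exists c, c'.
Qed.

(** Surjectivity of [1 - G] on the closed graph spanned by trajectories, the substitute for the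
    range criterion of essential skew-adjointness. The range is dense by the exponential growth
    argument, and it is closed because skewness gives [|x - y|^2 = |x|^2 + |y|^2]. *)
Lemma trajectory_range z : exists x y,
  [/\ closure [set p | exists c c', [/\ trajectory G setT c c', c 0 = p.1 & c' 0 = p.2]] (x, y)
    & z = x - y].
Proof.
set GT := [set p | _].
have sGT : linear_subspace GT.
  split; first by exists (fun=> 0), (fun=> 0); split => //; exact: trajectory0.
  move=> a [x x'] [y y'] [c [c' [cc /= <- <-]]] [d [d' [dd /= <- <-]]].
  exists (fun s => a *: c s + d s), (fun s => a *: c' s + d' s); split => //.
  exact: trajectoryD.
have GTG p : GT p -> closure G p.
  by case: p => x y [c [c' [cc /= <- <-]]]; exact: (cc 0 I).1.
have nGT x y : GT (x, y) -> nrm (x - y) ^+ 2 = nrm x ^+ 2 + nrm y ^+ 2.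
  by move=> /GTG/(closure_skew skG); rewrite nrmB2 => ->; lra.
have dA : dense [set p.1 - p.2 | p in GT].
  apply: dense_of_orth.
    split; first by exists 0; [exact: subspace0|rewrite /= subr0].
    move=> a _ _ [p Gp <-] [q Gq <-]; exists (a *: p + q); first exact: sGT.2.
    by rewrite /= scalerBr opprD addrACA.
  move=> psi psiA; apply: (dense_orth dG); apply: rdot_subspace.
    exact: trajectory_start_subspace.
  move=> _ [c [c' [cc <-]]].
  have cp (t : R) : is_derive t 1 (fun s => rdot (c s) psi) (rdot (c t) psi).
    have := is_derive_rdot (cc t I).2 (@deriv_at_cst _ E psi t).
    rewrite rdot0r addr0; suff -> : rdot (c' t) psi = rdot (c t) psi by [].
    apply/eqP; rewrite eq_sym -subr_eq0 -rdotBl /rdot psiA//.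
    exists (c t, c' t) => //; exists (fun s => c (s + t)), (fun s => c' (s + t)).
    by rewrite /= !add0r; split => //; exact: trajectory_shift.
  (* A vector orthogonal to the range of [1 - G] is orthogonal to every start: *)
  (* its pairing with a trajectory grows like [e^t], but the norm is conserved. *)
  have H t : rdot (c t) psi = expR t * rdot (c 0) psi.
    pose f s := expR (- s) * rdot (c s) psi.
    have : f t = f 0.
      apply: is_derive_0_is_cst => s.
      have d1 : is_derive s 1 (fun s => expR (- s)) (expR (- s) * -1).
        by apply: is_derive1_comp; exact: is_deriveN.
      have h := is_deriveM d1 (cp s).
      rewrite (_ : f = (fun s => expR (- s)) * (fun s => rdot (c s) psi))//.
      apply: is_derive_eq h _.
      by rewrite /= -![_ *: _]/(_ * _); ring.
    rewrite /f oppr0 expR0 mul1r => <-.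
    by rewrite mulrA -expRD subrr expR0 mul1r.
  pose M := nrm (c 0) * nrm psi; pose r := rdot (c 0) psi.
  have HM t : expR t * `|r| <= M.
    rewrite -[expR t]gtr0_norm ?expR_gt0// -normrM -H.
    by apply: le_trans (rdot_norm _ _) _; rewrite (trajectoryT_nrm skG _ cc).
  have M0 : 0 <= M by rewrite mulr_ge0 ?nrm_ge0.
  apply/eqP; apply: contraT; rewrite -normr_gt0 -/r => r0.
  have := HM (M / `|r|); have := expR_ge1Dx (M / `|r|) => H1 H2.
  have : (1 + M / `|r|) * `|r| <= M by apply: le_trans H2; rewrite ler_pM2r.
  by rewrite mulrDl divfK ?gt_eqF//; lra.
have /closure_seq[u + uz] := (dense_closure _).1 dA z.
move=> Hu; have {Hu}/choice[p Hp] n : exists p, GT p /\ p.1 - p.2 = u n.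
  by have [p ? ?] := Hu n; exists p.
(* The Pythagorean identity bounds the differences of first components by those of the convergent
   sequence [u]. *)
have [x px] : exists x : E, (fun n => (p n).1) @ \oo --> x.
  apply: cauchy_nrm => e e0.
  have [|N _ HN] := (cvg_nrmP _ _).1 uz (e / 2); first by rewrite divr_gt0.
  exists N => m n Nm Nn.
  apply: (@le_lt_trans _ _ (nrm (u m - u n))).
    have Gmn : GT ((p m).1 - (p n).1, (p m).2 - (p n).2).
      exact: (subspaceB sGT (Hp m).1 (Hp n).1).
    have := nGT _ _ Gmn; rewrite subACA (Hp m).2 (Hp n).2 => H.
    by rewrite -(@ler_pXn2r _ 2)// ?nnegrE ?nrm_ge0// H lerDl sqr_ge0.
  apply: le_lt_trans (nrm_dist z _ _) _; rewrite nrmBC [e]splitr.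
  by apply: ltrD; exact: HN.
exists x, (x - z); split; last by rewrite opprB addrCA subrr addr0.
apply: (@closure2_lim _ _ _ _ _ \oo _ (fun n => (p n).1) (fun n => (p n).1 - u n)).
- exact: px.
- exact: cvgBc.
- apply: nearW => n; have [Gp <-] := Hp n.
  by rewrite opprB addrCA subrr addr0; case: (p n) Gp.
Qed.

(** A skew operator has no proper skew extension once [1 - G] is onto: if two pairs of a skew graph
    have the same [x - y], they differ by some [(w, w)], and skewness gives [|w|^2 = 0]. *)
Lemma closure_trajectories : closure G =
  closure [set p | exists c c', [/\ trajectory G setT c c', c 0 = p.1 & c' 0 = p.2]].
Proof.
apply/seteqP; split => [[x y] Gxy|]; last first.
  have -> : closure G = closure (closure G).
    by apply: (closure_id _).1; exact: closed_closure.
  by apply: closure_subset => -[x y] [c [c' [cc /= <- <-]]]; exact: (cc 0 I).1.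
have [x' [y' [Gxy' xy]]] := trajectory_range (x - y).
suff xx : x = x'.
  move: Gxy'; rewrite -xx; suff -> : y = y' by [].
  by move: xy; rewrite -xx => /addrI/oppr_inj.
have Gxy2 : closure G (x', y').
  have -> : closure G = closure (closure G).
    by apply: (closure_id _).1; exact: closed_closure.
  by apply: closure_subset Gxy' => -[? ?] [c [c' [cc /= <- <-]]]; exact: (cc 0 I).1.
have := closure_skew skG (subspaceB (closure2_subspace sG) Gxy Gxy2).
rewrite /= (subr_swap xy) rdotxx => /eqP; rewrite sqrf_eq0 => /eqP/nrm_eq0/eqP.
by rewrite subr_eq0 => /eqP.
Qed.

Lemma derive_uniq (f : R -> R) (t a b : R) :
  is_derive t 1 f a -> is_derive t 1 f b -> a = b.
Proof. by move=> [_ <-] [_ <-]. Qed.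

Lemma generator_skew (W : R -> E -> E) : W 0 = id ->
  (forall t x, nrm (W t x) = nrm x) ->
  forall x y, group_generator W (x, y) -> rdot x y = 0.
Proof.
move=> W0 nW x y Wxy; have dW : deriv_at (fun h => W h x) 0 y.
  rewrite /deriv_at W0; under eq_fun do rewrite add0r.
  exact: Wxy.
have := is_derive_rdot dW dW.
rewrite (_ : (fun s => _) = cst (nrm x ^+ 2)); last first.
  by apply/funext => s; rewrite rdotxx nW.
move=> /derive_uniq/(_ (is_derive_cst _ _ _)); rewrite W0 /= (rdotC y).
by lra.
Qed.

(** The generator is skew, so maximality puts it inside the closure of [G]. Conversely, pairs on
    trajectories are limits of difference quotients with an error controlled by strong continuity
    alone, and this control survives passing to the closure. *)
Theorem stone_trajectories : exists W : R -> E -> E,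
  unitary_group W /\ group_generator W = closure G.
Proof.
have [W [lW nW cW Wc]] := trajectory_group.
have W0 : W 0 = id.
  apply/funext => x; apply: (eq_dense (f := W 0) (g := id) dG) => //.
    by move=> y; exact: cvg_id.
  by move=> _ [c [c' [cc <-]]]; rewrite (Wc _ _ cc).
have WD s t x : W (s + t) x = W s (W t x).
  apply: (eq_dense (f := W (s + t)) (g := W s \o W t) dG) => //.
    by move=> y; apply: continuous_comp; exact: cW.
  move=> _ [c [c' [cc <-]]] /=; rewrite !(Wc _ _ cc).
  by have := Wc _ _ (trajectory_shift t cc) s; rewrite add0r.
have WB t x y : W t x - W t y = W t (x - y) by rewrite (lfunB _ _ (lW t)).
have UW : unitary_group W.
  split => //; first by move=> t; exact: dot_nrm_preserve.
  move=> u t; apply/cvg_nrmP => e e0.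
  have e3 : 0 < e / 3 by rewrite divr_gt0.
  have [_ [c [c' [cc <-]]] ua] := (denseP _).1 dG u _ e3.
  have /cvg_nrmP/(_ _ e3) := deriv_at_continuous (cc t I).2.
  apply: filterS => s cs.
  apply: le_lt_trans (nrm_dist (c t) _ _) _.
  have : nrm (W t u - c t) < e / 3 by rewrite -(Wc _ _ cc) WB nW.
  have : nrm (c t - W s u) < e / 3 + e / 3.
    apply: le_lt_trans (nrm_dist (c s) _ _) _; apply: ltrD => //.
    by rewrite -(Wc _ _ cc s) WB nW nrmBC.
  by move=> H1 H2; apply: lt_le_trans (ltrD H2 H1) _; lra.
exists W; split => //; apply/seteqP; split => -[x y].
  move=> Wxy; rewrite closure_trajectories.
  have [x' [y' [Gxy' xy]]] := trajectory_range (x - y).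
  suff xx : x = x'.
    move: Gxy'; rewrite -xx; suff -> : y = y' by [].
    by move: xy; rewrite -xx => /addrI/oppr_inj.
  have [u [v [Huv ux vy]]] := closure2_seq Gxy'.
  have : rdot (x - x') (y - y') = 0.
    have H : rdot (x - u n) (y - v n) @[n --> \oo] --> rdot (x - x') (y - y').
      by apply: cvg_rdot; apply: cvgBc => //; exact: cvg_cst.
    apply: (cvgR_uniq H).
    rewrite (_ : (fun n => _) = cst 0); first exact: cvg_cst.
    apply/funext => n; apply: (generator_skew W0 nW).
    have [c [c' [cc /= <- <-]]] := Huv n.
    rewrite /group_generator /=.
    rewrite (_ : (fun h => _) = (fun h => (h^-1)%:C *: (W h x - x) -
      (h^-1)%:C *: (c (0 + h) - c 0))).
      by apply: cvgBc; [exact: Wxy|exact: (cc 0 I).2].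
    apply/funext => h; rewrite add0r -scalerBr -WB (Wc _ _ cc).
    by rewrite subACA.
  rewrite (subr_swap xy) rdotxx => /eqP; rewrite sqrf_eq0 => /eqP/nrm_eq0/eqP.
  by rewrite subr_eq0 => /eqP.
rewrite closure_trajectories => /closure2_seq[u [v [Huv ux vy]]].
apply/cvg_nrmP => e e0; have e2 : 0 < e / 2 by rewrite divr_gt0.
have [_ _ _ _ /(_ y 0)/cvg_nrmP/(_ _ e2) [d /= d0 Hd]] := UW.
(* The estimate is proved for approximating trajectories, with an extra error [2 |y - v n|], and
   then [n] tends to infinity. The radius [d] depends on the limit [y] only. *)
have key h : `|h| < d -> nrm (W h x - x - h%:C *: y) <= `|h| * (e / 2).
  move=> hd.
  have l1 : nrm (W h (u n) - u n - h%:C *: v n) @[n --> \oo] -->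
      nrm (W h x - x - h%:C *: y).
    apply: cvg_nrm; apply: cvgBc; last exact: cvgZc.
    by apply: cvgBc => //; apply: (cvg_comp _ _ ux); exact: cW.
  have l2 : `|h| * (e / 2 + 2 * nrm (y - v n)) @[n --> \oo] -->
      `|h| * (e / 2 + 2 * 0).
    apply: cvgMl_tmp; apply: cvgD; first exact: cvg_cst.
    by apply: cvgMl_tmp; exact/cvg_nrm0.
  rewrite mulr0 addr0 in l2; apply: (ler_cvg_to l1 l2); apply: nearW => n.
  have [c [c' [cc /= <- <-]]] := Huv n.
  rewrite (Wc _ _ cc); apply: (deriv_at_mvt (c' := c')) => s sh.
  split; first exact: (cc s I).2.
  have c's : c' s = W s (c' 0).
    apply: (@cvg_uniq _ _ _ _ _ _ _ _ (cc s I).2).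
    rewrite (_ : (fun h => _) = (fun h => W s ((h^-1)%:C *: (c (0 + h) - c 0)))).
      by apply: (cvg_comp _ _ (cc 0 I).2); exact: cW.
    apply/funext => k; have WZ a z : W s (a *: z) = a *: W s z by rewrite (lfunZ _ _ (lW s)).
    by rewrite WZ -WB add0r -(Wc _ _ cc (s + k)) -(Wc _ _ cc s) -(Wc _ _ cc k) WD.
  rewrite c's; have := Hd s; rewrite /ball_/= sub0r normrN W0.
  move=> /(_ (le_lt_trans sh hd)) ys.
  apply: le_trans (nrm_dist (W s y) _ _) _; rewrite WB nW.
  have := nrm_dist y (W s y) (c' 0); rewrite nrmBC in ys; rewrite (nrmBC (c' 0)).
  by move: ys => /=; lra.
near=> h.
have h0 : h != 0 by near: h; exact: nbhs_dnbhs_neq.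
have hd : `|h| < d by near: h; exact: dnbhs0_lt.
have -> : y - (h^-1)%:C *: (W h x - x) = - ((h^-1)%:C *: (W h x - x - h%:C *: y)).
  by rewrite [in RHS]scalerBr scalerA -rmorphM /= mulVf// scale1r opprB.
rewrite nrmN nrmZr normfV; apply: (@le_lt_trans _ _ (`|h|^-1 * (`|h| * (e / 2)))).
  by rewrite ler_wpM2l ?invr_ge0// key.
by rewrite mulrA mulVf ?normr_eq0// mul1r ltr_pdivrMr// ltr_pMr// ltr1n.
Unshelve. all: by end_near. Qed.

Lemma group_trajectory (W : R -> E -> E) : unitary_group W ->
  group_generator W = closure G -> forall x y, closure G (x, y) ->
  trajectory G setT (fun t => W t x) (fun t => W t y).
Proof.
move=> [lW dW W0 WD cW] gW x y Gxy t _.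
have nW s z : nrm (W s z) = nrm z.
  by apply/eqP; rewrite -(@eqrXn2 _ 2)// ?nrm_ge0// -!rdotxx /rdot dW.
have WB s a b : W s a - W s b = W s (a - b) by rewrite (lfunB _ _ (lW s)).
have WZ s a z : W s (a *: z) = a *: W s z by rewrite (lfunZ _ _ (lW s)).
have Wcvg T (F : set_system T) (FF : Filter F) (f : T -> E) l :
    f @ F --> l -> W t (f z) @[z --> F] --> W t l.
  move=> /cvg_nrm0 fl; apply/cvg_nrm0.
  by under eq_fun do rewrite WB nW.
have := Gxy; rewrite -gW => gxy; split.
  rewrite /group_generator /=.
  rewrite (_ : (fun h => _) = (fun h => W t ((h^-1)%:C *: (W h x - x)))).
    exact: (Wcvg _ _ _ _ _ gxy).
  by apply/funext => h; rewrite WZ -WB -!WD [t + h]addrC.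
rewrite /deriv_at.
rewrite (_ : (fun h => _) = (fun h => W t ((h^-1)%:C *: (W h x - x)))).
  exact: (Wcvg _ _ _ _ _ gxy).
by apply/funext => h; rewrite WZ -WB -!WD.
Qed.

(** [exp_group] is a choice satisfying a specification; uniqueness of trajectories lets it be
    evaluated along a curve known only for short times. *)
Lemma group_local_trajectory (W : R -> E -> E) : unitary_group W ->
  group_generator W = closure G -> forall (r : R) c c' t,
  trajectory G [set t | `|t| < r] c c' -> `|t| < r -> W t (c 0) = c t.
Proof.
move=> uW gW r c c' t cc tr.
have r0 : `|0 : R| < r by rewrite normr0; exact: le_lt_trans tr.
have W0 : W 0 = id by case: uW.
have WW := trajectoryT (r := r) (group_trajectory uW gW (cc 0 r0).1).
by apply: (trajectory_uniq sG skG WW cc) => //; rewrite W0.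
Qed.



End StoneGroup.

(** * Analytic vectors *)

Section ExponentialSeries.
Context {R : realType}.
Implicit Type E : hilbertType R.

Definition texp (t : R) (m : nat) : R := t ^+ m / m`!%:R.

Lemma texp_ge0 (t : R) m : 0 <= t -> 0 <= texp t m.
Proof. by move=> t0; rewrite divr_ge0// exprn_ge0. Qed.

Lemma texp_norm (t : R) m : `|texp t m| = texp `|t| m.
Proof. by rewrite /texp normrM normrX normfV normr_nat. Qed.

Lemma texp_le (s t : R) m : 0 <= s -> s <= t -> texp s m <= texp t m.
Proof.
move=> s0 st; rewrite ler_pM2r ?invr_gt0 ?ltr0n ?fact_gt0//.
by rewrite lerXn2r// nnegrE (le_trans s0).
Qed.

Lemma pow_taylor2 (t h rho : R) m : `|t| <= rho -> `|t + h| <= rho ->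
  `|(t + h) ^+ m.+2 - t ^+ m.+2 - h * (m.+2%:R * t ^+ m.+1)| <=
  (m.+2 * m.+1)%:R * (h ^+ 2 * rho ^+ m).
Proof.
move=> tr thr; have r0 : 0 <= rho := le_trans (normr_ge0 _) tr.
elim: m => [|m IH].
  rewrite expr0 mulr1 expr1.
  have -> : (t + h) ^+ 2 - t ^+ 2 - h * (2%:R * t) = h ^+ 2 by ring.
  by rewrite ger0_norm ?sqr_ge0// ler_peMl ?sqr_ge0// ler1n.
have -> : (t + h) ^+ m.+3 - t ^+ m.+3 - h * (m.+3%:R * t ^+ m.+2) =
  (t + h) * ((t + h) ^+ m.+2 - t ^+ m.+2 - h * (m.+2%:R * t ^+ m.+1)) +
  m.+2%:R * (h ^+ 2 * t ^+ m.+1).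
  by rewrite [(t + h) ^+ m.+3]exprS [t ^+ m.+3]exprS [t ^+ m.+2]exprS -[m.+3]addn1 natrD; ring.
apply: le_trans (ler_normD _ _) _; rewrite !normrM !normrX normr_nat.
have h2 : `|h| * `|h| = h ^+ 2 by rewrite -normrM -expr2 ger0_norm ?sqr_ge0.
rewrite h2.
have A1 : `|t + h| * `|(t + h) ^+ m.+2 - t ^+ m.+2 - h * (m.+2%:R * t ^+ m.+1)| <=
    rho * ((m.+2 * m.+1)%:R * (h ^+ 2 * rho ^+ m)) by apply: ler_pM.
have A2 : m.+2%:R * (h ^+ 2 * `|t| ^+ m.+1) <= m.+2%:R * (h ^+ 2 * rho ^+ m.+1).
  by rewrite !ler_wpM2l ?sqr_ge0// lerXn2r ?nnegrE.
apply: le_trans (lerD A1 A2) _.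
have -> : rho * ((m.+2 * m.+1)%:R * (h ^+ 2 * rho ^+ m)) +
    m.+2%:R * (h ^+ 2 * rho ^+ m.+1) = (m.+2 * m.+1 + m.+2)%:R * (h ^+ 2 * rho ^+ m.+1).
  by rewrite [rho ^+ m.+1]exprS natrD; ring.
apply: ler_wpM2r; first by rewrite mulr_ge0 ?sqr_ge0 ?exprn_ge0.
by rewrite ler_nat -mulnSr [X in (_ <= X)%N]mulnC leq_mul.
Qed.

(** A second-order remainder uniform in the interval of radius [rho]. The bound is again an
    exponential term, with index lowered by two, so it can be summed against a twice shifted
    series. *)
Lemma texp_taylor2 (t h rho : R) m : `|t| <= rho -> `|t + h| <= rho ->
  `|texp (t + h) m.+2 - texp t m.+2 - h * texp t m.+1| <= h ^+ 2 * texp rho m.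
Proof.
move=> tr thr; have f0 k : (k`!%:R : R) != 0 by rewrite pnatr_eq0 -lt0n fact_gt0.
have -> : texp (t + h) m.+2 - texp t m.+2 - h * texp t m.+1 =
   ((t + h) ^+ m.+2 - t ^+ m.+2 - h * (m.+2%:R * t ^+ m.+1)) / m.+2`!%:R.
  rewrite /texp !factS !natrM; field.
  have m0 := ler0n R m; rewrite f0 /=; apply/andP.
  by split; apply: lt0r_neq0; lra.
rewrite normrM normfV normr_nat ler_pdivrMr ?ltr0n ?fact_gt0//.
apply: le_trans (pow_taylor2 m tr thr) _.
rewrite /texp !factS !natrM.
rewrite [leRHS](_ : _ = m.+2%:R * m.+1%:R * (h ^+ 2 * rho ^+ m))//.
by field; rewrite f0.
Qed.

Lemma texp_taylor1 (t h : R) : texp (t + h) 1 - texp t 1 - h * texp t 0 = 0.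
Proof. by rewrite /texp !fact0 factS fact0 !expr1 expr0; ring. Qed.

(* [a m] are the norms of the iterates, [r] the radius of convergence of       *)
(* [sum_m a m t^m / m!]; boundedness of the partial sums is stable under the   *)
(* shift of [a], i.e. under differentiation of the series.                     *)
Definition exp_radius (a : nat -> R) (r : R) : Prop :=
  forall rho, 0 <= rho -> rho < r ->
    exists C, forall N, \sum_(m < N) a m * texp rho m <= C.

Lemma exp_radius_shift (a : nat -> R) (r : R) : (forall m, 0 <= a m) ->
  exp_radius a r -> exp_radius (fun m => a m.+1) r.
Proof.
move=> a0 ar rho rho0 rhor; pose s := (rho + r) / 2.
have sr : s < r by rewrite /s; lra.
have rs : rho < s by rewrite /s; lra.
have s0 : 0 < s by exact: le_lt_trans rs.
have [C HC] := ar s (ltW s0) sr.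
pose d := s - rho; have d0 : 0 < d by rewrite subr_gt0.
(* The factor [m + 1] produced by differentiation is absorbed by enlarging the radius from [rho] to
   [s]. *)
have bern m : m.+1%:R * rho ^+ m * d <= s ^+ m.+1.
  elim: m => [|m IH].
    by rewrite expr0 mulr1 mul1r expr1 /d lerBlDr lerDl.
  have -> : m.+2%:R * rho ^+ m.+1 * d = rho * (m.+1%:R * rho ^+ m * d) + rho ^+ m.+1 * d.
    by rewrite exprS -[m.+2]addn1 natrD; ring.
  rewrite [s ^+ _]exprS.
  have -> : s * s ^+ m.+1 = rho * s ^+ m.+1 + s ^+ m.+1 * d by rewrite /d; ring.
  apply: lerD; first by rewrite ler_wpM2l.
  by rewrite ler_wpM2r ?(ltW d0)// lerXn2r ?nnegrE ?(ltW s0)// ltW.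
exists (C / d) => N; rewrite ler_pdivlMr// mulr_suml.
apply: (le_trans _ (HC N.+1)); rewrite big_ord_recl -[leLHS]add0r; apply: lerD.
  by rewrite mulr_ge0// texp_ge0// ltW.
apply: ler_sum => i _; rewrite /= /bump add1n -mulrA ler_wpM2l//.
rewrite /texp factS natrM invfM mulrA mulrAC.
rewrite ler_pM2r ?invr_gt0 ?ltr0n ?fact_gt0// ler_pdivlMr//.
by rewrite mulrC mulrA bern.
Qed.

Lemma exp_radius_le (s s' : nat -> R) (r r' : R) : (forall m, s m <= s' m) -> r <= r' ->
  exp_radius s' r' -> exp_radius s r.
Proof.
move=> ss' rr' sr rho rho0 rhor; have [C HC] := sr rho rho0 (lt_le_trans rhor rr').
exists C => N; apply: le_trans (HC N); apply: ler_sum => m _.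
by rewrite ler_wpM2r// texp_ge0.
Qed.

Section Series.
Context {E : hilbertType R}.
Implicit Types (v : nat -> E) (r t : R).

Definition eser v t : E :=
  limn (fun N => \sum_(m < N) (texp t m)%:C *: v m : E).

Lemma exp_radius_cauchy (a : nat -> R) r rho : (forall m, 0 <= a m) ->
  exp_radius a r -> 0 <= rho -> rho < r -> forall e : R, 0 < e ->
  exists N, forall m n, (N <= n)%N -> (n <= m)%N ->
    \sum_(n <= k < m) a k * texp rho k < e.
Proof.
move=> a0 ar rho0 rhor e e0; have [C HC] := ar rho rho0 rhor.
pose u N := \sum_(0 <= k < N) a k * texp rho k.
have u_nd : {homo u : n m / (n <= m)%N >-> n <= m}.
  move=> n m nm; rewrite /u (big_cat_nat (leq0n n) nm)//= lerDl sumr_ge0// => i _.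
  by rewrite mulr_ge0// texp_ge0.
have [l ul] : exists l : R, u @ \oo --> l.
  apply/cvg_ex; apply: nondecreasing_is_cvgn => //.
  by exists C => _ [n _ <-]; rewrite /u big_mkord.
have e2 : 0 < e / 2 by rewrite divr_gt0.
have [N _ HN] := (cvgrPdist_lt _ _).1 ul _ e2; exists N => m n Nn nm.
have -> : \sum_(n <= k < m) a k * texp rho k = u m - u n.
  by rewrite /u (big_cat_nat (leq0n n) nm)//= addrAC subrr add0r.
have := HN n Nn; have := HN m (leq_trans Nn nm).
rewrite /= !ltr_norml => /andP[? ?] /andP[? ?]; lra.
Qed.

Lemma eser_cvg v r t : exp_radius (fun m => nrm (v m)) r -> `|t| < r ->
  (fun N => \sum_(m < N) (texp t m)%:C *: v m : E) @ \oo --> eser v t.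
Proof.
move=> vr tr; suff [l H] : exists l : E,
    (fun N => \sum_(m < N) (texp t m)%:C *: v m : E) @ \oo --> l.
  by apply: cvgP H.
apply: cauchy_nrm => e e0.
have [N HN] := exp_radius_cauchy (fun m => nrm_ge0 (v m)) vr (normr_ge0 t) tr e0.
have H m n : (N <= n)%N -> (n <= m)%N ->
    nrm (\sum_(k < m) (texp t k)%:C *: v k - \sum_(k < n) (texp t k)%:C *: v k) < e.
  move=> Nn nm; rewrite -!(big_mkord xpredT (fun k => (texp t k)%:C *: v k)).
  rewrite (big_cat_nat (leq0n n) nm)//= addrAC subrr add0r; apply: le_lt_trans (HN m n Nn nm).
  apply: le_trans (nrm_sum _ _ _) _; apply: ler_sum => i _.
  by rewrite nrmZr texp_norm mulrC.
exists N => m n Nm Nn; have [nm|/ltnW nm] := leqP n m; first exact: H.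
by rewrite nrmBC; exact: H.
Qed.

Lemma eser_le v r t C : exp_radius (fun m => nrm (v m)) r -> `|t| < r ->
  (forall N, \sum_(m < N) nrm (v m) * texp `|t| m <= C) -> nrm (eser v t) <= C.
Proof.
move=> vr tr HC; apply: nrm_lim_le (eser_cvg vr tr) _; apply: nearW => N.
apply: le_trans (HC N); apply: le_trans (nrm_sum _ _ _) _.
by apply: ler_sum => i _; rewrite nrmZr texp_norm mulrC.
Qed.

Lemma eser0 v r : exp_radius (fun m => nrm (v m)) r -> 0 < r -> eser v 0 = v 0.
Proof.
move=> vr r0; have := eser_cvg vr (t := 0); rewrite normr0 => /(_ r0) H.
apply: (cvg_uniq H); apply/cvg_nrmP => e e0; exists 1 => //= N N0.
rewrite -(prednK N0) big_ord_recl big1 => [|i _].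
  by rewrite addr0 /texp expr0 fact0 divr1 scale1r subrr nrm0.
by rewrite /texp expr0n /= mul0r scale0r.
Qed.

(** Termwise differentiation: the remainders add up to at most [h^2 C], where [C] bounds the twice
    shifted series at a radius strictly between [|t|] and [r]. *)
Lemma eser_deriv v r t : exp_radius (fun m => nrm (v m)) r -> `|t| < r ->
  deriv_at (eser v) t (eser (fun m => v m.+1) t).
Proof.
move=> vr tr; have vr1 := exp_radius_shift (fun m => nrm_ge0 (v m)) vr.
have vr2 := exp_radius_shift (fun m => nrm_ge0 (v m.+1)) vr1.
pose rho := (`|t| + r) / 2.
have rhor : rho < r by rewrite /rho; lra.
have trho : `|t| < rho by rewrite /rho; lra.
have rho0 : 0 <= rho by rewrite (le_trans (normr_ge0 t))// ltW.
have [C HC] := vr2 rho rho0 rhor.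
have key h : `|h| < rho - `|t| ->
    nrm (eser v (t + h) - eser v t - h%:C *: eser (fun m => v m.+1) t) <= h ^+ 2 * C.
  move=> hr; have thr : `|t + h| < rho by apply: le_lt_trans (ler_normD _ _) _; lra.
  pose P N := \sum_(m < N) ((texp (t + h) m)%:C *: v m) - \sum_(m < N) ((texp t m)%:C *: v m).
  have H : P N.+2 - h%:C *: \sum_(m < N.+1) ((texp t m)%:C *: v m.+1) @[N --> \oo] -->
      eser v (t + h) - eser v t - h%:C *: eser (fun m => v m.+1) t.
    have s2 (f : nat -> E) (l : E) : f @ \oo --> l -> f N.+2 @[N --> \oo] --> l.
      by move=> fl; rewrite -(cvg_shiftn 2) in fl; move: fl; under eq_fun do rewrite addn2.
    have s1 (f : nat -> E) (l : E) : f @ \oo --> l -> f N.+1 @[N --> \oo] --> l.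
      by move=> fl; rewrite -(cvg_shiftn 1) in fl; move: fl; under eq_fun do rewrite addn1.
    apply: cvgBc; last first.
      apply: cvgZc; apply: (s1 (fun N => \sum_(m < N) (texp t m)%:C *: v m.+1)).
      exact: eser_cvg vr1 tr.
    apply: cvgBc.
      apply: (s2 (fun N => \sum_(m < N) (texp (t + h) m)%:C *: v m)).
      exact: (eser_cvg vr (lt_trans thr rhor)).
    apply: (s2 (fun N => \sum_(m < N) (texp t m)%:C *: v m)).
    exact: eser_cvg vr tr.
  apply: nrm_lim_le H _; apply: nearW => N; rewrite /P -sumrB scaler_sumr.
  rewrite big_ord_recl -addrA -sumrB /=.
  have -> : (texp (t + h) 0)%:C *: v 0%N - (texp t 0)%:C *: v 0%N = 0.
    by rewrite /texp !expr0 subrr.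
  rewrite add0r; under eq_bigr => i _.
    rewrite /= /bump add1n scalerA -rmorphM /= -scalerBl -rmorphB /= -scalerBl -rmorphB /=.
    over.
  rewrite big_ord_recl /= texp_taylor1 scale0r add0r.
  apply: le_trans (nrm_sum _ _ _) _; apply: le_trans (_ : h ^+ 2 * \sum_(m < N) nrm (v m.+2) * texp rho m <= _).
    rewrite mulr_sumr; apply: ler_sum => i _; rewrite /bump !add1n nrmZr.
    rewrite [leRHS]mulrCA [leRHS]mulrC ler_wpM2r ?nrm_ge0//.
    by apply: texp_taylor2; exact: ltW.
  by rewrite ler_wpM2l ?sqr_ge0.
rewrite /deriv_at.
apply: (@cvg_nrm_le _ _ _ _ _ _ _ (fun h => `|h| * C)); last first.
  rewrite -[X in _ --> X](mul0r C); apply: cvgMr_tmp.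
  by rewrite -[X in _ --> X](@normr0 _ R); apply: cvg_norm; exact: cvg_dnbhs0.
near=> h.
have h0 : h != 0 by near: h; exact: nbhs_dnbhs_neq.
have hd : `|h| < rho - `|t| by near: h; apply: dnbhs0_lt; rewrite subr_gt0.
rewrite nrmBC; set w := eser (fun m => v m.+1) t.
have -> : (h^-1)%:C *: (eser v (t + h) - eser v t) - w =
    (h^-1)%:C *: (eser v (t + h) - eser v t - h%:C *: w).
  by rewrite [in RHS]scalerBr scalerA -rmorphM /= mulVf// scale1r.
rewrite nrmZr normfV; apply: (@le_trans _ _ (`|h|^-1 * (h ^+ 2 * C))).
  by rewrite ler_wpM2l ?invr_ge0// key.
have -> : h ^+ 2 = `|h| ^+ 2 by rewrite -normrX ger0_norm ?sqr_ge0.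
by rewrite expr2 -!mulrA mulKf ?normr_eq0.
Unshelve. all: by end_near. Qed.

End Series.


End ExponentialSeries.

(** * Global trajectories from analytic vectors *)

Section Nelson.
Context {R : realType} {E : hilbertType R} (G : set (E * E)).
Hypotheses (sG : linear_subspace G) (skG : forall x y, G (x, y) -> rdot x y = 0).
Implicit Types (r s t : R) (v : nat -> E).

Definition analytic_seq r v : Prop :=
  (forall m, closure G (v m, v m.+1)) /\ exp_radius (fun m => nrm (v m)) r.

(** The whole sequence of iterates transported to time [t]: entry [m] is the [m]-th derivative at
    [t] of the series with coefficients [v]. *)
Definition seq_flow t v : nat -> E := fun m => eser (fun k => v (m + k)%N) t.

Lemma analytic_seq_shift r v m : analytic_seq r v ->
  analytic_seq r (fun k => v (m + k)%N).
Proof.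
move=> [Gv vr]; split; first by move=> k; rewrite addnS.
elim: m => [//|m IH].
have := exp_radius_shift (fun k => nrm_ge0 (v (m + k)%N)) IH.
by under eq_fun do rewrite addnS -addSn.
Qed.

Lemma eser_trajectory r v : analytic_seq r v ->
  trajectory G [set t | `|t| < r] (eser v) (eser (fun m => v m.+1)).
Proof.
move=> [Gv vr] t tr; split; last exact: eser_deriv vr tr.
have vr1 := exp_radius_shift (fun m => nrm_ge0 (v m)) vr.
have -> : closure G = closure (closure G).
  by apply: (closure_id _).1; exact: closed_closure.
apply: (closure2_lim (eser_cvg vr tr) (eser_cvg vr1 tr)); apply: nearW => N.
apply: (big_ind2 (fun x y => closure G (x, y))).
- exact: (subspace0 (closure2_subspace sG)).
- by move=> a b c d; exact: (subspaceD (closure2_subspace sG)).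
- by move=> m _; exact: (subspaceZ _ (closure2_subspace sG) (Gv m)).
Qed.

Lemma seq_flow_trajectory r v m : analytic_seq r v ->
  trajectory G [set t | `|t| < r] (fun t => seq_flow t v m) (fun t => seq_flow t v m.+1).
Proof.
move=> /(analytic_seq_shift m)/eser_trajectory; rewrite /seq_flow.
rewrite (_ : (fun k => v (m + k.+1)%N) = (fun k => v (m.+1 + k)%N))//.
by apply/funext => k; rewrite addnS.
Qed.

Lemma seq_flow0 r v m : 0 < r -> analytic_seq r v -> seq_flow 0 v m = v m.
Proof.
by move=> r0 /(analytic_seq_shift m)[_ vr]; rewrite /seq_flow (eser0 vr r0) addn0.
Qed.

(** Each transported iterate lies on a trajectory, so its norm is that of the original iterate: the
    radius does not shrink. *)
Lemma seq_flow_analytic r v t : `|t| < r -> analytic_seq r v ->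
  analytic_seq r (seq_flow t v).
Proof.
move=> tr av; split; first by move=> m; exact: (seq_flow_trajectory m av tr).1.
rewrite (_ : (fun m => _) = (fun m => nrm (v m))); first exact: av.2.
apply/funext => m; rewrite (trajectory_nrm skG (seq_flow_trajectory m av) tr).
by rewrite (seq_flow0 _ _ av)//; exact: le_lt_trans tr.
Qed.

Lemma seq_flowD r v s t : `|s| + `|t| < r -> analytic_seq r v ->
  seq_flow s (seq_flow t v) = seq_flow (s + t) v.
Proof.
move=> str av; apply/funext => m.
have tr : `|t| < r by apply: le_lt_trans str; rewrite lerDr.
have r0 : 0 < r by apply: le_lt_trans tr.
have at_ := seq_flow_analytic tr av.
have sr : `|s| < r - `|t| by rewrite ltrBrDr.
apply: (@trajectory_uniq _ _ _ sG skG (r - `|t|) (fun s => seq_flow s (seq_flow t v) m)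
  (fun s => seq_flow s (seq_flow t v) m.+1) (fun s => seq_flow (s + t) v m)
  (fun s => seq_flow (s + t) v m.+1)) => //.
- move=> u /= ur; apply: (seq_flow_trajectory m at_) => /=.
  by apply: lt_le_trans ur _; rewrite gerBl.
- move=> u /= ur; have utr : `|u + t| < r.
    by apply: le_lt_trans (ler_normD _ _) _; rewrite -ltrBrDr.
  have [Gu du] := seq_flow_trajectory m av utr; split => //.
  exact: deriv_at_shift.
- by rewrite (seq_flow0 _ r0 at_) add0r.
Qed.

(* Trajectories conserve the norm, so re-expanding at an interior point keeps  *)
(* the radius [r]; steps of length [r / 4] then cover the whole line.          *)
Lemma analytic_trajectory r v : 0 < r -> analytic_seq r v ->
  exists c c', trajectory G setT c c' /\ c 0 = v 0%N.
Proof.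
move=> r0 av; pose h := r / 4; have h0 : 0 < h by rewrite divr_gt0.
have rh : r = h * 4 by rewrite /h divfK.
have hr : `|h| < r by rewrite gtr0_norm// rh; lra.
have hrN : `|- h| < r by rewrite normrN.
(* [X k] is the sequence of iterates at time [k h]; [Negz n] stands for [-(n + 1)]. *)
pose X (k : int) := match k with
  | Posz n => iter n (seq_flow h) v | Negz n => iter n.+1 (seq_flow (- h)) v end.
have aX k : analytic_seq r (X k).
  by case: k => n; elim: n => [|n IH] //; apply: seq_flow_analytic.
have Xh k : X (k + 1) = seq_flow h (X k).
  have inv n : seq_flow h (seq_flow (- h) (iter n (seq_flow (- h)) v)) =
      iter n (seq_flow (- h)) v.
    have an : analytic_seq r (iter n (seq_flow (- h)) v).
      by elim: n => [//|n IH]; exact: seq_flow_analytic.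
    rewrite (seq_flowD _ an) ?normrN ?gtr0_norm//; last by rewrite rh; lra.
    by rewrite subrr; apply/funext => m; exact: seq_flow0 r0 an.
  case: k => [n|[|n]]; first by rewrite -PoszD addn1.
    by rewrite /= (inv 0%N).
  have -> : Negz n.+1 + 1 = Negz n by rewrite !NegzE; lia.
  exact: (esym (inv n.+1)).
pose k s : int := Num.floor (s / h).
pose c m s := seq_flow (s - (k s)%:~R * h) (X (k s)) m.
have ks s : (k s)%:~R * h <= s < ((k s)%:~R + 1) * h.
  rewrite -ler_pdivlMr// -ltr_pdivrMr//.
  by have := floor_itv (s / h); rewrite intrD.
(* Differentiability at grid points requires the expansions around neighbouring centres to agree.
   Within distance [2 h] of [j h] the floor of [s / h] is one of [j - 2], [j - 1], [j], [j + 1], and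
   [seq_flowD] compares each with [j]. *)
have cE s j m : `|s - j%:~R * h| < h * 2 -> c m s = seq_flow (s - j%:~R * h) (X j) m.
  move=> sj; have /andP[k1 k2] := ks s.
  have skh : `|s - (k s)%:~R * h| < h by rewrite ger0_norm ?subr_ge0// ltrBlDr; lra.
  have [j1 j2] : j%:~R * h < s + h * 2 /\ s < j%:~R * h + h * 2.
    by move: sj; rewrite ltr_norml => /andP[]; lra.
  have jk : ((k s)%:~R < j%:~R + 2 :> R) /\ (j%:~R < (k s)%:~R + 3 :> R).
    by split; rewrite -(ltr_pM2r h0); lra.
  have [kj1 kj2] : (k s < j + 2)%R /\ (j < k s + 3)%R.
    by move: jk; rewrite -[2]/(2%:~R) -[3]/(3%:~R) -!intrD !ltr_int.
  have cases (a b : int) : a < b + 2 -> b < a + 3 ->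
      a = b \/ a = b + 1 \/ a + 1 = b \/ a + 2 = b by clear; lia.
  rewrite /c; case: (cases _ _ kj1 kj2) => [->//|[E1|[jE|jE]]].
  - rewrite E1 Xh (seq_flowD _ (aX j)); last first.
      by rewrite (gtr0_norm h0) -E1 rh; lra.
    by congr (seq_flow _ _ _); rewrite intrD; ring.
  - rewrite -jE in sj *.
    rewrite Xh (seq_flowD _ (aX _)); last by rewrite (gtr0_norm h0) rh; lra.
    by congr (seq_flow _ _ _); rewrite intrD; ring.
  - have kk : k s + 2 = k s + 1 + 1 by rewrite -addrA.
    rewrite -jE kk in sj *.
    have E2 : s - (k s + 1 + 1)%:~R * h + h = s - (k s)%:~R * h - h.
      by rewrite !intrD; ring.
    rewrite Xh (seq_flowD _ (aX _)); last first.
      rewrite (gtr0_norm h0) rh -[s - _](addrK h) E2.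
      have := ler_normB (s - (k s)%:~R * h - h) h.
      have := ler_normB (s - (k s)%:~R * h) h; rewrite (gtr0_norm h0); lra.
    rewrite E2 Xh (seq_flowD _ (aX _)); first by rewrite subrK.
    have := ler_normB (s - (k s)%:~R * h) h; rewrite (gtr0_norm h0) rh; lra.
have cT : trajectory G setT (c 0%N) (c 1%N).
  move=> t _; have /andP[k1 k2] := ks t.
  have tk : `|t - (k t)%:~R * h| < h by rewrite ger0_norm ?subr_ge0// ltrBlDr; lra.
  have tkr : `|t - (k t)%:~R * h| < r by rewrite rh; lra.
  have [Gt dt] := seq_flow_trajectory 0 (aX (k t)) tkr.
  split => //; apply: (deriv_at_eq h0 _ (deriv_at_shift dt)) => u uh.
  rewrite (cE _ (k t)) 1?addrAC//.
  by apply: le_lt_trans (ler_normD _ _) _; lra.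
exists (c 0%N), (c 1%N); split => //.
rewrite (cE 0 0) ?mul0r ?subrr ?normr0//; last by lra.
exact: seq_flow0 r0 av.
Qed.

End Nelson.

(** * Symmetric Fock spaces *)

Section SkewSpan.
Context {R : realType} {E : hilbertType R}.

Lemma lspan_orth (A : set E) x : (forall a, A a -> dot a x = 0) ->
  forall a, lspan A a -> dot a x = 0.
Proof.
move=> Ax; apply: (@lspan_min R E A [set a | dot a x = 0]) => //.
split=> [|a y z /= yx zx]; first exact: dot0l.
by rewrite dotDl dotZl yx zx mulr0 addr0.
Qed.

(** Skewness of each generator is not enough for a span; the sesquilinear condition on pairs of
    generators is, since it extends in each argument. *)
Lemma skew_lspan (A : set (E * E)) :
  (forall p q, A p -> A q -> dot p.2 q.1 + dot p.1 q.2 = 0) ->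
  forall x y, lspan A (x, y) -> rdot x y = 0.
Proof.
move=> Apq x y.
have H1 q : A q -> forall p, lspan A p -> dot p.2 q.1 + dot p.1 q.2 = 0.
  move=> Aq; apply: (@lspan_min R _ A [set p | dot p.2 q.1 + dot p.1 q.2 = 0]).
    split=> [|a p p' /= p1 p2]; first by rewrite /= !dot0l addr0.
    by rewrite !dotDl !dotZl addrACA -mulrDr p1 p2 mulr0 addr0.
  by move=> p Ap; exact: Apq.
have H2 p : lspan A p -> forall q, lspan A q -> dot p.2 q.1 + dot p.1 q.2 = 0.
  move=> Ap; apply: (@lspan_min R _ A [set q | dot p.2 q.1 + dot p.1 q.2 = 0]).
    split=> [|a q q' /= p1 p2]; first by rewrite /= !dot0r addr0.
    by rewrite !dotDr !dotZr addrACA -mulrDr p1 p2 mulr0 addr0.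
  by move=> q Aq; exact: H1.
move=> Axy; have := H2 _ Axy _ Axy => /= /(congr1 (@complex.Re R)).
by rewrite raddfD /= -/(rdot y x) -/(rdot x y) (rdotC y); lra.
Qed.

(** Polarization: apply skewness to [p + q], and to [p] with a rotated [q]. *)
Lemma skew_pair (G : set (E * E)) : linear_subspace G ->
  (forall x y, G (x, y) -> rdot x y = 0) ->
  forall p q, G p -> G q -> dot p.2 q.1 + dot p.1 q.2 = 0.
Proof.
move=> sG skG; have H p q : G p -> G q -> rdot p.2 q.1 = rdot p.1 (- q.2).
  move: p q => [x y] [x' y'] Gp Gq /=.
  have := skG _ _ (subspaceD sG Gp Gq); rewrite rdotDl !rdotDr.
  by rewrite (skG _ _ Gp) (skG _ _ Gq) rdotNr (rdotC y); lra.
move=> p q Gp Gq; apply/eqP; rewrite addr_eq0 -dotNr; apply/eqP.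
apply: dot_rdotP; first exact: H.
by have := H _ _ Gp (subspaceZ (- 'i) sG Gq); rewrite /= scalerN.
Qed.

End SkewSpan.

Section Slots.
Context {R : realType} {E : hilbertType R}.
Implicit Type F : hilbertType R.

Definition slot n (u x : 'I_n -> E) (i : 'I_n) : 'I_n -> E :=
  fun j => if j == i then x j else u j.

Definition multilinear (F : hilbertType R) n (Phi : ('I_n -> E) -> F) : Prop :=
  forall u x y (a : R[i]) i, Phi (slot u (fun j => a *: x j + y j) i) =
    a *: Phi (slot u x i) + Phi (slot u y i).

Definition multicontinuous (F : hilbertType R) n (Phi : ('I_n -> E) -> F) : Prop :=
  forall S (FS : set_system S) (FF : Filter FS) (f : S -> 'I_n -> E) v,
    (forall i, f s i @[s --> FS] --> v i) -> Phi (f s) @[s --> FS] --> Phi v.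

Lemma multilinear_telescope F n (Phi : ('I_n -> E) -> F) u v : multilinear Phi ->
  Phi u - Phi v = \sum_(k < n) Phi (slot (fun j => if (j < k)%N then u j else v j)
    (fun j => u j - v j) k).
Proof.
move=> mPhi; pose hyb k := (fun j : 'I_n => if (j < k)%N then u j else v j).
transitivity (Phi (hyb n) - Phi (hyb 0%N)).
  by congr (Phi _ - Phi _); apply/funext => j; rewrite /hyb ?ltn_ord.
rewrite -(telescope_sumr (fun k => Phi (hyb k)) (leq0n n)) big_mkord.
apply: eq_bigr => k _; apply/eqP; rewrite subr_eq; apply/eqP.
have -> : hyb k.+1 = slot (hyb k) (fun j => 1 *: (u j - v j) + v j) k.
  apply/funext => j; rewrite /hyb /slot ltnS leq_eqVlt; case: (eqVneq j k) => [->|].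
    by rewrite eqxx/= scale1r subrK.
  by move=> jk; rewrite -(inj_eq val_inj) /= in jk; rewrite (negbTE jk).
rewrite mPhi scale1r; congr (_ + Phi _).
by apply/funext => j; rewrite /hyb /slot; case: eqP => // ->; rewrite ltnn.
Qed.

Lemma deriv_at_multilinear F n (Phi : ('I_n -> E) -> F) (c : 'I_n -> R -> E) t c' :
  multilinear Phi -> multicontinuous Phi -> (forall i, deriv_at (c i) t (c' i)) ->
  deriv_at (fun s => Phi (c^~ s)) t (\sum_(i < n) Phi (slot (c^~ t) c' i)).
Proof.
move=> mPhi cPhi dc; rewrite /deriv_at.
have Z u x a i : Phi (slot u (fun j => a *: x j) i) = a *: Phi (slot u x i).
  have H0 : Phi (slot u (fun=> 0) i) = 0.
    by have := mPhi u (fun=> 0) (fun=> 0) (-1) i; rewrite !scaleN1r !addNr.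
  have := mPhi u x (fun=> 0) a i; rewrite H0 addr0 => <-.
  by congr (Phi (slot _ _ _)); apply/funext => j; rewrite addr0.
rewrite (_ : (fun h => _) = (fun h => \sum_(i < n) Phi (slot
    (fun j => if (j < i)%N then c j (t + h) else c j t)
    (fun j => (h^-1)%:C *: (c j (t + h) - c j t)) i))); last first.
  apply/funext => h; rewrite (multilinear_telescope (c^~ (t + h)) (c^~ t) mPhi).
  by rewrite scaler_sumr; apply: eq_bigr => i _; rewrite Z.
apply: cvg_sumc => i _; apply: cPhi => j; rewrite /slot; case: ifP => _.
  exact: dc.
by case: (j < i)%N; [exact: deriv_at_cont0 (dc j)|exact: cvg_cst].
Qed.

End Slots.

(** * Symmetric tensors *)

Section TensorPower.
Context {R : realType} {E : hilbertType R} (T : tensor_powers E).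

Lemma cvg_prodC S (FS : set_system S) {FF : Filter FS} (I : Type) (s : seq I)
    (f : I -> S -> R[i]^o) (l : I -> R[i]^o) :
  (forall i, f i @ FS --> l i) ->
  ((\prod_(i <- s) f i x : R[i]^o) @[x --> FS] --> (\prod_(i <- s) l i : R[i]^o)).
Proof.
move=> fl; elim: s => [|i s IH].
  by under eq_fun do rewrite big_nil; rewrite big_nil; exact: cvg_cst.
under eq_fun do rewrite big_cons; rewrite big_cons.
exact: (cvgM (fl i) IH).
Qed.

Lemma tp_continuous n : multicontinuous (@tp R E T n).
Proof.
move=> S FS FF f v fv; apply: cvg_dotP; rewrite !tp_dot.
  under eq_fun do rewrite tp_dot.
  by apply: cvg_prodC => i; apply: cvg_dot; exact: fv.
under eq_fun do rewrite tp_dot.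
by apply: cvg_prodC => i; apply: cvg_dot; [exact: fv|exact: cvg_cst].
Qed.

Lemma tp_ext n (x y : T n) : (forall w, dot (tp T w) x = dot (tp T w) y) -> x = y.
Proof.
move=> xy; apply/eqP; rewrite -subr_eq0; apply/eqP.
apply: (dense_orth (@tp_dense _ _ T n)); apply: lspan_orth => _ [w _ <-].
by rewrite dotBr xy subrr.
Qed.

Lemma tp_multilinear n : multilinear (@tp R E T n).
Proof.
move=> u x y a i; apply: tp_ext => w; rewrite dotDr dotZr !tp_dot.
rewrite !(bigD1 (P := xpredT) i)//= /slot eqxx dotDr dotZr mulrDl mulrA.
by congr (_ * _ + _ * _); apply: eq_bigr => j /negbTE ->.
Qed.

Lemma dot_tp_vee n (w u : 'I_n -> E) : dot (tp T w) (vee T u) =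
  (n`!%:R)^-1 * \sum_(s : 'S_n) \prod_i dot (w i) (u (s i)).
Proof.
rewrite /vee dotZr dot_sumr; congr (_ * _).
by apply: eq_bigr => s _; rewrite tp_dot.
Qed.

Lemma vee_symmetric n (u : 'I_n -> E) : symmetric_tensor (vee T u).
Proof.
move=> s w; rewrite !dot_tp_vee; congr (_ * _).
rewrite (reindex_inj (mulgI s)) /=; apply: eq_bigr => r _.
rewrite [RHS](reindex_inj (@perm_inj _ s)) /=.
by apply: eq_bigr => i _; rewrite permM.
Qed.

(** Symmetrization is an orthogonal projection: every permuted elementary tensor has the same
    pairing with a symmetric [x]. *)
Lemma dot_vee_sym n (u : 'I_n -> E) (x : T n) : symmetric_tensor x ->
  dot (vee T u) x = dot (tp T u) x.
Proof.
move=> sx; rewrite /vee dotZl dot_suml.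
under eq_bigr => s _ do rewrite (sx s u).
rewrite sumr_const (_ : #|_| = n`!); last by rewrite -card_Sn; exact: eq_card.
rewrite -(mulr_natl (dot (tp T u) x)) mulrA -[RHS]mul1r; congr (_ * _).
have -> : conjc ((n`!%:R)^-1 : R[i]) = (n`!%:R)^-1 by rewrite conjc_inv conjc_nat.
by rewrite mulVf// pnatr_eq0 -lt0n fact_gt0.
Qed.

Lemma vee_continuous n : multicontinuous (@vee R E T n).
Proof.
move=> S FS FF f v fv; apply: cvgZc; apply: cvg_sumc => s _.
by apply: tp_continuous => i; exact: fv.
Qed.

Lemma vee_multilinear n : multilinear (@vee R E T n).
Proof.
move=> u x y a i; rewrite /vee !scaler_sumr -big_split /=.
apply: eq_bigr => s _; rewrite scalerA [a * _]mulrC -scalerA -scalerDr.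
have H z : (fun j => slot u z i (s j)) = slot (u \o s) (z \o s) (s^-1%g i).
  apply/funext => j; rewrite /slot /=.
  by rewrite -(inj_eq (@perm_inj _ s) j) permKV.
by rewrite !H -tp_multilinear.
Qed.

Lemma symmetric_subspace n : linear_subspace (@symmetric_tensor R E T n).
Proof.
split=> [s v|a x y sx sy s v]; first by rewrite !dot0r.
by rewrite !dotDr !dotZr sx sy.
Qed.

Lemma symmetric_closure n (x : T n) : closure (@symmetric_tensor R E T n) x ->
  symmetric_tensor x.
Proof.
move=> /closure_seq[u su ux] s v.
have H w : dot (tp T w) (u k) @[k --> \oo] --> (dot (tp T w) x : R[i]^o).
  by apply: cvg_dot => //; exact: cvg_cst.
apply: (@cvg_uniq R (R[i]^o) nat \oo _ _ _ _ (H _)).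
by rewrite (_ : (fun k => _) = (fun k => dot (tp T v) (u k)))//; apply/funext => k; exact: su.
Qed.

(** The residual of the projection onto the span is symmetric and orthogonal to these products,
    hence to elementary tensors of vectors of [A], hence by continuity to all elementary tensors. *)
Lemma symmetric_closure_vee n (A : set E) (x : T n) : dense A ->
  symmetric_tensor x ->
  closure (lspan [set vee T v | v in [set v : 'I_n -> E | forall i, A (v i)]]) x.
Proof.
move=> dA sx; set B := lspan _.
have [y cy xy] := projection x (lspan_subspace _ : linear_subspace B).
have sB : B `<=` @symmetric_tensor R E T n.
  apply: lspan_min; first exact: symmetric_subspace.
  by move=> _ [v _ <-]; exact: vee_symmetric.
have sy : symmetric_tensor y.
  by apply: symmetric_closure; exact: closure_subset sB _ cy.
have sxy : symmetric_tensor (x - y) by exact: (subspaceB (@symmetric_subspace n)).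
suff : x - y = 0 by move=> /eqP; rewrite subr_eq0 => /eqP ->.
apply: tp_ext => v; rewrite dot0r.
have /choice[u Hu] (i : 'I_n) : exists u : nat -> E,
    (forall k, A (u k)) /\ u @ \oo --> v i.
  by have /closure_seq[u ? ?] := (dense_closure _).1 dA (v i); exists u.
have : dot (tp T (u^~ k)) (x - y) @[k --> \oo] --> (dot (tp T v) (x - y) : R[i]^o).
  apply: cvg_dot; last exact: cvg_cst.
  by apply: tp_continuous => i; exact: (Hu i).2.
move=> H; apply: (@cvg_uniq R (R[i]^o) nat \oo _ _ _ _ H).
rewrite (_ : (fun k => _) = cst 0); first exact: cvg_cst.
apply/funext => k; rewrite -dot_vee_sym//; apply: xy; apply: sub_lspan.
by exists (u^~ k) => // i; exact: (Hu i).1.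
Qed.

End TensorPower.

(** * Fock space and the derivation of a skew operator *)

Section Fock.
Context {R : realType} {E : hilbertType R} (T : tensor_powers E) (w : nat -> R).
Context (F : fock_space T w).

Lemma fock_ext (x y : F) : (forall n (v : T n), symmetric_tensor v ->
  dot (fock_inj F v) x = dot (fock_inj F v) y) -> x = y.
Proof.
move=> xy; apply/eqP; rewrite -subr_eq0; apply/eqP.
apply: (dense_orth (@fock_dense _ _ _ _ F)); apply: lspan_orth.
by move=> _ [n [v [sv ->]]]; rewrite dotBr xy// subrr.
Qed.

Lemma fock_dotE m n (u : T m) (v : T n) : symmetric_tensor u -> symmetric_tensor v ->
  forall (e : m = n), dot (fock_inj F u) (fock_inj F v) =
    (w n ^+ 2)%:C * dot (ecast k (T k) e u) v.
Proof. by move=> su sv e; case: n / e v sv => v sv /=; exact: fock_dot. Qed.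

(** Only inner products of injected tensors are specified; linearity is recovered by testing against
    the total family. *)
Lemma fock_inj_linear n (u v : T n) (a : R[i]) : symmetric_tensor u ->
  symmetric_tensor v -> fock_inj F (a *: u + v) = a *: fock_inj F u + fock_inj F v.
Proof.
move=> su sv; have suv := (@symmetric_subspace _ _ T n).2 a _ _ su sv.
apply: fock_ext => m z sz; have [e|mn] := eqVneq m n.
  rewrite dotDr dotZr !(fock_dotE _ _ e)// dotDr dotZr; ring.
by rewrite dotDr dotZr !fock_orth// mulr0 addr0.
Qed.

Lemma fock_inj_nrm n (u : T n) : symmetric_tensor u ->
  nrm (fock_inj F u) = `|w n| * nrm u.
Proof.
move=> su; apply/eqP; rewrite -(@eqrXn2 _ 2)//; last 2 first.
- exact: nrm_ge0.
- by rewrite mulr_ge0 ?nrm_ge0.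
rewrite exprMn -normrX ger0_norm ?sqr_ge0// -!rdotxx /rdot fock_dot// dotxx.
by rewrite -rmorphM.
Qed.

Lemma fock_inj0 n : fock_inj F (0 : T n) = 0.
Proof.
have s0 := subspace0 (@symmetric_subspace _ _ T n).
by apply: nrm_eq0; rewrite fock_inj_nrm// nrm0 mulr0.
Qed.

Lemma fock_injB n (u v : T n) : symmetric_tensor u -> symmetric_tensor v ->
  fock_inj F (u - v) = fock_inj F u - fock_inj F v.
Proof.
move=> su sv; rewrite addrC -scaleN1r fock_inj_linear//.
by rewrite scaleN1r addrC.
Qed.

Lemma fock_inj_cvg n S (FS : set_system S) (FF : Filter FS) (f : S -> T n) x :
  (forall s, symmetric_tensor (f s)) -> symmetric_tensor x ->
  f @ FS --> x -> fock_inj F (f s) @[s --> FS] --> fock_inj F x.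
Proof.
move=> sf sx /cvg_nrm0 fx; apply/cvg_nrm0.
rewrite (_ : (fun s => _) = (fun s => `|w n| * nrm (x - f s))); last first.
  apply/funext => s; rewrite -fock_injB// fock_inj_nrm//.
  exact: (subspaceB (@symmetric_subspace _ _ T n)).
by rewrite -[X in _ --> X](mulr0 `|w n|); exact: cvgMl_tmp.
Qed.

Definition fvee n (u : 'I_n -> E) : F := fock_inj F (vee T u).

Lemma fvee_continuous n : multicontinuous (@fvee n).
Proof.
move=> S FS FF f v fv; apply: fock_inj_cvg; try by move=> *; exact: vee_symmetric.
exact: vee_continuous.
Qed.

Lemma fvee_multilinear n : multilinear (@fvee n).
Proof.
move=> u x y a i; rewrite /fvee vee_multilinear fock_inj_linear//;
  exact: vee_symmetric.
Qed.

Lemma fvee_dense (A : set E) : dense A ->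
  dense (lspan [set x | exists n (v : 'I_n -> E), (forall i, A (v i)) /\ x = fvee v]).
Proof.
move=> dA; apply: dense_lspan (@fock_dense _ _ _ _ F) _ => _ [n [x [sx ->]]].
have /closure_seq[u Bu ux] := symmetric_closure_vee dA sx.
set C := lspan _.
have BC : lspan [set vee T v | v in [set v : 'I_n -> E | forall i, A (v i)]] `<=`
    [set x : T n | symmetric_tensor x /\ C (fock_inj F x)].
  apply: lspan_min.
    split=> [|a y z [sy Cy] [sz Cz]].
      split; first exact: (subspace0 (@symmetric_subspace _ _ T n)).
      by rewrite fock_inj0; exact: (subspace0 (lspan_subspace _)).
    split; first exact: (@symmetric_subspace _ _ T n).2.
    by rewrite fock_inj_linear//; exact: (lspan_subspace _).2.
  move=> _ [v Av <-]; split; first exact: vee_symmetric.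
  by apply: sub_lspan; exists n, v.
apply: (closure_lim (f := fun k => fock_inj F (u k)) (F := \oo)).
  by apply: fock_inj_cvg => // k; exact: (BC _ (Bu k)).1.
by apply: nearW => k; exact: (BC _ (Bu k)).2.
Qed.

Section Derivation.
Context (L : set (E * E)).
Hypotheses (sL : linear_subspace L) (skL : forall x y, L (x, y) -> rdot x y = 0).
Let D := fock_derivation F L.

Lemma fock_derivation_subspace : linear_subspace D.
Proof. exact: lspan_subspace. Qed.

Lemma dot_vee n (u v : 'I_n -> E) : dot (vee T u) (vee T v) =
  (n`!%:R)^-1 * \sum_(s : 'S_n) \prod_i dot (u i) (v (s i)).
Proof. by rewrite dot_vee_sym ?dot_tp_vee//; exact: vee_symmetric. Qed.

Lemma fock_derivation_skew x y : D (x, y) -> rdot x y = 0.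
Proof.
apply: skew_lspan => _ _ [n [v [Lv [Hv ->]]]] [m [u [Lu [Hu ->]]]] /=.
rewrite dot_suml dot_sumr.
have [e|nm] := eqVneq n m; last first.
  by rewrite !big1 ?addr0// => i _; apply: fock_orth => //; exact: vee_symmetric.
move: u Lu Hu; case: m / e => u Lu Hu.
have sp := skew_pair sL skL.
have dE a b : dot (fock_inj F (vee T a)) (fock_inj F (vee T b)) = (w n ^+ 2)%:C *
    ((n`!%:R)^-1 * \sum_(s : 'S_n) \prod_i dot (a i) (b (s i))).
  by rewrite fock_dot ?dot_vee//; exact: vee_symmetric.
under eq_bigr => i _ do rewrite dE.
under [X in _ + X]eq_bigr => i _ do rewrite dE.
rewrite -!mulr_sumr -mulrDr -mulrDr.
rewrite exchange_big [X in _ + X]exchange_big -big_split /=.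
rewrite big1 ?mulr0// => s _.
(* For a fixed permutation [s], replacing slot [i] on one side is matched with replacing slot [s i]
   on the other; the two products share all other factors and cancel by skewness of [L]. *)
rewrite [X in _ + X](reindex_inj (@perm_inj _ s)) -big_split /= big1// => i _.
rewrite !(bigD1 (P := xpredT) i)//= !eqxx.
set p := \prod_(_ | _) _; rewrite (_ : \prod_(_ | _) _ = p); last first.
  apply: eq_bigr => j /negbTE ji; by rewrite (inj_eq (@perm_inj _ s)) ji.
by rewrite -mulrDl (sp _ _ (Hv i) (Hu (s i))) mul0r.
Qed.

(** The derivative is the product rule. Membership in the closed graph follows by approximating each
    factor by pairs in the graph of [L]. *)
Lemma fock_trajectory n I (c c' : 'I_n -> R -> E) :
  (forall i, trajectory L I (c i) (c' i)) ->
  trajectory D I (fun s => fvee (c^~ s)) (fun s => \sum_(i < n) fvee (slot (c^~ s) (c'^~ s) i)).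
Proof.
move=> cc t It; split; last first.
  apply: deriv_at_multilinear.
  - exact: fvee_multilinear.
  - exact: fvee_continuous.
  - by move=> i; exact: (cc i t It).2.
have /choice[u Hu] (i : 'I_n) : exists u : nat -> E * E, [/\ forall k, L (u k),
    (u k).1 @[k --> \oo] --> c i t & (u k).2 @[k --> \oo] --> c' i t].
  have /closure2_seq[u [v [? ? ?]]] := (cc i t It).1.
  by exists (fun k => (u k, v k)).
apply: (@closure2_lim _ _ _ _ _ \oo _ (fun k => fvee (fun i => (u i k).1))
  (fun k => \sum_(i < n) fvee (slot (fun i => (u i k).1) (fun i => (u i k).2) i))).
- by apply: fvee_continuous => i; have [] := Hu i.
- apply: cvg_sumc => i _; apply: fvee_continuous => j; rewrite /slot.
  by have [_ ? ?] := Hu j; case: ifP.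
- apply: nearW => k; apply: sub_lspan.
  exists n, (fun i => (u i k).1), (fun i => (u i k).2); split => // i.
  by rewrite -surjective_pairing; have [] := Hu i.
Qed.

Lemma fock_trajectory_dense : dense (trajectory_start L) -> dense (trajectory_start D).
Proof.
move=> dL; have := fvee_dense dL.
have sub : lspan [set x | exists n (v : 'I_n -> E),
    (forall i, trajectory_start L (v i)) /\ x = fvee v] `<=` trajectory_start D.
  apply: lspan_min.
    exact: (trajectory_start_subspace fock_derivation_subspace).
  move=> _ [n [v [Hv ->]]]; move: Hv => /choice[c] /choice[c' Hc].
  exists (fun s => fvee (c^~ s)), (fun s => \sum_(i < n) fvee (slot (c^~ s) (c'^~ s) i)).
  split; first by apply: fock_trajectory => i; exact: (Hc i).1.
  by congr fvee; apply/funext => i; exact: (Hc i).2.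
move=> /denseP dF; apply/denseP => x e e0.
by have [a /sub Ha xa] := dF x e e0; exists a.
Qed.

Lemma exp_group_fock : dense (trajectory_start L) ->
  unitary_group (exp_group (closure D)) /\
  group_generator (exp_group (closure D)) = closure D.
Proof.
move=> /fock_trajectory_dense dD.
have [W HW] := stone_trajectories fock_derivation_subspace fock_derivation_skew dD.
exact: (@getPex _ [set W : R -> F -> F | unitary_group W /\ group_generator W = closure D]
  (ex_intro _ W HW)).
Qed.

Lemma exp_group_fvee n (r : R) (c c' : 'I_n -> R -> E) t :
  dense (trajectory_start L) ->
  (forall i, trajectory L [set s | `|s| < r] (c i) (c' i)) -> `|t| < r ->
  exp_group (closure D) t (fvee (c^~ 0)) = fvee (c^~ t).
Proof.
move=> /exp_group_fock[uW gW] cc tr.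
exact: (group_local_trajectory fock_derivation_subspace fock_derivation_skew
  uW gW (fock_trajectory cc) tr).
Qed.

End Derivation.
End Fock.

(** * Tensor powers of operators *)

Section TensorMap.
Context {R : realType}.
Implicit Types E F : hilbertType R.

Lemma nrm2_comb E I (f : I -> E) (s : seq (R[i] * I)) :
  dot (\sum_(k <- s) k.1 *: f k.2) (\sum_(k <- s) k.1 *: f k.2) =
  \sum_(k <- s) \sum_(l <- s) conjc k.1 * l.1 * dot (f k.2) (f l.2).
Proof.
rewrite dot_suml; apply: eq_bigr => k _; rewrite dot_sumr; apply: eq_bigr => l _.
by rewrite dotZl dotZr mulrA.
Qed.

(** Proportional Gram matrices scale the squared norms of all combinations by [K], so the map
    extends with norm at most the square root of [K]. *)
Lemma extend_gram E F (I : Type) (phi : I -> E) (psi : I -> F) (K : R) : 0 <= K ->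
  dense (lspan (range phi)) ->
  (forall i j, dot (psi i) (psi j) = K%:C * dot (phi i) (phi j)) ->
  exists B : E -> F, bounded_linear B /\ forall i, B (phi i) = psi i.
Proof.
move=> K0 dphi H.
have [|//|s|B [? ? _]] := @extend_family R E F I phi psi (Num.sqrt K).
- exact: sqrtr_ge0.
- rewrite -(@ler_pXn2r _ 2)// ?nnegrE ?mulr_ge0 ?nrm_ge0 ?sqrtr_ge0//.
  rewrite exprMn sqr_sqrtr// -!rdotxx /rdot !nrm2_comb.
  have -> : \sum_(k <- s) \sum_(l <- s) conjc k.1 * l.1 * dot (psi k.2) (psi l.2) =
     K%:C * \sum_(k <- s) \sum_(l <- s) conjc k.1 * l.1 * dot (phi k.2) (phi l.2).
    rewrite mulr_sumr; apply: eq_bigr => k _; rewrite mulr_sumr; apply: eq_bigr => l _.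
    by rewrite H; ring.
  rewrite -nrm2_comb dotxx -rmorphM /=; exact: lexx.
- by exists B.
Qed.

(** This makes the choice in [tensor_map] meaningful. It is established for multiples of isometries,
    such as [En], and for their adjoints, such as [p1Id]. *)
Definition tensorable E F (TE : tensor_powers E) (TF : tensor_powers F)
    (B : E -> F) : Prop :=
  forall n, exists P : TE n -> TF n,
    bounded_linear P /\ forall u, P (tp TE u) = tp TF (B \o u).

Lemma tensorable_similarity E F (TE : tensor_powers E) (TF : tensor_powers F)
    (B : E -> F) (K : R) : 0 <= K ->
  (forall x y, dot (B x) (B y) = K%:C * dot x y) -> tensorable TE TF B.
Proof.
move=> K0 HB n; apply: (extend_gram (K := K ^+ n)).
- exact: exprn_ge0.
- exact: tp_dense.
- move=> u v; rewrite !tp_dot; under eq_bigr do rewrite HB.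
  by rewrite big_split /= prodr_const card_ord rmorphXn.
Qed.

Lemma tensorable_adjoint E F (TE : tensor_powers E) (TF : tensor_powers F)
    (J : F -> E) (B : E -> F) : tensorable TF TE J ->
  (forall x y, dot (J x) y = dot x (B y)) -> tensorable TE TF B.
Proof.
move=> tJ JB n; have [P [bP HP]] := tJ n; have [P' bP' PP'] := adjoint_exists bP.
exists P'; split => // u; apply: tp_ext => w; rewrite -PP' HP !tp_dot.
by apply: eq_bigr => i _; rewrite /= JB.
Qed.

Section Spec.
Context {E F : hilbertType R} (TE : tensor_powers E) (TF : tensor_powers F).
Context (B : E -> F) (tB : tensorable TE TF B).

Lemma tensor_mapP n : bounded_linear (@tensor_map _ _ _ TE TF B n) /\
  forall u, @tensor_map _ _ _ TE TF B n (tp TE u) = tp TF (B \o u).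
Proof.
have [P HP] := tB n.
exact: (@getPex _ [set P : TE n -> TF n | bounded_linear P /\
  forall u, P (tp TE u) = tp TF (B \o u)] (ex_intro _ P HP)).
Qed.

Lemma tensor_map_vee n (u : 'I_n -> E) :
  tensor_map TF B (vee TE u) = vee TF (B \o u).
Proof.
have [[lP _] HP] := tensor_mapP n.
rewrite /vee (lfunZ _ _ lP) (lfun_sum _ _ _ lP); congr (_ *: _).
by apply: eq_bigr => s _; rewrite HP.
Qed.

Lemma tensor_map_symmetric n (x : TE n) : symmetric_tensor x ->
  symmetric_tensor (tensor_map TF B x).
Proof.
move=> sx; have [[lP cP] HP] := tensor_mapP n.
have dT : dense (setT : set E) by apply/denseP => y e e0; exists y; rewrite ?subrr ?nrm0.
have /closure_seq[u Hu ux] := symmetric_closure_vee dT sx.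
apply: symmetric_closure.
apply: (@closure_lim _ _ _ nat \oo _ (fun k => tensor_map TF B (u k))).
  by apply: (cvg_comp _ _ ux); exact: cP.
apply: nearW => k; move: (Hu k).
apply: (@lspan_min R (TE n) _ [set x | symmetric_tensor (tensor_map TF B x)]).
  split=> [|a y z /= sy sz]; first by rewrite /= (lfun0 lP); exact: (@symmetric_subspace _ _ TF n).1.
  by rewrite lP; exact: (@symmetric_subspace _ _ TF n).2.
by move=> _ [v _ <-] /=; rewrite tensor_map_vee; exact: vee_symmetric.
Qed.

End Spec.
End TensorMap.

(** * Vectors of finite degree and the action of operators on them *)

Section Component.
Context {R : realType} {E : hilbertType R} (T : tensor_powers E) (w : nat -> R).
Context (F : fock_space T w).
Hypothesis w0 : forall n, w n != 0.

Lemma component_eq n (x : F) (a : T n) : symmetric_tensor a ->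
  (forall v : T n, symmetric_tensor v -> dot (fock_inj F v) x = (w n ^+ 2)%:C * dot v a) ->
  component n x = a.
Proof.
move=> sa Ha; rewrite /component; set S := [set _ | _].
have [sb Hb] : S (get S) by apply: (@getPex _ S); exists a.
apply/eqP; rewrite -subr_eq0; apply/eqP; apply: nrm_eq0; apply/eqP.
rewrite -sqrf_eq0 -rdotxx; set d := _ - _.
have sd : symmetric_tensor d by exact: (subspaceB (@symmetric_subspace _ _ T n) sb sa).
have : (w n ^+ 2)%:C * dot d (get S) = (w n ^+ 2)%:C * dot d a by rewrite -Hb// -Ha.
have w2 : (w n ^+ 2)%:C != 0 by rewrite fmorph_eq0 expf_neq0.
by move=> /(mulfI w2) H; rewrite /rdot {2}/d dotBr H subrr.
Qed.

Lemma component_sum N (a : forall n, T n) n : (forall n, symmetric_tensor (a n)) ->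
  component n (\sum_(k < N) fock_inj F (a k)) = if (n < N)%N then a n else 0.
Proof.
move=> sa; apply: component_eq.
  by case: ifP => // _; exact: (subspace0 (@symmetric_subspace _ _ T n)).
move=> v sv; rewrite dot_sumr; case: ifPn => [nN|nN].
  rewrite (bigD1 (Ordinal nN))//= fock_dot// big1 ?addr0// => i iN.
  by apply: fock_orth => //; rewrite eq_sym; apply: contra iN => /eqP e; apply/eqP/val_inj.
rewrite dot0r mulr0 big1// => i _; apply: fock_orth => //.
by apply: contra nN => /eqP ->.
Qed.

Lemma Tfin_subspace : linear_subspace (Tfin F).
Proof.
have s0 n : symmetric_tensor (0 : T n) by exact: (subspace0 (@symmetric_subspace _ _ T n)).
split.
  exists 0%N, (fun n => 0); split => //.
  by rewrite big1// => i _; rewrite fock_inj0.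
move=> c _ _ [N [a [sa ->]]] [M [b [sb ->]]].
pose ext K (a : forall n, T n) n : T n := if (n < K)%N then a n else 0.
have sext K (a' : forall n, T n) : (forall n, symmetric_tensor (a' n)) ->
  forall n, symmetric_tensor (ext K a' n) by move=> sa' n; rewrite /ext; case: ifP.
have extE K L (a' : forall n, T n) : (K <= L)%N -> \sum_(k < K) fock_inj F (a' k) =
    \sum_(k < L) fock_inj F (ext K a' k).
  move=> KL; rewrite (big_ord_widen L (fun k => fock_inj F (a' k)) KL) big_mkcond.
  by apply: eq_bigr => i _; rewrite /ext; case: ifP => // _; rewrite fock_inj0.
exists (N + M)%N, (fun n => c *: ext N.+1 a n + ext M.+1 b n); split.
  by move=> n; apply: (@symmetric_subspace _ _ T n).2; exact: sext.
rewrite (extE N.+1 (N + M).+1) ?ltnS ?leq_addr//.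
rewrite (extE M.+1 (N + M).+1) ?ltnS ?leq_addl//.
rewrite scaler_sumr -big_split /=; apply: eq_bigr => i _.
by rewrite fock_inj_linear//; exact: sext.
Qed.

Lemma Tfin_component x : Tfin F x -> (forall n, symmetric_tensor (component n x)) /\
  exists N, forall M, (N <= M)%N -> component M x = 0 /\
    x = \sum_(n < M) fock_inj F (component n x).
Proof.
move=> [N [a [sa ->]]]; split.
  move=> n; rewrite component_sum//; case: ifP => // _.
  exact: (subspace0 (@symmetric_subspace _ _ T n)).
exists N.+1 => M NM; rewrite component_sum// ltnNge NM; split => //.
under [RHS]eq_bigr => n _ do rewrite component_sum//.
rewrite (big_ord_widen M (fun k => fock_inj F (a k)) NM) big_mkcond.
by apply: eq_bigr => i _; case: ifP => // _; rewrite fock_inj0.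
Qed.

Lemma component_dot x n (v : T n) : Tfin F x -> symmetric_tensor v ->
  dot (fock_inj F v) x = (w n ^+ 2)%:C * dot v (component n x).
Proof.
move=> Tx sv; have [sc [N HN]] := Tfin_component Tx.
have [|_ xE] := HN (N + n.+1)%N; first exact: leq_addr.
have nN : (n < N + n.+1)%N by rewrite addnS ltnS leq_addl.
rewrite {1}xE dot_sumr (bigD1 (Ordinal nN))//= fock_dot// big1 ?addr0// => i iN.
by apply: fock_orth => //; rewrite eq_sym; apply: contra iN => /eqP e; apply/eqP/val_inj.
Qed.

Lemma component_linear n a x y : Tfin F x -> Tfin F y ->
  component n (a *: x + y) = a *: component n x + component n y.
Proof.
move=> Tx Ty; have [sx _] := Tfin_component Tx; have [sy _] := Tfin_component Ty.
apply: component_eq; first exact: (@symmetric_subspace _ _ T n).2.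
by move=> v sv; rewrite !dotDr !dotZr !component_dot//; ring.
Qed.

Lemma component_inj n (v : T n) : symmetric_tensor v -> component n (fock_inj F v) = v.
Proof. by move=> sv; apply: component_eq => // u su; exact: fock_dot. Qed.

Lemma component_inj0 m n (v : T n) : symmetric_tensor v -> m != n ->
  component m (fock_inj F v) = 0.
Proof.
move=> sv mn; apply: component_eq; first exact: (subspace0 (@symmetric_subspace _ _ T m)).
by move=> u su; rewrite dot0r mulr0 fock_orth.
Qed.

Lemma Tfin_inj n (v : T n) : symmetric_tensor v -> Tfin F (fock_inj F v).
Proof.
move=> sv; exists n, (fun k => component k (fock_inj F v)); split.
  move=> k; have [->|kn] := eqVneq k n; first by rewrite component_inj.
  by rewrite component_inj0//; exact: (subspace0 (@symmetric_subspace _ _ T k)).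
rewrite (bigD1 ord_max)//= component_inj// big1 ?addr0// => i iN.
by rewrite component_inj0 ?fock_inj0.
Qed.

Lemma Tfin_fvee n (u : 'I_n -> E) : Tfin F (fvee F u).
Proof. by apply: Tfin_inj; exact: vee_symmetric. Qed.

Lemma Tfin_ext x y : Tfin F x -> Tfin F y ->
  (forall n, component n x = component n y) -> x = y.
Proof.
move=> Tx Ty xy; have [_ [N HN]] := Tfin_component Tx.
have [_ [M HM]] := Tfin_component Ty.
have [_ ->] := HN _ (leq_addr M N); have [_ ->] := HM _ (leq_addl N M).
by apply: eq_bigr => i _; rewrite xy.
Qed.

End Component.

Section FockMap.
Context {R : realType} {E E' : hilbertType R}.
Context (T : tensor_powers E) (T' : tensor_powers E') (w : nat -> R).
Context (F : fock_space T w) (F' : fock_space T' w).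
Hypothesis w0 : forall n, w n != 0.
Context (B : E -> E') (tB : tensorable T T' B).
Implicit Types x y : F.

Let c' x n : T' n := tensor_map T' B (component n x).

(** On vectors of finite degree the partial sums are eventually constant, so the limit defining
    [fock_map] is a finite sum. *)
Lemma fock_map_sum x : Tfin F x -> exists N,
  fock_map F' B x = \sum_(n < N.+1) fock_inj F' (c' x n) /\
  forall M, (N <= M)%N -> c' x M = 0.
Proof.
move=> Tx; have [_ [N HN]] := Tfin_component w0 Tx.
have cM M : (N <= M)%N -> c' x M = 0.
  move=> NM; have [lP _] := (tensor_mapP tB M).1.
  by rewrite /c' (HN M NM).1 (lfun0 lP).
exists N; split => //; apply: (lim_near_cst (@norm_hausdorff _ _)).
exists N.+1 => // M /= NM.
rewrite -!(big_mkord xpredT (fun n => fock_inj F' (c' x n))).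
rewrite (big_cat_nat (leq0n N.+1) NM)//= [X in _ + X]big_nat_cond [X in _ + X]big1 ?addr0//.
move=> k; rewrite andbT => /andP[Nk _].
by rewrite cM ?fock_inj0//; exact: ltnW.
Qed.

Lemma fock_map_Tfin x : Tfin F x -> Tfin F' (fock_map F' B x).
Proof.
move=> Tx; have [N [-> _]] := fock_map_sum Tx; exists N, (c' x); split => // n.
by apply: tensor_map_symmetric => //; exact: (Tfin_component w0 Tx).1.
Qed.

Lemma component_fock_map x n : Tfin F x ->
  component n (fock_map F' B x) = tensor_map T' B (component n x).
Proof.
move=> Tx; have [N [-> HN]] := fock_map_sum Tx.
rewrite component_sum//.
  by case: ifPn => //; rewrite -leqNgt => /ltnW /HN.
by move=> k; apply: tensor_map_symmetric => //; exact: (Tfin_component w0 Tx).1.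
Qed.

Lemma fock_map_linear a x y : Tfin F x -> Tfin F y ->
  fock_map F' B (a *: x + y) = a *: fock_map F' B x + fock_map F' B y.
Proof.
move=> Tx Ty; have Txy := (Tfin_subspace F).2 a _ _ Tx Ty.
apply: (Tfin_ext w0).
- exact: fock_map_Tfin.
- by apply: (Tfin_subspace F').2; exact: fock_map_Tfin.
- move=> n; have [lP _] := (tensor_mapP tB n).1.
  rewrite (component_linear w0) ?component_fock_map//; try exact: fock_map_Tfin.
  by rewrite (component_linear w0)// lP.
Qed.

Lemma fock_map_fvee n (u : 'I_n -> E) : fock_map F' B (fvee F u) = fvee F' (B \o u).
Proof.
have Tu := Tfin_fvee F w0 u; apply: (Tfin_ext w0).
- exact: fock_map_Tfin.
- exact: Tfin_fvee.
- move=> m; rewrite component_fock_map//; have [->|mn] := eqVneq m n.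
    by rewrite !component_inj ?tensor_map_vee//; exact: vee_symmetric.
  have [lP _] := (tensor_mapP tB m).1.
  by rewrite !component_inj0 ?(lfun0 lP)//; exact: vee_symmetric.
Qed.

End FockMap.

(** * Reproducing kernel Hilbert algebras *)

Section Schur.
Context {R : realType} {E : hilbertType R}.

Definition psd n (M : 'I_n -> 'I_n -> R[i]) : Prop := forall c : 'I_n -> R[i],
  0 <= complex.Re (\sum_i \sum_j conjc (c i) * c j * M i j).

(* The Schur product theorem: splitting off from all the vectors [g i] their   *)
(* projections on one of them adds a positive term and kills that vector.      *)
Lemma psd_gram n (M : 'I_n -> 'I_n -> R[i]) (g : 'I_n -> E) : psd M ->
  psd (fun i j => M i j * dot (g i) (g j)).
Proof.
move=> pM; suff H k : forall g : 'I_n -> E, (forall i : 'I_n, (k <= i)%N -> g i = 0) ->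
    psd (fun i j => M i j * dot (g i) (g j)).
  by apply: (H n) => i; rewrite leqNgt ltn_ord.
elim: k => [|k IH] {}g g0 c.
  by rewrite big1// => i _; rewrite big1// => j _; rewrite g0// dot0l !mulr0.
have [kn|kn] := ltnP k n; last first.
  by apply: IH => i ki; have := leq_ltn_trans ki (ltn_ord i); rewrite ltnNge kn.
pose i0 := Ordinal kn.
(* The unit vector along [g i0], or 0 when [g i0 = 0] since the inverse of 0 is 0. In both cases
   [dot e e * dot e x = dot e x], so the splitting needs no further case distinction. *)
have [e eE] : exists e, e = ((nrm (g i0))^-1)%:C *: g i0 by eexists.
pose g' i := g i - dot e (g i) *: e.
have eg : dot e (g i0) *: e = g i0.
  rewrite eE dotZl dotxx scalerA conjc_real -!rmorphM /=.
  have [/nrm_eq0 ->|n0] := eqVneq (nrm (g i0)) 0; first by rewrite scaler0.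
  have -> : (nrm (g i0))^-1 * nrm (g i0) ^+ 2 / nrm (g i0) = 1 by field.
  by rewrite scale1r.
have g'0 (i : 'I_n) : (k <= i)%N -> g' i = 0.
  rewrite leq_eqVlt => /orP[/eqP ki|ki].
    have -> : i = i0 by apply: val_inj.
    by rewrite /g' eg subrr.
  by rewrite /g' g0// dot0r scale0r subrr.
have qe x : dot e e * dot e x = dot e x.
  have [/nrm_eq0 n0|n0] := eqVneq (nrm (g i0)) 0.
    by rewrite eE n0 scaler0 !dot0l mul0r.
  suff -> : dot e e = 1 by rewrite mul1r.
  rewrite eE dotxx nrmZr normfV ger0_norm ?nrm_ge0// mulVf// expr1n.
  by [].
have gg i j : dot (g i) (g j) = conjc (dot e (g i)) * dot e (g j) + dot (g' i) (g' j).
  have H : dot (g i) e = conjc (dot e (g i)) by rewrite dot_conj.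
  rewrite /g' !dotBl !dotBr !dotZl !dotZr H.
  rewrite [dot e (g j) * dot e e]mulrC qe; ring.
have -> : \sum_i \sum_j conjc (c i) * c j * (M i j * dot (g i) (g j)) =
    \sum_i \sum_j conjc (c i * dot e (g i)) * (c j * dot e (g j)) * M i j +
    \sum_i \sum_j conjc (c i) * c j * (M i j * dot (g' i) (g' j)).
  rewrite -big_split; apply: eq_bigr => i _; rewrite -big_split; apply: eq_bigr => j _.
  by rewrite gg rmorphM /=; ring.
by rewrite raddfD addr_ge0//; [exact: pM|exact: IH].
Qed.

Lemma psdD n (M N : 'I_n -> 'I_n -> R[i]) : psd M -> psd N ->
  psd (fun i j => M i j + N i j).
Proof.
move=> pM pN c; have := addr_ge0 (pM c) (pN c); rewrite -raddfD -big_split /=.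
under eq_bigr => i _ do rewrite -big_split /=.
suff -> : \sum_i \sum_j (conjc (c i) * c j * M i j + conjc (c i) * c j * N i j) =
    \sum_i \sum_j conjc (c i) * c j * (M i j + N i j) by [].
by apply: eq_bigr => i _; apply: eq_bigr => j _; rewrite mulrDr.
Qed.

Lemma psdZ n (M : 'I_n -> 'I_n -> R[i]) (K : R) : 0 <= K -> psd M ->
  psd (fun i j => K%:C * M i j).
Proof.
move=> K0 pM c.
have -> : \sum_i \sum_j conjc (c i) * c j * (K%:C * M i j) =
    K%:C * \sum_i \sum_j conjc (c i) * c j * M i j.
  rewrite mulr_sumr; apply: eq_bigr => i _; rewrite mulr_sumr; apply: eq_bigr => j _.
  by ring.
rewrite (_ : complex.Re _ = K * complex.Re (\sum_i \sum_j conjc (c i) * c j * M i j)).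
  by rewrite mulr_ge0.
by case: (\sum_i _) => a b /=; rewrite mul0r subr0.
Qed.

End Schur.

(** * Bounded multiplication on tensor powers *)

Section Multiplication.
Context {R : realType} {X : Type} (H : rkhs R X) (TH : tensor_powers H).

Lemma ksec_dense : dense (lspan (range (ksec H))).
Proof.
apply: dense_of_orth; first exact: lspan_subspace.
move=> f Hf; apply: (@ev_inj _ _ H); apply/funext => x.
by rewrite !reproducing dot0r Hf//; apply: sub_lspan; exists x.
Qed.

Section Rkha.
Hypothesis hrkha : is_rkha TH.

(** The inequality [|Delta f|^2 <= C^2 |f|^2], tested on combinations of kernel sections, says
    exactly that [C^2 k - k^2] is positive semidefinite. *)
Lemma rkha_kernel : exists2 C : R, 0 <= C & (forall x, nrm (ksec H x) <= C) /\
  forall n (x : 'I_n -> X), psd (fun i j => (C ^+ 2)%:C * dot (ksec H (x i)) (ksec H (x j))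
    - dot (ksec H (x i)) (ksec H (x j)) ^+ 2).
Proof.
have [Delta [bD DE]] := hrkha; have [C C0 HC] := bounded_linear_bound bD.
have DD x y : dot (Delta (ksec H x)) (Delta (ksec H y)) = dot (ksec H x) (ksec H y) ^+ 2.
  by rewrite !DE tp_dot prodr_const card_ord.
(* [|Delta k_x| = |k_x|^2], so the norms [|k_x|] are bounded by that of [Delta]. *)
exists C => //; split.
  move=> x; have [->//|k0] := eqVneq (nrm (ksec H x)) 0.
  have kp : 0 < nrm (ksec H x) by rewrite lt_def k0 nrm_ge0.
  rewrite -(ler_pM2r kp) -expr2; apply: le_trans (HC _).
  rewrite -(@ler_pXn2r _ 2)// ?nnegrE ?nrm_ge0 ?sqr_ge0//.
  rewrite -[leRHS]rdotxx /rdot DD dotxx -rmorphXn /=; exact: lexx.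
move=> n x c; pose f := \sum_i c i *: ksec H (x i).
have nf (F : hilbertType R) (g : 'I_n -> F) : nrm (\sum_i c i *: g i) ^+ 2 =
    complex.Re (\sum_i \sum_j conjc (c i) * c j * dot (g i) (g j)).
  rewrite -rdotxx /rdot dot_suml; congr complex.Re; apply: eq_bigr => i _.
  by rewrite dot_sumr; apply: eq_bigr => j _; rewrite dotZl dotZr mulrA.
have : nrm (Delta f) ^+ 2 <= (C * nrm f) ^+ 2.
  by rewrite ler_pXn2r// nnegrE ?nrm_ge0// mulr_ge0// nrm_ge0.
rewrite /f (lfun_sum _ _ _ bD.1).
under eq_bigr => i _ do rewrite (lfunZ _ _ bD.1).
rewrite exprMn !nf -subr_ge0; congr (0 <= _).
have ReZ (K : R) (z : R[i]) : K * complex.Re z = complex.Re (K%:C * z).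
  by case: z => a b /=; rewrite mul0r subr0.
rewrite ReZ -raddfB; congr complex.Re.
rewrite mulr_sumr -sumrB; apply: eq_bigr => i _.
rewrite mulr_sumr -sumrB; apply: eq_bigr => j _.
by rewrite DD; ring.
Qed.

Lemma ev_bounded : exists2 C : R, 0 <= C &
  forall (f : H) x, nrm (ev f x : R[i]^o) <= C * nrm f.
Proof.
have [C C0 [HC _]] := rkha_kernel; exists C => // f x.
rewrite reproducing; apply: le_trans (dot_le _ _) _.
by rewrite ler_wpM2r// nrm_ge0.
Qed.

(** Domination of [k^(n+1)] by a multiple of [k] is the norm bound needed to extend the map defined
    on kernel sections. *)
Lemma coproduct_power n : exists D : H -> TH n.+1, bounded_linear D /\
  forall x, D (ksec H x) = tp TH (fun=> ksec H x).
Proof.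
have [C C0 [_ HC]] := rkha_kernel.
(* The kernel [C^(2m) k - k^(m+1)] is positive semidefinite by induction: it    *)
(* is [C^2 (C^(2(m-1)) k - k^m) + k^(m-1) (C^2 k - k^2)].                      *)
have key N (x : 'I_N -> X) m : psd (fun i j =>
    ((C ^+ 2) ^+ m)%:C * dot (ksec H (x i)) (ksec H (x j))
    - dot (ksec H (x i)) (ksec H (x j)) ^+ m.+1).
  elim: m => [|m IH].
    move=> c; rewrite big1// => i _; rewrite big1// => j _.
    by rewrite expr0 mul1r expr1 subrr mulr0.
  have := psdD (psdZ (sqr_ge0 C) IH)
    (psd_gram (fun i => tp TH (fun=> ksec H (x i)) : TH m) (HC N x)).
  move=> + c => /(_ c); congr (0 <= complex.Re _).
  apply: eq_bigr => i _; apply: eq_bigr => j _; congr (_ * _).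
  rewrite tp_dot prodr_const card_ord [X in (X)%:C]exprS rmorphM /=.
  by rewrite !exprS; ring.
have [|||D [bD HD _]] := @extend_family R H (TH n.+1) X (ksec H)
    (fun x => tp TH (fun=> ksec H x)) (C ^+ n).
- exact: exprn_ge0.
- exact: ksec_dense.
- move=> s; rewrite -(@ler_pXn2r _ 2)// ?nnegrE ?mulr_ge0 ?exprn_ge0 ?nrm_ge0//.
  rewrite big_tnth [X in _ <= (_ * nrm X) ^+ _]big_tnth exprMn exprAC.
  set c := fun i => (tnth (in_tuple s) i).1; set x := fun i => (tnth (in_tuple s) i).2.
  have nf (F : hilbertType R) (g : X -> F) :
      nrm (\sum_i c i *: g (x i)) ^+ 2 =
      complex.Re (\sum_i \sum_j conjc (c i) * c j * dot (g (x i)) (g (x j))).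
    rewrite -rdotxx /rdot dot_suml; congr complex.Re; apply: eq_bigr => i _.
    by rewrite dot_sumr; apply: eq_bigr => j _; rewrite dotZl dotZr mulrA.
  rewrite -subr_ge0; have := key _ x n c.
  have ReZ (K : R) (z : R[i]) : K * complex.Re z = complex.Re (K%:C * z).
    by case: z => a b /=; rewrite mul0r subr0.
  rewrite (nf _ (ksec H)) (nf _ (fun x => tp TH (fun=> ksec H x))) ReZ -raddfB.
  congr (0 <= complex.Re _).
  rewrite mulr_sumr -sumrB; apply: eq_bigr => i _.
  rewrite mulr_sumr -sumrB; apply: eq_bigr => j _.
  by rewrite tp_dot prodr_const card_ord; ring.
by exists D.
Qed.

Hypothesis hunital : exists one : H, forall x, ev one x = 1.

(** In positive degree multiplication is the adjoint of the iterated coproduct, as pairing with a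
    kernel section shows. In degree 0 the empty tensor is a unit vector, sent to the constant
    function 1. *)
Lemma mult_mapP n : bounded_linear (@mult_map _ _ H TH n) /\
  forall (g : 'I_n -> H) x, ev (mult_map (tp TH g)) x = \prod_i ev (g i) x.
Proof.
suff [M HM] : exists M : TH n -> H, bounded_linear M /\
  forall (g : 'I_n -> H) x, ev (M (tp TH g)) x = \prod_i ev (g i) x.
  exact: (@getPex _ [set M : TH n -> H | bounded_linear M /\
  forall (g : 'I_n -> H) x, ev (M (tp TH g)) x = \prod_i ev (g i) x] (ex_intro _ M HM)).
case: n => [|n].
  have [one H1] := hunital; pose t0 : TH 0%N := tp TH (fun=> 0).
  exists (fun u => dot t0 u *: one); split.
    apply: (bound_bounded_linear (C := nrm t0 * nrm one)) => [a u v|u].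
      by rewrite dotDr dotZr scalerDl scalerA.
    by rewrite nrmZ mulrAC ler_wpM2r ?nrm_ge0// dot_le.
  move=> g x; rewrite tp_dot !big_ord0 scale1r; exact: H1.
have [D [bD HD]] := coproduct_power n; have [M bM DM] := adjoint_exists bD.
exists M; split => // g x; rewrite reproducing -DM HD tp_dot.
by apply: eq_bigr => i _; rewrite reproducing.
Qed.

Lemma mult_map_vee n (g : 'I_n -> H) : mult_map (vee TH g) = mult_map (tp TH g).
Proof.
have [[lM _] HM] := mult_mapP n.
rewrite /vee (lfunZ _ _ lM) (lfun_sum _ _ _ lM).
under eq_bigr => s _.
  have -> : mult_map (tp TH (fun i => g (s i))) = mult_map (tp TH g).
    apply: (@ev_inj _ _ H); apply/funext => x; rewrite !HM.
    by rewrite [RHS](reindex_inj (@perm_inj _ s)).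
  over.
rewrite sumr_const (_ : #|_| = n`!); last by rewrite -card_Sn; exact: eq_card.
rewrite -(scaler_nat n`! (mult_map (tp TH g))) scalerA mulVf ?scale1r//.
Qed.

Context (w : nat -> R) (FH : fock_space TH w).
Hypothesis w0 : forall n, w n != 0.

Lemma mm_sum x : Tfin FH x -> exists N, forall M, (N <= M)%N ->
  mm x = \sum_(n < M) mult_map (component n x).
Proof.
move=> Tx; have [_ [N HN]] := Tfin_component w0 Tx; exists N => M NM.
rewrite /mm (fsbig_ord _ _ (fun n => mult_map (component n x))); apply/esym.
apply: fsbig_widen => // k [_ /negP]; rewrite -leqNgt => Mk.
have [lM _] := (mult_mapP k).1.
by rewrite /= (HN k (leq_trans NM Mk)).1 (lfun0 lM).
Qed.

Lemma mm_linear a x y : Tfin FH x -> Tfin FH y ->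
  mm (a *: x + y) = a *: mm x + mm y.
Proof.
move=> Tx Ty; have Txy := (Tfin_subspace FH).2 a _ _ Tx Ty.
have [N1 H1] := mm_sum Tx; have [N2 H2] := mm_sum Ty; have [N3 H3] := mm_sum Txy.
pose N := (N1 + N2 + N3)%N.
rewrite (H1 N) ?(H2 N) ?(H3 N) /N; try lia.
rewrite scaler_sumr -big_split; apply: eq_bigr => n _.
have [lM _] := (mult_mapP n).1.
by rewrite (component_linear w0)// lM.
Qed.

Lemma mm_fvee n (g : 'I_n -> H) : mm (fvee FH g) = mult_map (tp TH g).
Proof.
have [N HN] := mm_sum (Tfin_fvee FH w0 g).
rewrite (HN (N + n.+1)%N) ?leq_addr//.
have nN : (n < N + n.+1)%N by rewrite addnS ltnS leq_addl.
rewrite (bigD1 (Ordinal nN))//= component_inj//; last exact: vee_symmetric.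
rewrite mult_map_vee big1 ?addr0// => i iN.
have [lM _] := (mult_mapP i).1.
rewrite component_inj0 ?(lfun0 lM)//; exact: vee_symmetric.
Qed.

End Rkha.
End Multiplication.

(** * The amplified generator *)

Section HilbertTensor.
Context {R : realType} {E F : hilbertType R} (K : hilbert_tensor E F).

Lemma tens_ext (x y : K) : (forall a b, dot (tens K a b) x = dot (tens K a b) y) -> x = y.
Proof.
move=> xy; apply/eqP; rewrite -subr_eq0; apply/eqP.
apply: (dense_orth (@tens_dense _ _ _ K)); apply: lspan_orth => _ [a [b ->]].
by rewrite dotBr xy subrr.
Qed.

Lemma tens_linearl f : linear (fun x => tens K x f).
Proof.
move=> c x y; apply: tens_ext => a b; rewrite dotDr dotZr !tens_dot dotDr dotZr; ring.
Qed.

Lemma tens_linearr x : linear (tens K x).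
Proof.
move=> c f g; apply: tens_ext => a b; rewrite dotDr dotZr !tens_dot dotDr dotZr; ring.
Qed.

Lemma tens_cvg S (FS : set_system S) (FF : Filter FS) (u : S -> E) (v : S -> F) x f :
  u @ FS --> x -> v @ FS --> f -> tens K (u s) (v s) @[s --> FS] --> tens K x f.
Proof.
move=> ux vf; apply: cvg_dotP; rewrite !tens_dot.
  under eq_fun do rewrite tens_dot.
  by apply: (@cvgM _ _ FS FF (fun s => dot (u s) (u s) : R[i]^o)
    (fun s => dot (v s) (v s) : R[i]^o)); exact: cvg_dot.
under eq_fun do rewrite tens_dot.
by apply: (@cvgM _ _ FS FF (fun s => dot (u s) x : R[i]^o)
    (fun s => dot (v s) f : R[i]^o)); apply: cvg_dot => //; exact: cvg_cst.
Qed.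

Lemma tens_nrm x f : nrm (tens K x f) = nrm x * nrm f.
Proof.
apply/eqP; rewrite -(@eqrXn2 _ 2)// ?mulr_ge0 ?nrm_ge0// exprMn.
by rewrite -rdotxx /rdot tens_dot !dotxx -rmorphM.
Qed.

Lemma tens_dense_span (A : set E) (B : set F) : dense (lspan A) -> dense B ->
  dense (lspan [set u | exists a b, [/\ A a, B b & u = tens K a b]]).
Proof.
move=> dA dB; apply: dense_lspan (@tens_dense _ _ _ K) _ => _ [x [f ->]].
have /closure_seq[u Au ux] := (dense_closure _).1 dA x.
have /closure_seq[v Bv vf] := (dense_closure _).1 dB f.
apply: (closure_lim (tens_cvg _ ux vf)); apply: nearW => n.
have : lspan A `<=` [set y | lspan [set u | exists a b, [/\ A a, B b & u = tens K a b]]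
   (tens K y (v n))].
  apply: lspan_min.
    split=> [|c y z /= Hy Hz].
      by rewrite /= (lfun0 (tens_linearl (v n))); exact: (lspan_subspace _).1.
    by rewrite /= (tens_linearl (v n)); exact: (lspan_subspace _).2.
  by move=> y Ay; apply: sub_lspan; exists y, (v n).
by apply; exact: Au.
Qed.

End HilbertTensor.

(** * Norms of words and the Fibonacci recursion on columns *)

Section WordNorms.
Context {R : realType} {H : hilbertType R} (D : set H) (a b : H -> H).
Hypotheses (sD : linear_subspace D) (aD : forall f, D f -> D (a f))
  (bD : forall f, D f -> D (b f)).
Hypothesis alin : forall c f g, D f -> D g -> a (c *: f + g) = c *: a f + a g.
Hypothesis blin : forall c f g, D f -> D g -> b (c *: f + g) = c *: b f + b g.

Fixpoint word_nrm (m : nat) (h : H) : R :=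
  if m is m'.+1 then word_nrm m' (a h) + word_nrm m' (b h) else nrm h.

Lemma word_nrm_ge0 m h : 0 <= word_nrm m h.
Proof. by elim: m h => [|m IH] h /=; [exact: nrm_ge0|rewrite addr_ge0]. Qed.

Lemma iter_word_nrm m f : nrm (iter m a f) <= word_nrm m f.
Proof.
elim: m f => [//|m IH] f; rewrite iterSr /=; apply: le_trans (IH _) _.
by rewrite lerDl word_nrm_ge0.
Qed.

Lemma word_nrmE m h : \sum_(eps : m.-tuple bool)
    nrm (foldr (fun e g => if e then b g else a g) h eps) = word_nrm m h.
Proof.
elim: m h => [|m IH] h.
  by rewrite (big_pred1 [tuple]) // => t; apply/esym/eqP; exact: tuple0.
(* [foldr] applies the last letter of a word first, while [word_nrm] unfolds at the letter next to
   the vector; so words are split at their last letter. *)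
pose f (p : bool * m.-tuple bool) : m.+1.-tuple bool := [tuple of rcons p.2 p.1].
rewrite (reindex f) /=; last first.
  apply: onW_bij; apply: inj_card_bij.
    by move=> [e t] [e' t'] /(congr1 val) /= /rcons_inj[/val_inj -> ->].
  by rewrite card_prod !card_tuple card_bool expnS.
rewrite -(pair_bigA _ (fun e (t : m.-tuple bool) =>
  nrm (foldr (fun e g => if e then b g else a g) h (rcons t e)))) /= big_bool.
rewrite addrC -!IH; congr (_ + _); apply: eq_bigr => t _; by rewrite foldr_rcons.
Qed.

Lemma alin0 : a 0 = 0.
Proof.
have := alin (-1) (subspace0 sD) (subspace0 sD).
by rewrite !scaleN1r !addNr.
Qed.

Lemma blin0 : b 0 = 0.
Proof.
have := blin (-1) (subspace0 sD) (subspace0 sD).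
by rewrite !scaleN1r !addNr.
Qed.

Lemma alinZ c f : D f -> a (c *: f) = c *: a f.
Proof. by move=> Df; have := alin c Df (subspace0 sD); rewrite alin0 !addr0. Qed.

Lemma blinZ c f : D f -> b (c *: f) = c *: b f.
Proof. by move=> Df; have := blin c Df (subspace0 sD); rewrite blin0 !addr0. Qed.

Lemma word_nrm0 m : word_nrm m 0 = 0.
Proof. by elim: m => [|m IH] /=; [exact: nrm0|rewrite alin0 blin0 IH addr0]. Qed.

Lemma word_nrmZ m c h : D h -> word_nrm m (c *: h) = nrm (c : R[i]^o) * word_nrm m h.
Proof.
elim: m h => [|m IH] h Dh /=; first exact: nrmZ.
by rewrite alinZ// blinZ// !IH ?mulrDr//; [exact: bD|exact: aD].
Qed.

Lemma word_nrmD m h k : D h -> D k -> word_nrm m (h + k) <= word_nrm m h + word_nrm m k.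
Proof.
elim: m h k => [|m IH] h k Dh Dk /=; first exact: nrmD.
have aD' x y : D x -> D y -> a (x + y) = a x + a y.
  by move=> Dx Dy; have := alin 1 Dx Dy; rewrite !scale1r.
have bD' x y : D x -> D y -> b (x + y) = b x + b y.
  by move=> Dx Dy; have := blin 1 Dx Dy; rewrite !scale1r.
rewrite aD'// bD'// addrACA; apply: lerD; apply: IH;
  by [exact: aD|exact: bD].
Qed.

Definition spart (f : H) : H := 2^-1 *: (a f + b f).
Definition apart (f : H) : H := 2^-1 *: (a f - b f).

Lemma nrm_half : nrm (2^-1 : R[i]^o) = 2^-1.
Proof. by rewrite -[2]/(2%:R) -(rmorph_nat (real_complex R)) -fmorphV nrmC ger0_norm. Qed.

Lemma spart_D f : D f -> D (spart f).
Proof.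
move=> Df; apply: (subspaceZ _ sD); apply: (subspaceD sD); [exact: aD|exact: bD].
Qed.

Lemma apart_D f : D f -> D (apart f).
Proof.
move=> Df; apply: (subspaceZ _ sD); apply: (subspaceB sD); [exact: aD|exact: bD].
Qed.

Lemma word_nrm_spart m f : D f -> word_nrm m (spart f) <= 2^-1 * word_nrm m.+1 f.
Proof.
move=> Df; have Da := aD Df; have Db := bD Df.
rewrite word_nrmZ ?nrm_half; last exact: (subspaceD sD).
by rewrite ler_pM2l// word_nrmD.
Qed.

Lemma word_nrm_apart m f : D f -> word_nrm m (apart f) <= 2^-1 * word_nrm m.+1 f.
Proof.
move=> Df; have Da := aD Df; have Db := bD Df.
rewrite word_nrmZ ?nrm_half; last exact: (subspaceB sD).
rewrite ler_pM2l//; apply: le_trans (word_nrmD _ _ _) _ => //.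
  exact: (subspaceN sD).
rewrite -scaleN1r word_nrmZ// (_ : nrm (-1 : R[i]^o) = 1) ?mul1r//.
by rewrite nrmN -(rmorph1 (real_complex R)) nrmC normr1.
Qed.

(** The action of [L] on the coefficients of a column [sum_j e_j (x) g_j]: row [i] of the
    tridiagonal matrix with [S] above, [A] on and [- S] below the diagonal. *)
Definition jacobi (g : nat -> H) (i : nat) : H :=
  spart (g i.+1) + apart (g i) - (if i is j.+1 then spart (g j) else 0).

Lemma jacobi_D g : (forall i, D (g i)) -> forall i, D (jacobi g i).
Proof.
move=> Dg i; apply: (subspaceB sD); last first.
  by case: i => [|i]; [exact: subspace0|exact: spart_D].
by apply: (subspaceD sD); [exact: spart_D|exact: apart_D].
Qed.

Lemma iter_jacobi_D g m : (forall i, D (g i)) -> forall i, D (iter m jacobi g i).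
Proof. by move=> Dg; elim: m => [//|m IH] /=; exact: jacobi_D. Qed.

Lemma spart0 : spart 0 = 0.
Proof. by rewrite /spart alin0 blin0 addr0 scaler0. Qed.

Lemma apart0 : apart 0 = 0.
Proof. by rewrite /apart alin0 blin0 subr0 scaler0. Qed.

Lemma iter_jacobi_supp g J m : (forall i, (J <= i)%N -> g i = 0) ->
  forall i, (J + m <= i)%N -> iter m jacobi g i = 0.
Proof.
move=> gJ; elim: m => [|m IH] i; first by rewrite addn0; exact: gJ.
rewrite addnS => Ji; rewrite /= /jacobi !IH ?spart0 ?apart0 ?addr0 ?sub0r; try lia.
by case: i Ji => [//|i Ji]; rewrite IH ?spart0 ?oppr0.
Qed.

(* Both [u i = 2 ^ i] and [u i = 2 ^ - i] are admissible weights: the first one *)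
(* absorbs the growth of the Fibonacci numbers, the second one is summable.    *)
Lemma jacobi_bound (u : nat -> R) (g : nat -> H) (beta : nat -> R) m :
  (forall k, 0 <= beta k) ->
  u 1%N + u 0%N <= 4 * u 0%N -> (forall i, u i.+2 + u i.+1 + u i <= 4 * u i.+1) ->
  (forall i, D (g i)) -> (forall k i, word_nrm k (g i) <= u i * beta k) ->
  forall k i, word_nrm k (iter m jacobi g i) <= u i * (2 ^+ m * beta (m + k)%N).
Proof.
move=> beta0 u0 u1 Dg gb; elim: m => [|m IH] k i; first by rewrite expr0 mul1r add0n.
have Dm := iter_jacobi_D m Dg; set h := iter m jacobi g in IH Dm *.
rewrite /= -/h /jacobi; set B := 2 ^+ m * beta (m + k.+1)%N.
have B0 : 0 <= B by rewrite mulr_ge0 ?exprn_ge0.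
have -> : 2 ^+ m.+1 * beta (m.+1 + k)%N = 2 * B by rewrite exprS addSnnS -mulrA.
have Hs j : word_nrm k (spart (h j)) <= 2^-1 * (u j * B).
  by apply: le_trans (word_nrm_spart _ (Dm j)) _; rewrite ler_pM2l// IH.
have Ha j : word_nrm k (apart (h j)) <= 2^-1 * (u j * B).
  by apply: le_trans (word_nrm_apart _ (Dm j)) _; rewrite ler_pM2l// IH.
have N1 x : D x -> word_nrm k (- x) = word_nrm k x.
  move=> Dx; rewrite -scaleN1r word_nrmZ// (_ : nrm (-1 : R[i]^o) = 1) ?mul1r//.
  by rewrite nrmN -(rmorph1 (real_complex R)) nrmC normr1.
have Ds j := spart_D (Dm j); have Da j := apart_D (Dm j).
apply: le_trans (word_nrmD _ (subspaceD sD (Ds _) (Da _)) _) _.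
  by apply: (subspaceN sD); case: i => [|i]; [exact: subspace0|exact: Ds].
apply: le_trans (lerD (word_nrmD k (Ds i.+1) (Da i)) (lexx _)) _.
(* Each of the three terms costs half of the next word norm; the condition on [u] turns half the sum
   of three neighbouring weights into at most [2 u i]. *)
have := Hs i.+1; have := Ha i; case: i => [|i] Hai Hsi.
  rewrite oppr0 word_nrm0 addr0; have := ler_wpM2r B0 u0; lra.
rewrite N1//; have := Hs i; have := ler_wpM2r B0 (u1 i); lra.
Qed.

Lemma spartZ c f : D f -> spart (c *: f) = c *: spart f.
Proof. by move=> Df; rewrite /spart alinZ// blinZ// -scalerDr !scalerA mulrC. Qed.

Lemma apartZ c f : D f -> apart (c *: f) = c *: apart f.
Proof. by move=> Df; rewrite /apart alinZ// blinZ// -scalerBr !scalerA mulrC. Qed.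

Lemma spart_apart f : spart f + apart f = a f.
Proof.
rewrite /spart /apart -scalerDr addrACA subrr addr0 -mulr2n -(scaler_nat 2 (a f)).
by rewrite scalerA mulVf ?scale1r// pnatr_eq0.
Qed.

Lemma iter_a_D m f : D f -> D (iter m a f).
Proof. by move=> Df; elim: m => [//|m IH] /=; exact: aD. Qed.

(* [F_(i+2) - F_i = F_(i+1)] turns [S] and [A] into [S + A]. *)
Lemma jacobi_fib n f g : D f ->
  (forall i, (i < n)%N -> g i = (fib i.+1)%:R *: f) ->
  forall m i, (i + m < n)%N -> iter m jacobi g i = (fib i.+1)%:R *: iter m a f.
Proof.
move=> Df gf; elim=> [|m IH] i; first by rewrite addn0; exact: gf.
move=> imn; have Dm := iter_a_D m Df; rewrite /= /jacobi IH; last by lia.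
rewrite IH; last by lia.
rewrite spartZ// apartZ//; case: i imn => [|i] imn.
  by rewrite subr0 !scale1r spart_apart.
rewrite IH; last by lia.
rewrite spartZ// (_ : fib i.+3 = (fib i.+2 + fib i.+1)%N)//.
by rewrite natrD scalerDl [_ + _ *: spart _ + _]addrAC addrK -scalerDr spart_apart.
Qed.

End WordNorms.

(** * The amplified operator and its compression to the first component *)

Section JacobiOperator.
Context {R : realType} {H : hilbertType R} (D : set H) (a b : H -> H).
Hypotheses (sD : linear_subspace D) (dD : dense D) (aD : forall f, D f -> D (a f))
  (bD : forall f, D f -> D (b f)).
Hypothesis alin : forall c f g, D f -> D g -> a (c *: f + g) = c *: a f + a g.
Hypothesis blin : forall c f g, D f -> D g -> b (c *: f + g) = c *: b f + b g.
Hypothesis ab : forall f g, D f -> D g -> dot (b f) g = dot f (a g).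
Context (ell : ell2 R) (K : hilbert_tensor ell H).

Notation e j := (l2e ell j).
Notation S := (spart a b).
Notation A := (apart a b).
Notation Lam := (jacobi a b).

(** The value of [L] on [e_j (x) f], a column of the tridiagonal matrix; the first term is absent
    for [j = 0]. *)
Definition jacobi_column (j : nat) (f : H) : K :=
  (if j is i.+1 then tens K (e i) (S f) else 0) + tens K (e j) (A f)
  - tens K (e j.+1) (S f).

Definition jacobi_graph : set (K * K) :=
  lspan [set p | exists j f, D f /\ p = (tens K (e j) f, jacobi_column j f)].

Let sL : linear_subspace jacobi_graph := lspan_subspace _.

Lemma dot_spart f g : D f -> D g -> dot (S f) g = dot f (S g).
Proof.
move=> Df Dg; rewrite /spart dotZl dotZr dotDl dotDr ab//.
rewrite [dot (a f) g]dot_conj -ab// -dot_conj addrC.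
by rewrite conjc_inv conjc_nat.
Qed.

Lemma dot_apart f g : D f -> D g -> dot (A f) g = - dot f (A g).
Proof.
move=> Df Dg; rewrite /apart dotZl dotZr dotBl dotBr ab//.
rewrite [dot (a f) g]dot_conj -ab// -dot_conj conjc_inv conjc_nat.
by rewrite -mulrN opprB.
Qed.

(** [S] is symmetric with antisymmetric scalar coefficients, and [A] is skew on the diagonal. *)
Lemma jacobi_graph_skew x y : jacobi_graph (x, y) -> rdot x y = 0.
Proof.
apply: skew_lspan => _ _ [j [f [Df ->]]] [k [g [Dg ->]]] /=.
have tE i f' i' g' : dot (tens K (e i) f') (tens K (e i') g') = (i == i')%:R * dot f' g'.
  by rewrite tens_dot l2e_orthonormal.
rewrite /jacobi_column dotBl dotDl dotBr dotDr !tE.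
have -> : dot (if j is i.+1 then tens K (e i) (S f) else 0) (tens K (e k) g) =
    (j == k.+1)%:R * dot (S f) g.
  by case: j => [|j]; rewrite ?dot0l ?mul0r ?tE// eqSS.
have -> : dot (tens K (e j) f) (if k is i.+1 then tens K (e i) (S g) else 0) =
    (j.+1 == k)%:R * dot f (S g).
  by case: k => [|k]; rewrite ?dot0r ?mul0r ?tE// eqSS.
by rewrite dot_spart// dot_apart//; ring.
Qed.

Definition column_vector (J : nat) (g : nat -> H) : K := \sum_(j < J) tens K (e j) (g j).

Lemma column_vector_graph J g : (forall j, D (g j)) -> (forall j, (J <= j)%N -> g j = 0) ->
  jacobi_graph (column_vector J g, column_vector J.+1 (Lam g)).
Proof.
move=> Dg gJ.
have S0 : S 0 = 0 by exact: (spart0 sD alin blin).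
have A0 : A 0 = 0 by exact: (apart0 sD alin blin).
have t0 i : tens K (e i) 0 = 0 by exact: (lfun0 (tens_linearr K (e i))).
have -> : column_vector J.+1 (Lam g) = \sum_(j < J) jacobi_column j (g j).
  (* The three diagonals end at different rows; padding with the vanishing entries of [g] brings the
     sums to a common length. *)
  have ext (F : nat -> H -> K) (N : nat) : (forall j, F j 0 = 0) -> (J <= N)%N ->
      \sum_(j < J) F j (g j) = \sum_(j < N) F j (g j).
    move=> F0 JN; rewrite (big_ord_widen N (fun j => F j (g j)) JN) big_mkcond.
    by apply: eq_bigr => i _; case: ltnP => // Ji; rewrite gJ ?F0.
  rewrite /jacobi_column sumrB big_split /=.
  rewrite (ext (fun j f => if j is i.+1 then tens K (e i) (S f) else 0) J.+2); last 2 first.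
  - by case=> [|j]; rewrite ?S0 ?t0.
  - by rewrite leqW.
  rewrite (ext (fun j f => tens K (e j) (A f)) J.+1) ?leqnSn//; last by move=> j; rewrite A0 t0.
  rewrite [X in _ = X + _ - _]big_ord_recl add0r.
  rewrite /column_vector.
  have -> : \sum_(j < J) tens K (e j.+1) (S (g j)) =
      \sum_(i < J.+1) tens K (e i) (if (i : nat) is j.+1 then S (g j) else 0).
    by rewrite big_ord_recl t0 add0r.
  rewrite -big_split -sumrB /=; apply: eq_bigr => i _.
  by rewrite /jacobi (lfunB _ _ (tens_linearr K _)) (lfunD _ _ (tens_linearr K _)).
apply: (big_ind2 (fun x y => jacobi_graph (x, y))).
- exact: (subspace0 sL).
- by move=> x y z t; exact: (subspaceD sL).
- by move=> j _; apply: sub_lspan; exists j, (g j).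
Qed.

Lemma column_vector_nrm J g : nrm (column_vector J g) <= \sum_(j < J) nrm (g j).
Proof.
apply: le_trans (nrm_sum _ _ _) _; apply: ler_sum => j _.
rewrite tens_nrm (_ : nrm (e j) = 1) ?mul1r//.
have := rdotxx (e j); rewrite /rdot l2e_orthonormal eqxx /= => /esym/eqP.
by rewrite sqrp_eq1 ?nrm_ge0// => /eqP.
Qed.

(** The iterates of [L] on a column of length [J]: each application lengthens the support by at most
    one row. *)
Definition column_seq (J : nat) (g : nat -> H) (m : nat) : K :=
  column_vector (J + m) (iter m Lam g).

Lemma texpM2 (t : R) m : 2 ^+ m * texp t m = texp (2 * t) m.
Proof. by rewrite /texp exprMn mulrA. Qed.

(** With weights [2^-i] the column norms are summable and the [m]-th iterate is at most a constant
    times [2^m W_m], [W_m] being the word norm of [f]; this [2^m] accounts for the radius [2 r] of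
    the word series. *)
Lemma column_seq_analytic J (c : nat -> R[i]) f r : D f ->
  exp_radius (fun k => word_nrm a b k f) (2 * r) ->
  analytic_seq jacobi_graph r
    (column_seq J (fun j => if (j < J)%N then c j *: f else 0)).
Proof.
move=> Df fr; set g := fun j => _.
have Dg j : D (g j).
  by rewrite /g; case: ifP => _; [exact: (subspaceZ _ sD)|exact: (subspace0 sD)].
have gJ j : (J <= j)%N -> g j = 0 by rewrite /g ltnNge => ->.
split.
  move=> m; apply: subset_closure; rewrite /column_seq addnS.
  apply: (column_vector_graph (g := iter m Lam g)).
    exact: (iter_jacobi_D sD aD bD).
  exact: (iter_jacobi_supp sD alin blin).
(* Chosen so that [|c_i| <= 2^-i C] for every row of the column. *)
pose C := \sum_(j < J) nrm (c j : R[i]^o) * 2 ^+ j.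
have C0 : 0 <= C by rewrite sumr_ge0// => j _; rewrite mulr_ge0 ?nrm_ge0 ?exprn_ge0.
have gb k i : word_nrm a b k (g i) <= 2^-1 ^+ i * (C * word_nrm a b k f).
  rewrite /g; case: ifPn => iJ; last first.
    rewrite (word_nrm0 sD alin blin) !mulr_ge0 ?exprn_ge0 ?invr_ge0//.
    exact: word_nrm_ge0.
  rewrite (word_nrmZ sD aD bD alin blin)// mulrA ler_wpM2r ?word_nrm_ge0//.
  rewrite exprVn mulrC ler_pdivlMr ?exprn_gt0// /C (bigD1 (Ordinal iJ))//= lerDl.
  by rewrite sumr_ge0// => j _; rewrite mulr_ge0 ?nrm_ge0 ?exprn_ge0.
have beta0 k : 0 <= C * word_nrm a b k f by rewrite mulr_ge0 ?word_nrm_ge0.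
have H1 m i : word_nrm a b 0 (iter m Lam g i) <=
    2^-1 ^+ i * (2 ^+ m * (C * word_nrm a b m f)).
  rewrite -[m in word_nrm a b m f]addn0.
  apply: (jacobi_bound (u := fun i => 2^-1 ^+ i) sD aD bD alin blin m beta0 _ _ Dg gb).
    by rewrite expr0 expr1; lra.
  move=> j; rewrite !exprS; have : 0 <= (2^-1 : R) ^+ j by rewrite exprn_ge0// invr_ge0.
  by lra.
move=> rho rho0 rhor; have [||B HB] := fr (2 * rho).
- by rewrite mulr_ge0.
- by rewrite ltr_pM2l.
exists (2 * C * B) => N; apply: le_trans (ler_wpM2l _ (HB N)); last by rewrite mulr_ge0.
rewrite mulr_sumr; apply: ler_sum => m _; rewrite -texpM2.
have -> : 2 * C * (word_nrm a b m f * (2 ^+ m * texp rho m)) =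
    2 * (2 ^+ m * (C * word_nrm a b m f)) * texp rho m by ring.
rewrite ler_wpM2r ?texp_ge0//; apply: le_trans (column_vector_nrm _ _) _.
apply: (@le_trans _ _ (\sum_(i < J + m) 2^-1 ^+ i * (2 ^+ m * (C * word_nrm a b m f)))).
  by apply: ler_sum => i _; exact: H1.
rewrite -mulr_suml ler_wpM2r ?mulr_ge0 ?exprn_ge0 ?word_nrm_ge0//.
elim: (J + m)%N => [|M IH]; first by rewrite big_ord0.
rewrite big_ord_recl expr0; under eq_bigr => i _ do rewrite /= /bump add1n exprS.
by rewrite -mulr_sumr; lra.
Qed.

Lemma jacobi_trajectory_dense : (forall f, D f ->
    exists2 r, 0 < r & exp_radius (fun k => word_nrm a b k f) r) ->
  dense (trajectory_start jacobi_graph).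
Proof.
move=> Dr; have := @tens_dense_span _ _ _ K _ _ (@l2e_dense _ ell) dD.
have sub : lspan [set u | exists x f, [/\ range (l2e ell) x, D f & u = tens K x f]]
    `<=` trajectory_start jacobi_graph.
  apply: lspan_min; first exact: trajectory_start_subspace.
  move=> _ [_ [f [[j _ <-] Df ->]]]; have [r r0 fr] := Dr f Df.
  have r2 : 0 < r / 2 by rewrite divr_gt0.
  have fr2 : exp_radius (fun k => word_nrm a b k f) (2 * (r / 2)) by rewrite mulrC divfK.
  have := analytic_trajectory sL jacobi_graph_skew r2
    (column_seq_analytic j.+1 (fun i => (i == j)%:R) Df fr2).
  move=> [c [c' [cc c0]]]; exists c, c'; split => //; rewrite c0.
  rewrite /column_seq /column_vector addn0 big_ord_recr /= ltnSn eqxx scale1r.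
  rewrite big1 ?add0r// => i _.
  rewrite ltnW ?ltnS// (ltn_eqF (ltn_ord i)) scale0r.
  exact: (lfun0 (tens_linearr K _)).
move=> /denseP dL; apply/denseP => x eps e0.
by have [u /sub Hu xu] := dL x eps e0; exists u.
Qed.

Section Compression.
Context (P : K -> H) (bP : bounded_linear P)
  (PE : forall x f, P (tens K x f) = dot (e 0%N) x *: f).

Lemma compression_column J g : (0 < J)%N -> P (column_vector J g) = g 0%N.
Proof.
case: J => // J _; rewrite /column_vector (lfun_sum _ _ _ bP.1).
rewrite big_ord_recl PE l2e_orthonormal eqxx scale1r big1 ?addr0// => i _.
by rewrite PE l2e_orthonormal scale0r.
Qed.

Lemma fib_le2 n : (fib n.+1 <= 2 ^ n)%N.
Proof.
suff : (fib n <= 2 ^ n)%N /\ (fib n.+1 <= 2 ^ n)%N by case.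
elim: n => [//|n [IH1 IH2]]; split; first by rewrite expnS; lia.
by rewrite (_ : fib n.+2 = (fib n.+1 + fib n)%N)// expnS; lia.
Qed.

(** Dominated convergence of power series. The first component of [L^m E_n f] equals [V^m f] for
    [m < n], and with weights [2^i] it is bounded by [2^m W_m] for all [m], independently of [n];
    only the tail from [n] on contributes to the error. *)
Lemma compression_cvg f r t : D f ->
  exp_radius (fun k => word_nrm a b k f) (2 * r) -> `|t| < r ->
  P (eser (column_seq n (fun j => if (j < n)%N then (fib j.+1)%:R *: f else 0)) t)
    @[n --> \oo] --> eser (fun m => iter m a f) t.
Proof.
move=> Df fr tr.
have r0 : 0 < r by exact: le_lt_trans tr.
pose g n j := if (j < n)%N then (fib j.+1)%:R *: f else 0 : H.
have Dg n j : D (g n j).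
  by rewrite /g; case: ifP => _; [exact: (subspaceZ _ sD)|exact: (subspace0 sD)].
have w0 k : 0 <= word_nrm a b k f by exact: word_nrm_ge0.
have gb n k i : word_nrm a b k (g n i) <= 2 ^+ i * word_nrm a b k f.
  rewrite /g; case: ifP => _.
    rewrite (word_nrmZ sD aD bD alin blin)// ler_wpM2r//.
    rewrite -(rmorph_nat (real_complex R)) nrmC ger0_norm// -natrX ler_nat.
    exact: fib_le2.
  by rewrite (word_nrm0 sD alin blin) mulr_ge0 ?exprn_ge0.
have gm n m : nrm (iter m Lam (g n) 0%N) <= 2 ^+ m * word_nrm a b m f.
  have := jacobi_bound (u := fun i => 2 ^+ i) (g := g n) sD aD bD alin blin m w0.
  move=> /(_ _ _ (Dg n) (gb n) 0%N 0%N); rewrite /= addn0 expr0 mul1r; apply.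
    by rewrite expr1; lra.
  move=> i; rewrite !exprS; have : 0 <= (2 : R) ^+ i by rewrite exprn_ge0.
  by lra.
have am m : nrm (iter m a f) <= word_nrm a b m f by exact: iter_word_nrm.
(* The factor 2 lets the same domination cover both series and their difference. *)
have dom (v : nat -> H) : (forall m, nrm (v m) <= 2 * (2 ^+ m * word_nrm a b m f)) ->
    exp_radius (fun m => nrm (v m)) r.
  move=> vw rho rho0 rhor; have [||B HB] := fr (2 * rho).
  - by rewrite mulr_ge0.
  - by rewrite ltr_pM2l.
  exists (2 * B) => N; apply: le_trans (ler_wpM2l _ (HB N)) => //.
  rewrite mulr_sumr; apply: ler_sum => m _; rewrite -texpM2.
  have -> : 2 * (word_nrm a b m f * (2 ^+ m * texp rho m)) =
     2 * (2 ^+ m * word_nrm a b m f) * texp rho m by ring.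
  by rewrite ler_wpM2r ?texp_ge0.
have p2 m : 1 <= (2 : R) ^+ m by apply: exprn_ege1; lra.
have ra : exp_radius (fun m => nrm (iter m a f)) r.
  apply: dom => m; apply: le_trans (am m) _.
  have := p2 m; have := w0 m; nra.
have PEg n : (0 < n)%N -> P (eser (column_seq n (g n)) t) = eser (fun m => iter m Lam (g n) 0%N) t.
  move=> n0; have [_ rg] := column_seq_analytic n (fun j => (fib j.+1)%:R) Df fr.
  have rL : exp_radius (fun m => nrm (iter m Lam (g n) 0%N)) r.
    apply: dom => m; apply: le_trans (gm n m) _.
    have := p2 m; have := w0 m; nra.
  have H1 := eser_cvg rg tr; have H2 := eser_cvg rL tr.
  have H3 := cvg_comp _ _ H1 (bP.2 _).
  apply: (cvg_uniq H3); rewrite (_ : _ \o _ = (fun N =>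
     \sum_(m < N) (texp t m)%:C *: iter m Lam (g n) 0%N)) //.
  apply/funext => N /=; rewrite (lfun_sum _ _ _ bP.1); apply: eq_bigr => m _.
  by rewrite (lfunZ _ _ bP.1) compression_column// addn_gt0 n0.
have t2 : 0 <= 2 * `|t| by rewrite mulr_ge0.
have t2r : 2 * `|t| < 2 * r by rewrite ltr_pM2l.
apply/cvg_nrmP => eps eps0; have e4 : 0 < eps / 4 by rewrite divr_gt0.
have [N HN] := exp_radius_cauchy w0 fr t2 t2r e4.
exists N.+1 => // n /= Nn; have n0 : (0 < n)%N by exact: leq_trans Nn.
rewrite -/(g n) PEg//.
pose d m := iter m a f - iter m Lam (g n) 0%N.
have dE : eser (fun m => iter m a f) t - eser (fun m => iter m Lam (g n) 0%N) t = eser d t.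
  have rL : exp_radius (fun m => nrm (iter m Lam (g n) 0%N)) r.
    apply: dom => m; apply: le_trans (gm n m) _.
    have := p2 m; have := w0 m; nra.
  have rd : exp_radius (fun m => nrm (d m)) r.
    apply: dom => m; apply: le_trans (nrmB _ _) _.
    have := am m; have := gm n m; have := p2 m; have := w0 m; nra.
  apply: (@cvg_uniq R H nat \oo _ (fun M => \sum_(m < M) (texp t m)%:C *: iter m a f
    - \sum_(m < M) (texp t m)%:C *: iter m Lam (g n) 0%N)).
    by apply: cvgBc; [exact: (eser_cvg ra tr)|exact: (eser_cvg rL tr)].
  rewrite (_ : (fun i => _) = (fun N => \sum_(m < N) (texp t m)%:C *: d m)).
    exact: eser_cvg rd tr.
  apply/funext => M; rewrite -sumrB; apply: eq_bigr => m _; by rewrite -scalerBr.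
have d0 m : (m < n)%N -> d m = 0.
  move=> mn; rewrite /d (jacobi_fib sD aD alin blin Df (n := n)).
  - by rewrite scale1r subrr.
  - by move=> i; rewrite /g => ->.
  - by rewrite add0n.
have rd : exp_radius (fun m => nrm (d m)) r.
  apply: dom => m; apply: le_trans (nrmB _ _) _.
  have := am m; have := gm n m; have := p2 m; have := w0 m; nra.
rewrite dE; apply: (@le_lt_trans _ _ (2 * (eps / 4))); last by lra.
apply: (eser_le rd tr) => M; have [Mn|nM] := leqP M n.
  rewrite big1 ?mulr_ge0 ?ltW// => m _; rewrite d0 ?nrm0 ?mul0r//.
  exact: leq_trans Mn.
have H1 := HN M n (ltnW Nn) (ltnW nM).
rewrite -(big_mkord xpredT (fun m => nrm (d m) * texp `|t| m)).
rewrite (big_cat_nat (leq0n n) (ltnW nM))//= big_nat_cond big1 ?add0r; last first.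
  by move=> m /andP[/andP[_ mn] _]; rewrite d0 ?nrm0 ?mul0r.
apply: le_trans (ler_wpM2l _ (ltW H1)) => //; rewrite mulr_sumr.
apply: ler_sum => m _; rewrite -texpM2.
have -> : 2 * (word_nrm a b m f * (2 ^+ m * texp `|t| m)) =
   2 * (2 ^+ m * word_nrm a b m f) * texp `|t| m by ring.
rewrite ler_wpM2r ?texp_ge0//; apply: le_trans (nrmB _ _) _.
have := am m; have := gm n m; have := p2 m; have := w0 m; nra.
Qed.

End Compression.
End JacobiOperator.

(** * The flow *)

Section Taylor.
Context {R : realType}.

Lemma texp0 m : texp (0 : R) m = (m == 0)%N%:R.
Proof. by case: m => [|m]; rewrite /texp ?expr0 ?fact0 ?divr1// exprS !mul0r. Qed.

Lemma is_derive_texp (t s : R) m :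
  is_derive s 1 (fun s => texp (t - s) m.+1) (- texp (t - s) m).
Proof.
have d1 : is_derive s 1 (fun s : R => t - s) (-1).
  rewrite -[-1]add0r; apply: is_deriveD.
rewrite (_ : (fun s => _) = ((m.+1)`!%:R^-1 : R) *: ((fun s => t - s) ^+ m.+1)).
  apply: is_derive_eq.
  rewrite /texp factS natrM invfM -![_ *: _]/(_ * _) mulrN1.
  rewrite mulrN -mulrA [m.+1%:R^-1 * _]mulrCA !mulrA; congr (- _).
  by rewrite mulrC mulrA /= -!mulrA mulVf ?mulr1// pnatr_eq0.
by apply/funext => x; rewrite /texp mulrC fctE.
Qed.

(** Taylor's formula with Cauchy's remainder. The intermediate point satisfies [|t - x| <= |t|], so
    the remainder is at most [|t|] times a term of the once shifted series, which tends to 0 inside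
    the radius. *)
Lemma taylor_cvg (phi : nat -> R -> R) (a : nat -> R) (r t : R) :
  (forall m (s : R), is_derive s 1 (phi m) (phi m.+1 s)) ->
  (forall m s, `|phi m s| <= a m) -> exp_radius a r -> `|t| < r ->
  \sum_(m < N) texp t m * phi m 0 @[N --> \oo] --> phi 0%N t.
Proof.
move=> dphi phia ar tr.
have a0 m : 0 <= a m by apply: le_trans (phia m 0).
pose psi N s := \sum_(m < N.+1) texp (t - s) m * phi m s.
have dpsi N (s : R) : is_derive s 1 (psi N) (texp (t - s) N * phi N.+1 s).
  elim: N => [|N IH].
    rewrite (_ : psi 0%N = phi 0%N); last first.
      by apply/funext => x; rewrite /psi big_ord1 /texp expr0 fact0 divr1 mul1r.
    by rewrite /texp expr0 fact0 divr1 mul1r.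
  rewrite (_ : psi N.+1 = psi N + (fun s => texp (t - s) N.+1) * phi N.+1); last first.
    by apply/funext => x; rewrite /psi big_ord_recr fctE.
  have d2 := is_derive_texp t s N.
  have d3 := is_deriveM d2 (dphi N.+1 s).
  apply: is_derive_eq (is_deriveD IH d3) _.
  by rewrite -![_ *: _]/(_ * _); ring.
(* [psi N s] is the Taylor polynomial at [s] evaluated at [t]; its derivative  *)
(* in [s] telescopes to the last term.                                         *)
have psit N : psi N t = phi 0%N t.
  rewrite /psi big_ord_recl subrr big1 => [|i _]; first by rewrite addr0 texp0 mul1r.
  by rewrite texp0 mul0r.
have rem N : `|phi 0%N t - psi N 0| <= a N.+1 * texp `|t| N * `|t|.
  have [x /andP[_ xt]] :=
    @MVT0 R (psi N) (fun s => texp (t - s) N * phi N.+1 s) t (fun s _ => dpsi N s).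
  rewrite psit => ->; rewrite normrM [X in X * _]normrM texp_norm.
  rewrite ler_wpM2r// mulrC.
  by apply: ler_pM => //; [exact: texp_ge0|exact: texp_le].
have ar1 := exp_radius_shift a0 ar.
have c0 : a N.+1 * texp `|t| N * `|t| @[N --> \oo] --> (0 : R).
  rewrite -[X in _ --> X](mul0r `|t|); apply: cvgMr_tmp.
  apply/cvgrPdist_lt => e e0.
  have [N HN] := exp_radius_cauchy (fun m => a0 m.+1) ar1 (normr_ge0 t) tr e0.
  exists N => // n /= Nn; have := HN n.+1 n Nn (leqnSn n); rewrite big_nat1 => H.
  by rewrite sub0r normrN ger0_norm// mulr_ge0// texp_ge0.
rewrite -(cvg_shiftn 1); under eq_fun do rewrite addn1.
apply/cvgrPdist_lt => e e0; move/cvgrPdist_lt: c0 => /(_ e e0).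
apply: filterS => N /=; rewrite sub0r normrN => cN; apply: le_lt_trans cN.
rewrite (_ : \sum_(m < N.+1) _ = psi N 0); last first.
  by apply: eq_bigr => m _; rewrite subr0.
by apply: le_trans (rem N) _; exact: ler_norm.
Qed.

End Taylor.

(** * The vector field on the kernel space and its flow *)

Section VectorField.
Context {R : realType} {X : topologicalType} {d : nat} (atlas : set (chart R X d)).
Context (V : (X -> R) -> X -> R) (hV : smooth_vector_field atlas V).
Context (Phi : R -> X -> X) (hPhi : flow_generated_by atlas V Phi).
Context (H : rkhs R X) (hsmooth : forall f : H, smoothC atlas (ev f)).
Context (D : set H) (sD : linear_subspace D) (dD : dense D).
Hypothesis hD : D `<=` op_dom (Vop V H) `&` op_dom (op_adjoint (Vop V H)).
Hypothesis VD : forall f, D f -> D (op_app (Vop V H) f).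

Notation a := (op_app (Vop V H)).
Notation b := (op_app (op_adjoint (Vop V H))).

Lemma ev_linear c (f g : H) x : ev (c *: f + g) x = c * ev f x + ev g x.
Proof. by rewrite !reproducing dotDr dotZr. Qed.

Lemma op_appP (E F : pointedType) (G : set (E * F)) x : op_dom G x -> G (x, op_app G x).
Proof. by move=> [y Gy]; exact: (@getPex _ [set y | G (x, y)] (ex_intro _ y Gy)). Qed.

Lemma ev_V f : D f -> ev (a f) = vfC V (ev f).
Proof. by move=> /hD[/op_appP]. Qed.

(** [V] is only real linear on real functions. The scalar [p + i q] is treated in two steps, [p]
    first and [i q] next, each taking real and imaginary parts to real combinations of smooth
    functions. *)
Lemma vfC_linear c (f g : H) x : vfC V (ev (c *: f + g)) x =
  c * vfC V (ev f) x + vfC V (ev g) x.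
Proof.
have [Vlin _ _] := hV; case: c => p q.
have [fr fi] := hsmooth f; have [gr gi] := hsmooth g.
have [hr hi] := hsmooth ((0 +i* q) *: f + g).
have ReE y : complex.Re (ev ((p +i* q) *: f + g) y) =
    p * complex.Re (ev f y) + complex.Re (ev ((0 +i* q) *: f + g) y).
  by rewrite !ev_linear; case: (ev f y) => u v; case: (ev g y) => u' v' /=; ring.
have ImE y : complex.Im (ev ((p +i* q) *: f + g) y) =
    p * complex.Im (ev f y) + complex.Im (ev ((0 +i* q) *: f + g) y).
  by rewrite !ev_linear; case: (ev f y) => u v; case: (ev g y) => u' v' /=; ring.
have ReE' y : complex.Re (ev ((0 +i* q) *: f + g) y) =
    - q * complex.Im (ev f y) + complex.Re (ev g y).
  by rewrite !ev_linear; case: (ev f y) => u v; case: (ev g y) => u' v' /=; ring.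
have ImE' y : complex.Im (ev ((0 +i* q) *: f + g) y) =
    q * complex.Re (ev f y) + complex.Im (ev g y).
  by rewrite !ev_linear; case: (ev f y) => u v; case: (ev g y) => u' v' /=; ring.
rewrite /vfC (funext ReE) (funext ImE) !Vlin// (funext ReE') (funext ImE') !Vlin//.
apply/eqP; rewrite eq_complex /=; apply/andP; split; apply/eqP; ring.
Qed.

Lemma V_linear c f g : D f -> D g -> a (c *: f + g) = c *: a f + a g.
Proof.
move=> Df Dg; apply: (@ev_inj _ _ H); apply/funext => x.
rewrite ev_linear !ev_V//; last exact: sD.2.
exact: vfC_linear.
Qed.

Lemma V_adjoint f g : D f -> D g -> dot (b f) g = dot f (a g).
Proof.
move=> /hD[_ /op_appP Df] /hD[/op_appP Dg _].
exact: (Df (g, a g) Dg).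
Qed.

Lemma Vadj_linear c f g : D f -> D g -> b (c *: f + g) = c *: b f + b g.
Proof.
move=> Df Dg; apply/eqP; rewrite -subr_eq0; apply/eqP; apply: (dense_orth dD) => h Dh.
rewrite dot_conj dotBl dotDl dotZl !V_adjoint ?dotDl ?dotZl ?subrr ?conjc0//.
exact: sD.2.
Qed.

(** Evaluate the complex series at the real point [rho]: its partial sums are real and nonnegative,
    and convergence bounds them. *)
Lemma word_radius f (r : R) (e : \bar R) : (r%:E <= e)%E ->
  jointly_analytic_on (Vop V H) f e ->
  exp_radius (fun k => word_nrm a b k f) r.
Proof.
move=> re an rho rho0 rhor.
have := an rho%:C; rewrite (_ : complex.Re `|rho%:C| = rho); last first.
  by rewrite normc_def /= expr0n addr0 sqrtr_sqr ger0_norm.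
have rhoe : (rho%:E < e)%E by apply: lt_le_trans re; rewrite lte_fin.
move=> /(_ rhoe) /cvg_ex[l /= Hl].
have /cvg_nrm Hn := Hl.
have : cvgn (fun N => nrm (series (fun n => rho%:C ^+ n / n`!%:R *
    \sum_(eps : n.-tuple bool) `|word (Vop V H) eps f|) N : R[i]^o)).
  by apply/cvg_ex; exists (nrm (l : R[i]^o)); exact: Hn.
move=> /cvg_seq_bounded[M [Mr HM]]; exists (M + 1) => N.
have := HM (M + 1); rewrite ltrDl => /(_ ltr01 N I) /=.
rewrite ger0_norm ?nrm_ge0//; congr (_ <= _).
rewrite /series /= big_mkord.
have -> : \sum_(k < N) (rho%:C ^+ k / k`!%:R * \sum_(eps : k.-tuple bool) `|word (Vop V H) eps f|) =
    (\sum_(k < N) word_nrm a b k f * texp rho k)%:C.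
  rewrite rmorph_sum; apply: eq_bigr => k _.
  rewrite -word_nrmE rmorphM /= mulrC; congr (_ * _).
    rewrite rmorph_sum; apply: eq_bigr => eps _; rewrite /= -nrmE /word.
    congr `| _ |; elim: (val eps) => [//|e' s IH] /=.
    by rewrite IH; case: e'.
  by rewrite /texp rmorphM rmorphXn fmorphV rmorph_nat.
rewrite nrmC ger0_norm// sumr_ge0// => k _.
by rewrite mulr_ge0 ?word_nrm_ge0// texp_ge0.
Qed.

(** Along the orbit of [x] the derivatives of [f] are the values of [V^m f], bounded by [C |V^m f|]
    uniformly in time; [taylor_cvg] applies to real and imaginary parts. *)
Lemma flow_series (C : R) f r t : 0 <= C ->
  (forall (g : H) x, nrm (ev g x : R[i]^o) <= C * nrm g) ->
  D f -> exp_radius (fun m => nrm (iter m a f)) r -> `|t| < r ->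
  ev (eser (fun m => iter m a f) t) = ev f \o Phi t.
Proof.
move=> C0 HC Df fr tr; apply/funext => x /=.
have Dm m : D (iter m a f) by elim: m => [//|m IH] /=; exact: VD.
have [Phi0 _ dPhi] := hPhi.
have Car : exp_radius (fun m => C * nrm (iter m a f)) r.
  move=> rho rho0 rhor; have [B HB] := fr rho rho0 rhor; exists (C * B) => N.
  under eq_bigr do rewrite -mulrA.
  by rewrite -mulr_sumr; exact: ler_wpM2l.
have bR (z : R[i]) : `|complex.Re z| <= nrm (z : R[i]^o).
  by rewrite -lecR -nrmE normc_ge_Re.
have bI (z : R[i]) : `|complex.Im z| <= nrm (z : R[i]^o).
  have := bR (- 'i * z); rewrite (_ : nrm (_ : R[i]^o) = nrm (z : R[i]^o)).
    by case: z => u v /=; rewrite oppr0 mul0r mulN1r add0r opprK.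
  rewrite -[- 'i * z]/(- 'i *: (z : R[i]^o)) nrmZ (_ : nrm _ = 1) ?mul1r//.
  by rewrite /nrm normc_def /= oppr0 expr0n add0r sqrrN expr1n sqrtr1.
have tRe := @taylor_cvg R (fun m s => complex.Re (ev (iter m a f) (Phi s x)))
  (fun m => C * nrm (iter m a f)) r t.
have tIm := @taylor_cvg R (fun m s => complex.Im (ev (iter m a f) (Phi s x)))
  (fun m => C * nrm (iter m a f)) r t.
have cRe : \sum_(m < N) texp t m * complex.Re (ev (iter m a f) x) @[N --> \oo] -->
    complex.Re (ev f (Phi t x)).
  rewrite -[in X in X @ _](Phi0 x); apply: tRe => //.
    by move=> m s; rewrite /= ev_V//; apply: dPhi; exact: (hsmooth (iter m a f)).1.
  by move=> m s; apply: le_trans (bR _) (HC _ _).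
have cIm : \sum_(m < N) texp t m * complex.Im (ev (iter m a f) x) @[N --> \oo] -->
    complex.Im (ev f (Phi t x)).
  rewrite -[in X in X @ _](Phi0 x); apply: tIm => //.
    by move=> m s; rewrite /= ev_V//; apply: dPhi; exact: (hsmooth (iter m a f)).2.
  by move=> m s; apply: le_trans (bI _) (HC _ _).
have lE := eser_cvg fr tr; set y := eser _ _ in lE *.
have cE : dot (ksec H x) (\sum_(m < N) (texp t m)%:C *: iter m a f) @[N --> \oo] -->
    (dot (ksec H x) y : R[i]^o) by apply: cvg_dot => //; exact: cvg_cst.
have sumE N : dot (ksec H x) (\sum_(m < N) (texp t m)%:C *: iter m a f) =
    (\sum_(m < N) texp t m * complex.Re (ev (iter m a f) x)) +i*
    (\sum_(m < N) texp t m * complex.Im (ev (iter m a f) x)).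
  rewrite dot_sumr; elim: N => [|N IH]; first by rewrite !big_ord0.
  rewrite !big_ord_recr IH dotZr -reproducing /=.
  by case: (ev _ _) => u v /=; simpc.
have eR : complex.Re (ev y x) = complex.Re (ev f (Phi t x)).
  rewrite reproducing; apply: (cvgR_uniq (cvg_Re cE)).
  by under eq_fun do rewrite sumE.
have eI : complex.Im (ev y x) = complex.Im (ev f (Phi t x)).
  rewrite reproducing ImdotE.
  have cI : rdot (ksec H x) (- 'i *: \sum_(m < N) (texp t m)%:C *: iter m a f) @[N --> \oo]
      --> rdot (ksec H x) (- 'i *: y).
    by apply: cvg_rdot; [exact: cvg_cst|exact: cvgZc].
  apply: (cvgR_uniq cI); under eq_fun do rewrite -ImdotE sumE.
  exact: cIm.
by apply/eqP; rewrite eq_complex eR eI !eqxx.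
Qed.

Section Amplification.
Context (ell : ell2 R) (K : hilbert_tensor ell H).

(** At [e_j (x) f] only the summands [i = j - 1] and [i = j] contain a matrix unit that does not
    vanish. *)
Lemma Lop_jacobi : Lop K (Vop V H) D = jacobi_graph D a b (K := K).
Proof.
have colE j f : \sum_(i < j.+1)
     (tens K (matrix_unit i i.+1 (l2e ell j)) (sym_part (Vop V H) f)
      + tens K (matrix_unit i i (l2e ell j)) (anti_part (Vop V H) f)
      - tens K (matrix_unit i.+1 i (l2e ell j)) (sym_part (Vop V H) f)) =
    jacobi_column a b K j f.
  have mE i k : matrix_unit i k (l2e ell j) = (k == j)%:R *: l2e ell i.
    by rewrite /matrix_unit l2e_orthonormal.
  have tZ c x g : tens K (c *: x) g = c *: tens K x g by exact: (lfunZ _ _ (tens_linearl K g)).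
  rewrite big_ord_recr /= !mE !tZ eqxx (gtn_eqF (ltnSn j)) scale0r !scale1r add0r.
  rewrite /jacobi_column -addrA; congr (_ + _).
  case: j mE => [|j] mE; first by rewrite big_ord0.
  rewrite big_ord_recr /= !mE !tZ eqxx (ltn_eqF (ltnSn j)) !scale0r scale1r addr0 subr0.
  rewrite big1 ?add0r// => i _; rewrite !mE !tZ eqSS !ltn_eqF//; last first.
    by apply: leq_trans (ltn_ord i) _.
  by rewrite !scale0r addr0 subr0.
rewrite /Lop /jacobi_graph; congr lspan; apply/seteqP; split => p [j [f [Df ->]]];
  by exists j, f; rewrite colE.
Qed.

End Amplification.
End VectorField.

(** * The maps [En] and [p1Id] as a multiple of an isometry and the adjoint of an isometry *)

Section Compression.
Context {R : realType} {X : Type} {H : rkhs R X} (ell : ell2 R) (K : hilbert_tensor ell H).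

Lemma En_column (a b : H -> H) n f :
  column_seq a b K n (fun j => if (j < n)%N then (fib j.+1)%:R *: f else 0) 0%N = En K n f.
Proof.
rewrite /column_seq /column_vector /En addn0 /=.
apply: eq_bigr => i _; rewrite ltn_ord.
exact: (lfunZ _ _ (tens_linearr K _)).
Qed.

Lemma dot_En n f g :
  dot (En K n f) (En K n g) = (\sum_(i < n) (fib i.+1)%:R ^+ 2)%:C * dot f g.
Proof.
rewrite /En dot_suml rmorph_sum mulr_suml; apply: eq_bigr => i _.
rewrite dot_sumr (bigD1 i)// big1 => [|j ji]; last first.
  rewrite dotZl dotZr tens_dot l2e_orthonormal (_ : (_ == _) = false) ?mul0r ?mulr0//.
  by rewrite eq_sym; exact: negbTE ji.
rewrite [LHS]addr0 dotZl dotZr tens_dot l2e_orthonormal eqxx mul1r mulrA conjc_nat.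
by rewrite rmorphXn /= rmorph_nat expr2.
Qed.

(** The compression is the adjoint of the isometry [f |-> e_0 (x) f], with indices starting at 0. *)
Lemma p1Id_exists : exists P : K -> H, [/\ bounded_linear P,
  forall x f, P (tens K x f) = dot (l2e ell 0) x *: f &
  forall f y, dot (tens K (l2e ell 0) f) y = dot f (P y)].
Proof.
have e1 f : nrm (tens K (l2e ell 0) f) = nrm f.
  have : nrm (tens K (l2e ell 0) f) ^+ 2 = nrm f ^+ 2.
    by apply: complexI; rewrite -!dotxx tens_dot l2e_orthonormal eqxx mul1r.
  by move=> /eqP; rewrite eqrXn2 ?nrm_ge0// => /eqP.
have bJ : bounded_linear (tens K (l2e ell 0)).
  apply: (@bound_bounded_linear R H K _ 1); first exact: tens_linearr.
  by move=> x; rewrite mul1r e1.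
have [P bP PE] := adjoint_exists bJ; exists P; split=> // x f.
apply: dot_ext => y.
by rewrite -PE tens_dot dotZr.
Qed.

Lemma p1IdP : bounded_linear (p1Id K) /\
  forall x f, p1Id K (tens K x f) = dot (l2e ell 0) x *: f.
Proof.
have [P [bP PE _]] := p1Id_exists.
exact: (@getPex _ [set P : K -> H | bounded_linear P /\
  forall x f, P (tens K x f) = dot (l2e ell 0) x *: f] (ex_intro _ P (conj bP PE))).
Qed.

Lemma p1Id_adjoint f y : dot (tens K (l2e ell 0) f) y = dot f (p1Id K y).
Proof.
have [P [[lP cP] PE PJ]] := p1Id_exists; have [[lQ cQ] QE] := p1IdP.
rewrite PJ; congr dot; apply: (eq_dense (@tens_dense _ _ _ K) cP cQ) => x.
apply: (@lspan_min _ _ _ [set x | P x = p1Id K x]).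
  split=> [|c u v /= Pu Pv]; first by rewrite /= (lfun0 lP) (lfun0 lQ).
  by rewrite lP lQ Pu Pv.
by move=> _ [u [v ->]] /=; rewrite PE QE.
Qed.

Context (TH : tensor_powers H) (TK : tensor_powers K).

Lemma En_tensorable n : tensorable TH TK (En K n).
Proof.
apply: (tensorable_similarity TH TK (K := \sum_(i < n) (fib i.+1)%:R ^+ 2)).
  by apply: sumr_ge0 => i _; exact: sqr_ge0.
exact: dot_En.
Qed.

Lemma p1Id_tensorable : tensorable TK TH (p1Id K).
Proof.
apply: (tensorable_adjoint (J := tens K (l2e ell 0))); last exact: p1Id_adjoint.
apply: (tensorable_similarity TH TK (K := 1)) => // x y.
by rewrite tens_dot l2e_orthonormal eqxx.
Qed.

End Compression.

(** * A common radius and the limit *)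

Section Radius.
Context {R : realType}.

(** For nonzero [t], [3 |t| <= e] leaves room for [2 r] below [e] with [r > |t|]. For [t = 0] the
    inequality does not give [e > 0], and the least of the finitely many individual radii is
    used. *)
Lemma common_radius (I : finType) (s : I -> nat -> R) (t : R) (e : \bar R) :
  (`|t|%:E <= e * (3^-1)%:E)%E ->
  (forall i, exists2 r, 0 < r & exp_radius (s i) r) ->
  (forall q : R, (q%:E < e)%E -> forall i, exp_radius (s i) q) ->
  exists2 r, `|t| < r & forall i, exp_radius (s i) (2 * r).
Proof.
move=> te loc glob; have [->|t0] := eqVneq t 0.
  have /choice[g Hg] i : exists r : R, 0 < r /\ exp_radius (s i) r.
    by have [r r0 sr] := loc i; exists r.
  exists (\big[Order.min/1]_i g i / 2).
    rewrite normr0 divr_gt0// lt_bigmin// => i _; exact: (Hg i).1.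
  move=> i rho rho0; rewrite mulrC divfK// => rm; apply: (Hg i).2 => //.
  by apply: lt_le_trans rm _; exact: bigmin_le.
have t1 : 0 < `|t| by rewrite normr_gt0.
have te' : ((3 * `|t|)%:E <= e)%E.
  case: e te {glob} => [e||]; rewrite ?leey//.
    rewrite -EFinM !lee_fin; lra.
  by rewrite mulNyr gtr0_sg ?invr_gt0// mul1e.
(* Twice the new radius is [5/2 |t| < 3 |t|]. *)
exists (5 / 4 * `|t|); first lra.
move=> i; apply: glob.
by apply: lt_le_trans te'; rewrite lte_fin; lra.
Qed.

End Radius.

Theorem theorem14
  (R : realType)
  (* the manifold, the vector field and its flow *)
  (X : topologicalType) (d : nat) (atlas : set (chart R X d))
  (hX : smooth_manifold atlas)
  (V : (X -> R) -> X -> R) (hV : smooth_vector_field atlas V)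
  (Phi : R -> X -> X) (hPhi : flow_generated_by atlas V Phi)
  (* the RKHS *)
  (H : rkhs R X)
  (hsmooth : forall f : H, smoothC atlas (ev f))
  (hkernel : strictly_positive_definite (kernel_of H))
  (* standing assumption 1 *)
  (hVcont : continuous
     (fun f : H => vfC V (ev f) : {compact-open, X -> R[i]^o}))
  (Hinf : set H)
  (hHinf_sub : linear_subspace Hinf)
  (hHinf_dom : Hinf `<=` op_dom (Vop V H) `&` op_dom (op_adjoint (Vop V H)))
  (hHinf_dense : dense Hinf)
  (hHinf_V : forall f, Hinf f -> Hinf (op_app (Vop V H) f))
  (hHinf_Vadj : forall f, Hinf f -> Hinf (op_app (op_adjoint (Vop V H)) f))
  (hanalytic : forall f, Hinf f ->
     exists r : R, 0 < r /\ jointly_analytic_on (Vop V H) f r%:E)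
  (* standing assumption 2 *)
  (TH : tensor_powers H)
  (hrkha : is_rkha TH)
  (S : set H)
  (hS_sub : linear_subspace S)
  (hS_fin : finite_dimensional S)
  (hS_Hinf : S `<=` Hinf)
  (hS_dense : dense (Alg S))
  (hunital : exists one : H, forall x, ev one x = 1)
  (* the amplification of H and the weighted Fock spaces *)
  (ell : ell2 R) (K : hilbert_tensor ell H) (TK : tensor_powers K)
  (tau p : R) (htau : 0 < tau) (hp : 0 < p < 1)
  (FH : fock_space TH (weight tau p)) (FK : fock_space TK (weight tau p)) :
  let L := Lop K (Vop V H) Hinf in
  let expD := exp_group (closure (fock_derivation FK L)) in
  forall (f : FH) (t : R),
    Tsub FH S f ->
    (`|t|%:E <= joint_radius (Vop V H) S * (3^-1)%:E)%E ->
    let g := fun n : nat =>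
      fock_map FH (p1Id K) (expD t (fock_map FK (En K n) f)) in
    [/\ op_dom (koopman Phi H t) (mm f),
        (forall n, Tfin FH (g n)) &
        `|mm (g n) - op_app (koopman Phi H t) (mm f)| @[n --> \oo]
          --> (0 : R[i]^o)].
Proof.
have w0 n : weight tau p n != 0 by rewrite gt_eqF// expR_gt0.
have VD := hHinf_V; have VD' := hHinf_Vadj.
pose a := op_app (Vop V H); pose b := op_app (op_adjoint (Vop V H)).
have alin := V_linear hV hsmooth hHinf_sub hHinf_dom.
have ab := V_adjoint hHinf_dom.
have blin := Vadj_linear hHinf_sub hHinf_dense hHinf_dom.
move=> L expD f t fS tR g.
have LE : L = jacobi_graph Hinf a b (K := K) by exact: Lop_jacobi.
have sL : linear_subspace L by exact: lspan_subspace.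
have skL x y : L (x, y) -> rdot x y = 0 by rewrite LE; exact: jacobi_graph_skew.
have wr (h : H) : Hinf h -> exists2 r : R, 0 < r & exp_radius (fun k => word_nrm a b k h) r.
  move=> /hanalytic[r [r0 hr]]; exists r => //.
  exact: (word_radius _ hr).
have dL : dense (trajectory_start L) by rewrite LE; exact: jacobi_trajectory_dense.
have [[lexp _ _ _ _] _] := exp_group_fock FK sL skL dL.
have tE n := En_tensorable TH TK n.
have tP := p1Id_tensorable TH TK.
have [bP PE] := p1IdP K.
have [C C0 HC] := ev_bounded hrkha.
pose T n (h : FH) := expD t (fock_map FK (En K n) h).
(* The conclusion in a form closed under linear combinations: finite degree is included because [mm]
   and [fock_map] are known to be linear only there. *)
pose Q : set FH := [set h | [/\ Tfin FH h, (forall n, Tfin FK (T n h)) &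
  exists2 y : H, ev y = ev (mm h) \o Phi t &
    mm (fock_map FH (p1Id K) (T n h)) @[n --> \oo] --> y]].
suff Qf : Q f.
  have [_ Tf [y yE gy]] := Qf; split.
  - by exists y.
  - by move=> n; exact: (fock_map_Tfin FH w0 tP (Tf n)).
  have -> : op_app (koopman Phi H t) (mm f) = y.
    apply: (@ev_inj _ _ H); rewrite yE.
    exact: (@op_appP _ _ (koopman Phi H t) _ (ex_intro _ y yE)).
  apply/cvg_nrmP => e e0; move/cvg_nrmP: gy => /(_ e e0).
  apply: filterS => n; rewrite sub0r nrmN nrmE nrmC ger0_norm ?nrm_ge0//.
  by rewrite nrmBC.
have Tlin n c x y : Tfin FH x -> Tfin FH y -> T n (c *: x + y) = c *: T n x + T n y.
  by move=> Tx Ty; rewrite /T (fock_map_linear FK w0 (tE n))//; exact: lexp.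
have Qlin c x y : Q x -> Q y -> Q (c *: x + y).
  move=> [Fx Tx [x' xE gx]] [Fy Ty [y' yE gy]]; split.
  - exact: (Tfin_subspace FH).2.
  - by move=> n; rewrite Tlin//; exact: (Tfin_subspace FK).2.
  exists (c *: x' + y').
    apply/funext => z; rewrite /= mm_linear// !ev_linear xE yE.
    by [].
  under eq_fun => n.
    rewrite Tlin// (fock_map_linear FH w0 tP)// mm_linear//; try exact: (fock_map_Tfin FH w0 tP).
    over.
  by apply: cvgDc => //; exact: cvgZc.
have Qvee n (u : 'I_n -> H) : (forall i, S (u i)) -> Q (fvee FH u).
  move=> uS; have uD i : Hinf (u i) by exact/hS_Hinf/uS.
  have [||r tr ur] := @common_radius R 'I_n (fun i k => word_nrm a b k (u i)) t
      (joint_radius (Vop V H) S) tR.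
  - by move=> i; exact: wr.
  - move=> q /ereal_sup_gt[e eS qe] i; apply: (word_radius (ltW qe)).
    exact: eS.
  pose cs k i := column_seq a b K k
    (fun j => if (j < k)%N then (fib j.+1)%:R *: u i else 0).
  have csa k i : analytic_seq L r (cs k i).
    rewrite LE; apply: (@column_seq_analytic _ _ _ _ _ hHinf_sub VD VD' alin blin).
    - exact: uD.
    - exact: ur.
  have r0 : 0 < r by apply: le_lt_trans tr.
  have Tu k : T k (fvee FH u) = fvee FK (fun i => eser (cs k i) t).
    rewrite /T (fock_map_fvee FH FK w0 (tE k)).
    rewrite -(exp_group_fvee FK sL skL dL (fun i => eser_trajectory sL (csa k i)) tr).
    congr (expD t (fvee _ _)); apply/funext => i /=.
    by rewrite (eser0 (csa k i).2)// /cs En_column.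
  have gu k : mm (fock_map FH (p1Id K) (T k (fvee FH u))) =
      mult_map (tp TH (fun i => p1Id K (eser (cs k i) t))).
    by rewrite Tu (fock_map_fvee FK FH w0 tP) mm_fvee.
  have [[_ cM] HM] := mult_mapP hrkha hunital n.
  split.
  - exact: Tfin_fvee.
  - by move=> k; rewrite Tu; exact: Tfin_fvee.
  (* The limit is the product of the one-factor limits. Composition with the flow is multiplicative,
     so it represents the composed product. *)
  exists (mult_map (tp TH (fun i => eser (fun m => iter m a (u i)) t))).
    apply/funext => x; rewrite /= mm_fvee// !HM; apply: eq_bigr => i _.
    have ar : exp_radius (fun m => nrm (iter m a (u i))) r.
      apply: exp_radius_le (ur i) => [m|]; first exact: iter_word_nrm.
      by rewrite ler_peMl ?ltW// ltr1n.
    by rewrite (flow_series hPhi hsmooth hHinf_dom VD C0 HC (uD i) ar tr).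
  under eq_fun do rewrite gu.
  apply: continuous_cvg; first exact: cM.
  apply: tp_continuous => i.
  exact: (compression_cvg hHinf_sub VD VD' alin blin bP PE (uD i) (ur i) tr).
apply: (@lspan_min _ _ _ Q _ _ _ fS); last first.
  by move=> _ [n [u [uS ->]]]; exact: Qvee.
(* [Q] is nonempty, since it contains the empty product, and hence contains 0 as a difference. *)
split=> //; have Q0 : Q (fvee FH (fun i : 'I_0 => 0)) by apply: Qvee => - [].
by rewrite -(addNr (fvee FH (fun i : 'I_0 => 0))) -scaleN1r; exact: Qlin.
Qed.
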